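(* Assume the uniform minorization condition, the uniform drift condition and the Lipschitz perturbation condition, and that $g\in\mathscr{L}_{V^{r}}$ for some $r\in[0,\tfrac12)$. Let $\delta>-1$ be real, and consider the SMC algorithm without resampling with $N$ particles in dimension $d$ and $\lfloor d^{1+\delta}\rfloor$ bridging steps. Let $$\mathrm{ESS}_{(0,\lfloor d^{1+\delta}\rfloor)}(N)=\frac{\big(\sum_{i=1}^Nw^i\big)^2}{\sum_{i=1}^N(w^i)^2},\qquad w^i=\exp\Big\{\frac{1-\phi_0}{\lfloor d^{1+\delta}\rfloor}\sum_{j=1}^d\sum_{n=1}^{\lfloor d^{1+\delta}\rfloor}g(X^i_{n-1,j})\Big\}.$$ Then, for any fixed $N>1$, as $d\to\infty$: - if $\delta>0$ then $\mathrm{ESS}_{(0,\lfloor d^{1+\delta}\rfloor)}(N)\to N$ in probability; - if $-1<\delta<0$ then $\mathrm{ESS}_{(0,\lfloor d^{1+\delta}\rfloor)}(N)\to1$ in probability.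
   Context: Setting. $g:\mathbb R\to\mathbb R$ is measurable and bounded above, and $\pi(x)=e^{g(x)}$ is a probability density on $\mathbb R$ (Lebesgue measure). $\phi_0\in(0,1)$ is fixed. For $s\in[\phi_0,1]$, $\pi_s$ is the probability density $\pi_s(x)\propto e^{s\,g(x)}$ (assumed normalizable; the same symbol denotes the measure). For $s\in(\phi_0,1]$, $k_s$ is a Markov kernel on $(\mathbb R,\mathscr B(\mathbb R))$ with $\pi_sk_s=\pi_s$; by convention $k_{\phi_0}(x,\cdot)=\pi_{\phi_0}(\cdot)$. SMC without resampling, with $p=\lfloor d^{1+\delta}\rfloor$ steps. The annealing sequence is $\phi_n=\phi_0+n(1-\phi_0)/p$, $0\le n\le p$, and $k_n:=k_{\phi_n}$. There are $N$ particles $X^i_n=(X^i_{n,1},\dots,X^i_{n,d})$, $0\le n\le p$. The $Nd$ scalar chains $\{X^i_{n,j}\}_{n=0}^p$ are independent, each with $X^i_{0,j}\sim\pi_{\phi_0}$ and $X^i_{n,j}\mid X^i_{n-1,j}=x\sim k_n(x,\cdot)$. Notation. $P(f)(x)=\int P(x,dy)f(y)$ and $\mu(f)=\int f\,d\mu$. For $V:\mathbb R\to[1,\infty)$: $|f|_V=\sup_x|f(x)|/V(x)$, $\mathscr L_V=\{f:|f|_V<\infty\}$, and $|||P-Q|||_V=\sup_x V(x)^{-1}\sup_{|f|\le V}|P(f)(x)-Q(f)(x)|$. Uniform minorization condition: there are a Borel set $C$, $\theta\in(0,1)$ and a probability $\nu$ on $\mathbb R$ with $k_s(x,A)\ge\theta\,\nu(A)$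 for all $s\in(\phi_0,1]$, $x\in C$ and Borel $A$. Uniform drift condition: there are $V:\mathbb R\to[1,\infty)$ with $\lim_{|x|\to\infty}V(x)=\infty$, $\lambda<1$, $b<\infty$ such that, with the same $C$, $k_s(V)(x)\le\lambda V(x)+b\,\mathbb I_C(x)$ for all $x\in\mathbb R$, $s\in(\phi_0,1]$; moreover $\pi_{\phi_0}(V)<\infty$. Lipschitz perturbation condition: there is $M<\infty$ with $|||k_s-k_t|||_V\le M|s-t|$ for all $s,t\in(\phi_0,1]$ (same $V$). *)

(* Defs.v *)
From HB Require Import structures.
From mathcomp Require Import all_boot all_order all_algebra.
From mathcomp Require Import all_classical all_reals all_analysis.
From mathcomp Require Import measurable_realfun.

Set Implicit Arguments.
Unset Strict Implicit.
Unset Printing Implicit Defensive.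

Import Order.TTheory GRing.Theory Num.Theory.
Import numFieldNormedType.Exports.

Local Open Scope classical_set_scope.
Local Open Scope ring_scope.

Section tempering.
Context {R : realType}.
Local Notation RR := (measurableTypeR R).
Local Notation leb := (@lebesgue_measure R).
Implicit Types (g : {mfun RR >-> RR}) (s : R).

Definition normalizable g s : Prop :=
  (\int[leb]_x (expR (s * g x))%:E < +oo)%E.

Definition tempered_pdf g s (x : R) : R :=
  expR (s * g x) / Rintegral leb setT (fun y => expR (s * g y)).

Definition tempered g s (A : set RR) : \bar R :=
  (\int[leb]_(x in A) (tempered_pdf g s x)%:E)%E.

Lemma tempered_pdf_ge0 g s x : 0 <= tempered_pdf g s x.
Proof.
rewrite /tempered_pdf divr_ge0 ?expR_ge0// fine_ge0//.
by apply: integral_ge0 => y _; rewrite lee_fin expR_ge0.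
Qed.

Lemma measurable_expR_scale g s :
  measurable_fun [set: RR] (fun x => expR (s * g x) : RR).
Proof.
apply: measurableT_comp => //=; apply: measurable_funM => //=.
have := @measurable_funPT _ _ RR RR g; exact.
Qed.

Lemma measurable_tempered_pdf g s :
  measurable_fun [set: RR] (tempered_pdf g s : RR -> RR).
Proof.
by apply: measurable_funM => //=; exact: measurable_expR_scale.
Qed.

Let tempered0 g s : tempered g s set0 = 0%E.
Proof. by rewrite /tempered integral_set0. Qed.

Let tempered_ge0 g s A : (0 <= tempered g s A)%E.
Proof. by apply: integral_ge0 => x _; rewrite lee_fin tempered_pdf_ge0. Qed.

Let tempered_sigma_additive g s : semi_sigma_additive (tempered g s).
Proof.
move=> /= F mF tF mUF; rewrite /tempered ge0_integral_bigcup//=.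
- apply: is_cvg_ereal_nneg_natsum_cond => // n _ _.
  by apply: integral_ge0 => x _; rewrite lee_fin tempered_pdf_ge0.
- apply: measurable_funTS; apply/measurable_EFinP.
  exact: measurable_tempered_pdf.
- by move=> x _; rewrite lee_fin tempered_pdf_ge0.
Qed.

HB.instance Definition _ g s := isMeasure.Build _ _ _
  (tempered g s) (tempered0 g s) (@tempered_ge0 g s)
  (@tempered_sigma_additive g s).

Lemma tempered_setT g s : normalizable g s -> tempered g s setT = 1%E.
Proof.
move=> fin; rewrite /tempered /tempered_pdf.
have mE : measurable_fun [set: RR] (fun x : RR => (expR (s * g x))%:E).
  by apply/measurable_EFinP; exact: measurable_expR_scale.
have E0 x : [set: RR] x -> (0 <= (expR (s * g x))%:E)%E.
  by rewrite lee_fin expR_ge0.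
have Zge0 : (0 <= \int[leb]_x (expR (s * g x))%:E)%E.
  by apply: integral_ge0.
have Zneq0 : (\int[leb]_x (expR (s * g x))%:E)%E != 0%E.
  apply/eqP => Z0.
  have /(ae_eq_integral_abs leb measurableT mE)[N [mN N0 sN]] :
      (\int[leb]_x `|(expR (s * g x))%:E| = 0)%E.
    by rewrite -[RHS]Z0; apply: eq_integral => x _; rewrite gee0_abs// E0.
  have TN : N = setT.
    apply/seteqP; split => // x _; apply: sN => /= /(_ I) [] /eqP.
    by rewrite gt_eqF// expR_gt0.
  have := @lebesgue_measure_itv R `[0, 1]; rewrite /= lte_fin ltr01 => h.
  have : (leb `[0%R, 1%R] <= leb N)%E by apply: le_measure => //; rewrite ?inE ?TN.
  by rewrite N0 h oppr0 adde0 lee_fin ler10.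
under eq_integral do rewrite EFinM.
have fi : (\int[leb]_x (expR (s * g x))%:E)%E \is a fin_num.
  by rewrite ge0_fin_numE.
rewrite ge0_integralZr//; last by rewrite lee_fin invr_ge0 fine_ge0.
rewrite /Rintegral -{1}(fineK fi) -EFinM divff// fine_eq0//.
Qed.

End tempering.

Section weighted_norms.
Context {R : realType}.
Local Notation RR := (measurableTypeR R).
Implicit Types (P Q : R.-pker RR ~> RR) (V f : R -> R).

Definition kact P f (x : R) : \bar R := (\int[P x]_y (f y)%:E)%E.

Definition Vnorm V f : \bar R :=
  ereal_sup [set (`|f x| / V x)%:E | x in [set: R]].

Definition LV V f : Prop := (Vnorm V f < +oo)%E.

Definition Vdist V P Q : \bar R :=
  ereal_sup [set ((V x)^-1%:E *
      ereal_sup [set `|kact P f x - kact Q f x| | f in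
        [set f : R -> R | measurable_fun [set: RR] (f : RR -> RR) /\
                          forall y, (`|f y| <= V y)%R]])%E | x in [set: R]].

End weighted_norms.

Section kernel_conditions.
Context {R : realType}.
Local Notation RR := (measurableTypeR R).
Implicit Types (g : {mfun RR >-> RR}) (k : R -> R.-pker RR ~> RR).
Implicit Types (C : set RR) (V : R -> R).

Definition invariant_kernel (mu : {measure set RR -> \bar R})
    (K : R.-pker RR ~> RR) : Prop :=
  forall A, measurable A -> (\int[mu]_x K x A)%E = mu A.

Definition uniform_minorization (phi0 : R) k C : Prop :=
  measurable C /\
  exists (theta : R) (nu : probability RR R), 0 < theta < 1 /\
    forall s x A, phi0 < s <= 1 -> C x -> measurable A ->
      (theta%:E * nu A <= k s x A)%E.

Definition uniform_drift (phi0 : R) g k C V : Prop :=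
  [/\ measurable_fun [set: RR] (V : RR -> RR),
      forall x, 1 <= V x,
      V x @[x --> +oo] --> +oo /\ V x @[x --> -oo] --> +oo,
      exists lambda b : R, lambda < 1 /\
        forall x s, phi0 < s <= 1 ->
          (kact (k s) V x <= (lambda * V x + b * \1_C x)%:E)%E
    & (\int[tempered g phi0]_x (V x)%:E < +oo)%E].

Definition Lipschitz_perturbation (phi0 : R) k V : Prop :=
  exists M : R, forall s t, phi0 < s <= 1 -> phi0 < t <= 1 ->
    (Vdist V (k s) (k t) <= (M * `|s - t|)%:E)%E.

End kernel_conditions.

Section processes.
Context {R : realType}.
Local Notation RR := (measurableTypeR R).

Section one_space.
Context (d : measure_display) (Omega : measurableType d).
Variable P : probability Omega R.

(* The sigma-algebra generated by Y 0, ..., Y n. *)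
Definition history (Y : nat -> Omega -> R) (n : nat) : set (set Omega) :=
  <<s [set F | exists m (A : set RR),
         [/\ (m <= n)%N, measurable A & F = Y m @^-1` A] ]>>.

(* Initial law mu, and given Y 0, ..., Y n the law of Y n.+1 is
   K n.+1 (Y n) -- that is, the conditional probability of Y n.+1 \in A given
   history Y n has the version K n.+1 (Y n) A.  The index 0 of K is unused. *)
Definition markov_chain (mu : set RR -> \bar R)
    (K : nat -> R.-pker RR ~> RR) (p : nat) (Y : nat -> Omega -> R) : Prop :=
  (forall A, measurable A -> P (Y 0%N @^-1` A) = mu A) /\
  forall n, (n < p)%N -> forall F, history Y n F -> forall A, measurable A ->
    P (F `&` Y n.+1 @^-1` A) = (\int[P]_(w in F) K n.+1 (Y n w) A)%E.

(* Subfamilies are covered by taking F i = setT outside the subfamily. *)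
Definition independent_chains (I : finType) (p : nat)
    (Y : I -> nat -> Omega -> R) : Prop :=
  forall F : I -> set Omega, (forall i, history (Y i) p (F i)) ->
    P (\bigcap_(i in [set: I]) F i) = (\prod_(i : I) P (F i))%E.

Definition annealing (phi0 : R) (p n : nat) : R :=
  phi0 + n%:R * (1 - phi0) / p%:R.

(* X i j n is the j-th coordinate of particle i after n steps. *)
Definition smc_without_resampling (g : {mfun RR >-> RR})
    (k : R -> R.-pker RR ~> RR) (phi0 : R) (N dim p : nat)
    (X : 'I_N -> 'I_dim -> nat -> {RV P >-> RR}) : Prop :=
  (forall i j, markov_chain (tempered g phi0)
                 (fun n => k (annealing phi0 p n)) p (X i j)) /\
  independent_chains p (fun ij : 'I_N * 'I_dim => (X ij.1 ij.2 : nat -> _ -> _)).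

Definition smc_weight (g : R -> R) (phi0 : R) (N dim p : nat)
    (X : 'I_N -> 'I_dim -> nat -> {RV P >-> RR}) (i : 'I_N) (w : Omega) : R :=
  expR ((1 - phi0) / p%:R *
        \sum_(j < dim) \sum_(1 <= n < p.+1) g (X i j n.-1 w)).

Definition ESS (g : R -> R) (phi0 : R) (N dim p : nat)
    (X : 'I_N -> 'I_dim -> nat -> {RV P >-> RR}) (w : Omega) : R :=
  (\sum_(i < N) smc_weight g phi0 p X i w) ^+ 2 /
  \sum_(i < N) smc_weight g phi0 p X i w ^+ 2.

End one_space.

(* Convergence in probability to a constant; each term of the sequence lives on
   its own probability space. *)
Definition cvg_in_probability (disp : nat -> measure_display)
    (Omega : forall d, measurableType (disp d))
    (P : forall d, probability (Omega d) R)
    (Y : forall d, Omega d -> R) (l : R) : Prop :=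
  forall eps : R, 0 < eps ->
    P d [set w | eps <= `|Y d w - l|] @[d --> \oo] --> 0%E.

Definition bridging_steps (delta : R) (d : nat) : nat :=
  Num.truncn (d%:R `^ (1 + delta)).

End processes.

(* Main.v *)
(* The log-weight of a particle is (1 - phi0) / p times the sum of d independent
   copies of S, the sum of g along an inhomogeneous chain of length p whose
   kernels change by O(1 / p) at each step.

   Variance. Since |g| <= G sqrt V, the drift and minorization conditions bound
   the solution of a time-dependent Poisson equation by a multiple of sqrt V, so
   that S has variance O(p) (on windows of length proportional to p the kernels
   are close enough for the recursion to close up).  The log-weight thus has
   variance O(d / p).  If d / p -> 0, all log-weights are close to a common
   constant and the ESS tends to N.

   Non-degeneracy. The mean of g under pi_s is strictly increasing in s, because
   g is not almost everywhere constant (pi is integrable on a space of infinite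
   measure).  If for two close parameters s and t the sum of g over a
   regeneration block of length l were essentially deterministic for every l, it
   would be l pi_s(g) + O(1), respectively l pi_t(g) + O(1), and closeness of the
   kernels would force pi_s(g) = pi_t(g).  So at some s0 the block sums charge two
   separated intervals.  Each block run near s0 then multiplies the modulus of the
   characteristic function of S at frequency a / p by a factor 1 - c a^2 / p^2,
   and the order p such blocks give a bound 1 - c' a^2 / p.

   If d / p -> infinity, the difference of the log-weights of two particles has a
   characteristic function bounded by (1 - c' a^2 / p)^(2 d) -> 0 at every
   frequency, so by a Fejer kernel it lies in any fixed interval with vanishing
   probability: one weight dominates all the others and the ESS tends to 1. *)
Require Import Defs.
From HB Require Import structures.
From mathcomp Require Import all_boot all_order all_algebra.
From mathcomp Require Import all_classical all_reals all_analysis.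
From mathcomp Require Import measurable_realfun zify ring lra.

Set Implicit Arguments.
Unset Strict Implicit.
Unset Printing Implicit Defensive.

Import Order.TTheory GRing.Theory Num.Theory.
Import numFieldNormedType.Exports.

Local Open Scope classical_set_scope.
Local Open Scope ring_scope.

(** * Integrals against weights and the kernel operators *)

Section weighted_integrals.
Context {R : realType}.
Local Notation RR := (measurableTypeR R).
Implicit Types (V f h : R -> R) (mu : {measure set RR -> \bar R}).

(** All estimates are made on operators acting on real functions of a pair (accumulated sum, current
    position), by backward recursion over the steps; random variables enter only afterwards, through
    an identity between expectations and these operators. The test functions are bounded (cosines,
    indicators, truncated squares) and only their majorants, built from [V], are unbounded. The
    condition r < 1/2 enters as [|g| <= G * sqrt V]: a product of two quantities of size [sqrt V] is
    of order [V], the function that the drift controls. Two obstacles shape the contraction. A start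
    far from [C] delays the first regeneration, so bounds of the form 1 - beta + rho t^2 V are
    propagated, in which the drift pays for such starts. And the parameters move, so a fixed
    fraction of the path has to carry the whole contraction, the other steps merely not spoiling it.
    The phase of the characteristic function is handled by translating a cosine in the sum
    variable. *)

Definition Vdom V f : Prop :=
  measurable_fun [set: RR] (f : RR -> RR) /\
  exists c : R, forall x, `|f x| <= c * V x.

Definition Vprob V mu : Prop :=
  mu setT = 1%E /\ (\int[mu]_x (V x)%:E < +oo)%E.

Section fixed_weight.
Context (V : R -> R) (mV : measurable_fun [set: RR] (V : RR -> RR))
  (V1 : forall x, 1 <= V x).

Let V0 x : 0 <= V x. Proof. exact: le_trans (V1 x). Qed.

Lemma VdomV : Vdom V V.
Proof. by split => //; exists 1 => x; rewrite mul1r ger0_norm. Qed.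

Lemma Vdom_bounded f c : measurable_fun [set: RR] (f : RR -> RR) ->
  (forall x, `|f x| <= c) -> Vdom V f.
Proof.
move=> mf fc; split=> //; exists c => x; rewrite (le_trans (fc x))//.
by rewrite ler_peMr// (le_trans _ (fc x)).
Qed.

Lemma Vdom_cst c : Vdom V (fun _ => c).
Proof. by apply: (@Vdom_bounded _ `|c|) => //. Qed.

Lemma VdomD f h : Vdom V f -> Vdom V h -> Vdom V (fun x => f x + h x).
Proof.
move=> [mf [c fc]] [mh [e he]]; split; first exact: measurable_funD.
exists (c + e) => x; rewrite mulrDl (le_trans (ler_normD _ _))//.
exact: lerD.
Qed.

Lemma VdomZ a f : Vdom V f -> Vdom V (fun x => a * f x).
Proof.
move=> [mf [c fc]]; split; first exact: measurable_funM.
by exists (`|a| * c) => x; rewrite normrM -mulrA ler_wpM2l.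
Qed.

Lemma VdomN f : Vdom V f -> Vdom V (fun x => - f x).
Proof.
move=> [mf [c fc]]; split; first exact: measurableT_comp.
by exists c => x; rewrite normrN.
Qed.

Lemma VdomB f h : Vdom V f -> Vdom V h -> Vdom V (fun x => f x - h x).
Proof. by move=> df dh; apply: VdomD => //; exact: VdomN. Qed.

Lemma Vdom_norm f : Vdom V f -> Vdom V (fun x => `|f x|).
Proof.
move=> [mf [c fc]]; split; first exact: measurableT_comp.
by exists c => x; rewrite normr_id.
Qed.

Lemma Vdom_le f h : measurable_fun [set: RR] (f : RR -> RR) -> Vdom V h ->
  (forall x, `|f x| <= `|h x|) -> Vdom V f.
Proof.
move=> mf [mh [c hc]] fh; split=> //; exists c => x.
exact: le_trans (fh x) (hc x).
Qed.

Lemma Vdom_indic (A : set RR) : measurable A -> Vdom V \1_A.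
Proof.
move=> mA; apply: (@Vdom_bounded _ 1); first exact: measurable_indic.
by move=> x; rewrite indicE; case: (x \in A); rewrite ?normr1 ?normr0.
Qed.

Context (mu : {measure set RR -> \bar R}) (pmu : Vprob V mu).

Lemma Vdom_integrable f : Vdom V f -> mu.-integrable setT (EFin \o f).
Proof.
move=> [mf [c fc]].
have iV : mu.-integrable setT (EFin \o (fun x => c * V x)).
  have : mu.-integrable setT (EFin \o V).
    apply/integrableP; split; first exact/measurable_EFinP.
    under eq_integral do rewrite /= ger0_norm//.
    by case: pmu.
  move=> /(integrableZl measurableT c); apply: eq_integrable => //.
apply: le_integrable iV => //; first exact/measurable_EFinP.
by move=> x _ /=; rewrite lee_fin (le_trans (fc x))// ler_norm.
Qed.

Lemma Vdom_integralE f : Vdom V f ->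
  (\int[mu]_x (f x)%:E = (\int[mu]_x f x)%:E)%E.
Proof.
by move=> df; rewrite /Rintegral fineK// integrable_fin_num//; exact: Vdom_integrable.
Qed.

Lemma VintD f h : Vdom V f -> Vdom V h ->
  \int[mu]_x (f x + h x) = \int[mu]_x f x + \int[mu]_x h x.
Proof. by move=> df dh; rewrite RintegralD//; exact: Vdom_integrable. Qed.

Lemma VintB f h : Vdom V f -> Vdom V h ->
  \int[mu]_x (f x - h x) = \int[mu]_x f x - \int[mu]_x h x.
Proof. by move=> df dh; rewrite RintegralB//; exact: Vdom_integrable. Qed.

Lemma VintZ a f : Vdom V f -> \int[mu]_x (a * f x) = a * \int[mu]_x f x.
Proof. by move=> df; rewrite RintegralZl//; exact: Vdom_integrable. Qed.

Lemma Vint_cst a : \int[mu]_x a = a.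
Proof. by rewrite Rintegral_cst// pmu.1 mulr1. Qed.

Lemma Vint_le f h : Vdom V f -> Vdom V h -> (forall x, f x <= h x) ->
  \int[mu]_x f x <= \int[mu]_x h x.
Proof. by move=> df dh fh; apply: le_Rintegral => //; exact: Vdom_integrable. Qed.

Lemma Vint_norm f : Vdom V f -> `|\int[mu]_x f x| <= \int[mu]_x `|f x|.
Proof. by move=> df; apply: le_normr_Rintegral => //; exact: Vdom_integrable. Qed.

End fixed_weight.
End weighted_integrals.

#[global] Hint Resolve Vdom_cst VdomV VdomD VdomZ VdomN VdomB Vdom_norm : vdom.

(** * Kernels under uniform drift, minorization and Lipschitz conditions *)

Section uniform_kernels.
Context {R : realType}.
Local Notation RR := (measurableTypeR R).

(** Normal form of the hypotheses over an abstract set [S] of parameters. The constants are enlarged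
    so that [lam] and [b] are positive, as square roots and quotients of them are taken. [dm_nuV]
    follows from minorization and drift; it is recorded because regeneration restarts the chain from
    [nu]. *)
Record drift_minor (S : set R) (k : R -> R.-pker RR ~> RR) (V : R -> R)
    (C : set RR) (nu : probability RR R) (theta lam b M : R) : Prop := {
  dm_mV : measurable_fun [set: RR] (V : RR -> RR);
  dm_V1 : forall x, 1 <= V x;
  dm_mC : measurable C;
  dm_theta : 0 < theta < 1;
  dm_lam : 0 < lam < 1;
  dm_b : 0 < b;
  dm_M : 0 <= M;
  dm_minor : forall s x A, S s -> C x -> measurable A ->
    (theta%:E * nu A <= k s x A)%E;
  dm_drift : forall s x, S s ->
    (kact (k s) V x <= (lam * V x + b * \1_C x)%:E)%E;
  dm_lip : forall s t, S s -> S t ->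
    (Vdist V (k s) (k t) <= (M * `|s - t|)%:E)%E;
  dm_nuV : (\int[nu]_x (V x)%:E < +oo)%E
}.

Definition kop (k : R -> R.-pker RR ~> RR) (s : R) (f : R -> R) (x : R) : R :=
  \int[k s x]_y f y.

Section theory.
Context (S : set R) (k : R -> R.-pker RR ~> RR) (V : R -> R)
  (C : set RR) (nu : probability RR R) (theta lam b M : R)
  (D : drift_minor S k V C nu theta lam b M).

Local Notation K := (kop k).
Local Notation dom := (Vdom V).

Let mV := dm_mV D.
Let V1 := dm_V1 D.

Lemma indicC01 (x : R) : 0 <= (\1_C x : R) <= 1.
Proof. by rewrite indicE; case: (x \in C); rewrite ?lexx ?ler01. Qed.

Lemma Vprob_k s x : S s -> Vprob V (k s x).
Proof.
move=> Ss; split; first exact: prob_kernel.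
exact: le_lt_trans (dm_drift D x Ss) (ltry _).
Qed.

Lemma Vprob_nu : Vprob V nu.
Proof. by split; [exact: probability_setT | exact: dm_nuV D]. Qed.

Lemma kopE s f x : S s -> dom f -> kact (k s) f x = (K s f x)%:E.
Proof. by move=> Ss df; rewrite /kact (Vdom_integralE mV V1 (Vprob_k x Ss) df). Qed.

Lemma kopD s f h x : S s -> dom f -> dom h ->
  K s (fun y => f y + h y) x = K s f x + K s h x.
Proof. by move=> Ss df dh; rewrite /kop (VintD mV V1 (Vprob_k x Ss)). Qed.

Lemma kopB s f h x : S s -> dom f -> dom h ->
  K s (fun y => f y - h y) x = K s f x - K s h x.
Proof. by move=> Ss df dh; rewrite /kop (VintB mV V1 (Vprob_k x Ss)). Qed.

Lemma kopZ s a f x : S s -> dom f ->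
  K s (fun y => a * f y) x = a * K s f x.
Proof. by move=> Ss df; rewrite /kop (VintZ mV V1 (Vprob_k x Ss)). Qed.

Lemma kop_cst s a x : S s -> K s (fun=> a) x = a.
Proof. by move=> Ss; rewrite /kop (Vint_cst (Vprob_k x Ss)). Qed.

Lemma kop_le s f h x : S s -> dom f -> dom h -> (forall y, f y <= h y) ->
  K s f x <= K s h x.
Proof. by move=> Ss df dh; apply: (Vint_le mV V1 (Vprob_k x Ss)). Qed.

Lemma kop_norm s f x : S s -> dom f ->
  `|K s f x| <= K s (fun y => `|f y|) x.
Proof. by move=> Ss; apply: (Vint_norm mV V1 (Vprob_k x Ss)). Qed.

Lemma kopV s x : S s -> K s V x <= lam * V x + b * \1_C x.
Proof.
move=> Ss; rewrite -lee_fin -kopE//; last by apply: VdomV.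
exact: (dm_drift D).
Qed.

Lemma kopV_le s x : S s -> K s V x <= lam * V x + b.
Proof.
move=> Ss; apply: (le_trans (kopV _ Ss)); rewrite lerD2l.
by rewrite ler_piMr ?(ltW (dm_b D))//; case/andP: (indicC01 x).
Qed.

Lemma kop_measurable s f : S s -> dom f ->
  measurable_fun [set: RR] (K s f : RR -> RR).
Proof.
move=> Ss df; have [mf [c fc]] := df.
have dV : dom V by apply: VdomV.
have dfV : dom (fun y => f y + c * V y).
  by apply: VdomD => //; apply: VdomZ.
(* [f + c V] and [c V] are nonnegative, the case in which integration against a kernel is known to
   be measurable. *)
rewrite (_ : K s f = fun x => K s (fun y => f y + c * V y) x - c * K s V x); last first.
  by apply/funext => x; rewrite kopD ?kopZ ?addrK//; exact: VdomZ.
have mk h : dom h -> (forall y, 0 <= h y) ->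
    measurable_fun [set: RR] (K s h : RR -> RR).
  move=> dh h0; apply: measurableT_comp => /=; first exact: fine_measurable.
  apply: (@measurable_fun_integral_kernel _ _ RR RR R (k s) _ (EFin \o h)).
  - by move=> U mU; exact: measurable_kernel.
  - by move=> z; rewrite /= lee_fin.
  - by apply/measurable_EFinP; exact: dh.1.
apply: measurable_funB.
  apply: mk => // y; have := fc y; rewrite ler_norml => /andP[+ _].
  by rewrite -subr_ge0 opprK.
apply: measurable_funM => //; apply: mk => // y.
exact: le_trans (V1 y).
Qed.

Lemma kop_dom s f : S s -> dom f -> dom (K s f).
Proof.
move=> Ss df; split; first exact: kop_measurable.
have [mf [c fc]] := df; exists (`|c| * (lam + b)) => x.
rewrite (le_trans (kop_norm x Ss df))//.
have dV : dom V by apply: VdomV.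
have : K s (fun y => `|f y|) x <= K s (fun y => `|c| * V y) x.
  apply: kop_le => //; [exact: Vdom_norm|exact: VdomZ|].
  move=> y; rewrite (le_trans (fc y))// ler_wpM2r ?ler_norm//.
  exact: le_trans (V1 y).
rewrite kopZ// => /le_trans; apply.
rewrite -mulrA ler_wpM2l// (le_trans (kopV_le x Ss))// mulrDl lerD2l.
by rewrite ler_peMr// ltW// (dm_b D).
Qed.

Lemma kop_minor s f x : S s -> dom f -> (forall y, 0 <= f y) -> C x ->
  theta * \int[nu]_y f y <= K s f x.
Proof.
move=> Ss df f0 Cx.
have t0 : 0 <= theta by case/andP: (dm_theta D) => /ltW.
rewrite -lee_fin EFinM -(Vdom_integralE mV V1 Vprob_nu df) -kopE// /kact.
have mf : measurable_fun [set: RR] (EFin \o f).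
  by apply/measurable_EFinP; exact: df.1.
have -> : theta%:E = (NngNum t0)%:num%:E by [].
rewrite -ge0_integral_mscale//; last by move=> y _; rewrite lee_fin.
by apply: ge0_le_measure_integral => // A mA; exact: (dm_minor D).
Qed.

(** [Vdist] tests functions bounded by [V] itself, so it is applied to [f / c]; for [c = 0] the
    function vanishes. *)
Lemma kop_lip s t f c x : S s -> S t ->
  measurable_fun [set: RR] (f : RR -> RR) -> 0 <= c ->
  (forall y, `|f y| <= c * V y) ->
  `|K s f x - K t f x| <= c * M * `|s - t| * V x.
Proof.
move=> Ss St mf c0 fc.
have df : dom f by split=> //; exists c.
have [c00|cn0] := eqVneq c 0.
  have f0 y : f y = 0.
    by apply/eqP; rewrite -normr_le0 (le_trans (fc y))// c00 mul0r.
  have -> : f = (fun=> 0) by apply/funext => y.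
  by rewrite !kop_cst// subrr normr0 c00 !mul0r.
have cp : 0 < c by rewrite lt_def cn0.
pose h y := c^-1 * f y.
have dh : dom h by apply: VdomZ.
have hV y : `|h y| <= V y.
  by rewrite normrM gtr0_norm ?invr_gt0// ler_pdivrMl.
have Vx0 : 0 < V x by exact: lt_le_trans (V1 x).
have : ((V x)^-1%:E * `|kact (k s) h x - kact (k t) h x| <= (M * `|s - t|)%:E)%E.
  apply: le_trans (dm_lip D Ss St).
  apply: (@le_trans _ _ ((V x)^-1%:E *
      ereal_sup [set `|kact (k s) f x - kact (k t) f x| | f in
        [set f : R -> R | measurable_fun [set: RR] (f : RR -> RR) /\
                          forall y, (`|f y| <= V y)%R]])%E).
    rewrite lee_pmul2l//; last by rewrite lte_fin invr_gt0.
    apply: ereal_sup_ubound; exists h => //; split => //; exact: dh.1.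
  by apply: ereal_sup_ubound; exists x.
rewrite !kopE// -EFinB abse_EFin -EFinM lee_fin.
rewrite ler_pdivrMl// !kopZ// -mulrBr normrM gtr0_norm ?invr_gt0//.
rewrite ler_pdivrMl// => /le_trans; apply.
by rewrite le_eqVlt; apply/orP; left; apply/eqP; ring.
Qed.

End theory.
End uniform_kernels.

(** * Path operators of the inhomogeneous chain *)

Section kernel_of_second.
Context d0 d1 d2 (T0 : measurableType d0) (T1 : measurableType d1)
  (T2 : measurableType d2) (R : realType).

(** Lets a kernel act on the second coordinate while the first, such as an accumulated sum, is
    carried along as a parameter. *)
Definition ksnd (K : R.-pker T1 ~> T2) (p : T0 * T1) :
  {measure set T2 -> \bar R} := K p.2.

Let measurable_ksnd (K : R.-pker T1 ~> T2) (U : set T2) : measurable U ->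
  measurable_fun [set: T0 * T1] (ksnd K ^~ U).
Proof.
move=> mU; rewrite (_ : (fun _ => _) = (K ^~ U) \o snd)//.
by apply: measurableT_comp => //; exact: measurable_kernel.
Qed.

HB.instance Definition _ (K : R.-pker T1 ~> T2) :=
  isKernel.Build _ _ (T0 * T1)%type T2 R (ksnd K) (@measurable_ksnd K).

Let ksndT (K : R.-pker T1 ~> T2) p : ksnd K p setT = 1%E.
Proof. exact: prob_kernel. Qed.

HB.instance Definition _ (K : R.-pker T1 ~> T2) :=
  Kernel_isProbability.Build _ _ (T0 * T1)%type T2 R (ksnd K) (@ksndT K).

End kernel_of_second.

Section path_operators.
Context {R : realType}.
Local Notation RR := (measurableTypeR R).

(** Bounded jointly measurable functions of an accumulated sum [z] and a position [x]. *)
Definition bjm (F : R -> R -> R) : Prop :=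
  measurable_fun [set: RR * RR] ((fun p => F p.1 p.2) : RR * RR -> RR) /\
  exists c : R, forall z x, `|F z x| <= c.

Definition z_only (f : R -> R) (z x : R) : R := f z.

Lemma bjm_section F z : bjm F -> measurable_fun [set: RR] (F z : RR -> RR).
Proof.
move=> [mF _]; rewrite (_ : F z = (fun p => F p.1 p.2) \o pair z)//.
by apply: measurableT_comp mF _; exact: pair1_measurable.
Qed.

Lemma bjmD F F' : bjm F -> bjm F' -> bjm (fun z x => F z x + F' z x).
Proof.
move=> [mF [c Fc]] [mF' [c' Fc']]; split; first exact: measurable_funD.
by exists (c + c') => z x; rewrite (le_trans (ler_normD _ _))// lerD.
Qed.

Lemma bjmM F F' : bjm F -> bjm F' -> bjm (fun z x => F z x * F' z x).
Proof.
move=> [mF [c Fc]] [mF' [c' Fc']]; split; first exact: measurable_funM.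
by exists (c * c') => z x; rewrite normrM ler_pM.
Qed.

Lemma bjm_cst a : bjm (fun _ _ => a).
Proof. by split => //; exists `|a|. Qed.

Lemma bjmZ a F : bjm F -> bjm (fun z x => a * F z x).
Proof. by move=> bF; apply: bjmM => //; exact: bjm_cst. Qed.

Lemma bjm_fst f c : measurable_fun [set: RR] (f : RR -> RR) ->
  (forall z, `|f z| <= c) -> bjm (z_only f).
Proof.
move=> mf fc; split; last by exists c => z x; exact: fc.
by rewrite (_ : (fun _ => _) = f \o fst)//; exact: measurableT_comp.
Qed.

Lemma bjm_snd f c : measurable_fun [set: RR] (f : RR -> RR) ->
  (forall z, `|f z| <= c) -> bjm (fun _ x => f x).
Proof.
move=> mf fc; split; last by exists c => z x; exact: fc.
by rewrite (_ : (fun _ => _) = f \o snd)//; exact: measurableT_comp.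
Qed.

Lemma bjm_indic_snd (A : set RR) : measurable A -> bjm (fun _ x => \1_A x).
Proof.
move=> mA; apply: (@bjm_snd \1_A 1); first exact: measurable_indic.
by move=> x; rewrite indicE; case: (x \in A); rewrite ?normr1 ?normr0.
Qed.

Lemma bjm_shift (g : R -> R) F : measurable_fun [set: RR] (g : RR -> RR) ->
  bjm F -> bjm (fun z x => F (z + g x) x).
Proof.
move=> mg [mF [c Fc]]; split; last by exists c => z x; exact: Fc.
rewrite (_ : (fun _ => _) = (fun p => F p.1 p.2) \o
  (fun p : RR * RR => (p.1 + g p.2 : RR, p.2)))//.
apply: measurableT_comp mF _; apply/measurable_fun_pairP; split => /=; last first.
  by rewrite (_ : _ \o _ = snd).
rewrite (_ : _ \o _ = (fun p : RR * RR => fst p + (g \o snd) p))//.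
by apply: measurable_funD => //; exact: measurableT_comp.
Qed.

Lemma bjm_translate a F : bjm F -> bjm (fun z x => F (z + a) x).
Proof. by move=> bF; exact: (@bjm_shift (fun=> a)). Qed.

Context (S : set R) (k : R -> R.-pker RR ~> RR) (V : R -> R)
  (C : set RR) (nu : probability RR R) (theta lam b M : R)
  (D : drift_minor S k V C nu theta lam b M).
Local Notation K := (kop k).
Local Notation dom := (Vdom V).

Let mV := dm_mV D.
Let V1 := dm_V1 D.
Let V0 x : 0 <= V x. Proof. exact: le_trans (V1 x). Qed.
Let lam0 : 0 <= lam. Proof. by case/andP: (dm_lam D) => /ltW. Qed.
Let b0 : 0 <= b. Proof. exact: ltW (dm_b D). Qed.

Lemma bjm_dom F z : bjm F -> dom (F z).
Proof.
move=> bF; have [_ [c Fc]] := bF.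
by apply: (@Vdom_bounded _ _ V1 _ c) => //; exact: bjm_section.
Qed.

Lemma bjm_kop s F : S s -> bjm F -> bjm (fun z x => K s (F z) x).
Proof.
move=> Ss bF; have [mF [c Fc]] := bF; split; last first.
  exists c => z x; have dF := @bjm_dom F z bF.
  rewrite (le_trans (kop_norm D x Ss dF))//.
  rewrite -[leRHS](kop_cst D c x Ss); apply: (kop_le D) => //.
    exact: Vdom_norm.
  exact: Vdom_cst.
rewrite (_ : (fun _ => _) =
    (fun p => K s (fun y => F p.1 y + c) p.2 - c)); last first.
  apply/funext => -[z x] /=; rewrite (kopD D) ?(kop_cst D) ?addrK//.
    exact: bjm_dom.
  exact: Vdom_cst.
apply: measurable_funB => //; apply: measurableT_comp => /=.
  exact: fine_measurable.
apply: (@measurable_fun_integral_finite_kernel _ _ (RR * RR)%type RR R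
  (fun p => (F p.1.1 p.2 + c)%:E) (@ksnd _ _ _ RR RR RR R (k s))).
  move=> p; rewrite lee_fin; have := Fc p.1.1 p.2.
  by rewrite ler_norml -lerBlDr sub0r => /andP[].
apply/measurable_EFinP; apply: measurable_funD => //.
rewrite (_ : (fun _ => _) = (fun p => F p.1 p.2) \o
  (fun p : (RR * RR) * RR => (p.1.1, p.2)))//.
apply: measurableT_comp mF _; apply/measurable_fun_pairP; split => /=.
  by rewrite (_ : _ \o _ = fst \o fst)//; exact: measurableT_comp.
by rewrite (_ : _ \o _ = snd).
Qed.

Context (g : R -> R) (mg : measurable_fun [set: RR] (g : RR -> RR)).

(* [Eop sg T m F z x] is the mean of [F] at (z + sum of g over the first T
   positions, last position), for the chain started at [x] whose i-th step
   uses the parameter [sg (m + i)], i = 1, ..., T. *)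
Fixpoint Eop (sg : nat -> R) (T m : nat) (F : R -> R -> R) (z x : R) : R :=
  if T is T'.+1 then K (sg m.+1) (Eop sg T' m.+1 F (z + g x)) x else F z x.

Fixpoint Pop (sg : nat -> R) (T m : nat) (h : R -> R) (x : R) : R :=
  if T is T'.+1 then K (sg m.+1) (Pop sg T' m.+1 h) x else h x.

Section fixed_parameters.
Context (sg : nat -> R) (Ssg : forall n, S (sg n)).
Local Notation E := (Eop sg).
Local Notation P := (Pop sg).

Lemma Eop_bjm T m F : bjm F -> bjm (E T m F).
Proof.
move=> bF; elim: T m => [|T IH] m //=.
have := bjm_kop (Ssg m.+1) (IH m.+1); exact: bjm_shift.
Qed.

Lemma Eop_dom T m F z : bjm F -> dom (E T m F z).
Proof. by move=> bF; apply: bjm_dom; exact: Eop_bjm. Qed.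

Lemma Eop_le T m F F' z x : bjm F -> bjm F' ->
  (forall z x, F z x <= F' z x) -> E T m F z x <= E T m F' z x.
Proof.
move=> bF bF' FF'; elim: T m z x => [|T IH] m z x //=.
by apply: (kop_le D) => //; exact: Eop_dom.
Qed.

Lemma EopD T m F F' z x : bjm F -> bjm F' ->
  E T m (fun z x => F z x + F' z x) z x = E T m F z x + E T m F' z x.
Proof.
move=> bF bF'; elim: T m z x => [|T IH] m z x //=.
rewrite -(kopD D)//; [|exact: Eop_dom|exact: Eop_dom].
by congr (K _ _ x); apply/funext => y.
Qed.

Lemma EopZ a T m F z x : bjm F ->
  E T m (fun z x => a * F z x) z x = a * E T m F z x.
Proof.
move=> bF; elim: T m z x => [|T IH] m z x //=.
rewrite -(kopZ D)//; last exact: Eop_dom.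
by congr (K _ _ x); apply/funext => y.
Qed.

Lemma Eop_cst a T m z x : E T m (fun _ _ => a) z x = a.
Proof.
elim: T m z x => [|T IH] m z x //=; rewrite -[RHS](kop_cst D a x (Ssg m.+1)).
by congr (K _ _ x); apply/funext => y.
Qed.

Lemma Eop_ge0 T m F z x : bjm F -> (forall z x, 0 <= F z x) -> 0 <= E T m F z x.
Proof.
by move=> bF F0; rewrite -(Eop_cst 0 T m z x); apply: Eop_le => //; exact: bjm_cst.
Qed.

(** The sum only accumulates and never influences the steps. *)
Lemma Eop_translate a T m F z x :
  E T m (fun z x => F (z + a) x) z x = E T m F (z + a) x.
Proof.
elim: T m z x => [|T IH] m z x //=.
by congr (K _ _ x); apply/funext => y; rewrite IH addrAC.
Qed.

Lemma Eop_cat T1 T2 m F z x :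
  E (T1 + T2)%N m F z x = E T1 m (E T2 (m + T1)%N F) z x.
Proof.
elim: T1 m z x => [|T1 IH] m z x /=; first by rewrite add0n addn0.
by congr (K _ _ x); apply/funext => y; rewrite IH addSnnS.
Qed.

Lemma Pop_dom T m h : dom h -> dom (P T m h).
Proof.
move=> dh; elim: T m => [|T IH] m //=; exact: (kop_dom D).
Qed.

Lemma Pop_le T m h h' x : dom h -> dom h' -> (forall x, h x <= h' x) ->
  P T m h x <= P T m h' x.
Proof.
move=> dh dh' hh'; elim: T m x => [|T IH] m x //=.
by apply: (kop_le D) => //; exact: Pop_dom.
Qed.

Lemma PopD T m h h' x : dom h -> dom h' ->
  P T m (fun x => h x + h' x) x = P T m h x + P T m h' x.
Proof.
move=> dh dh'; elim: T m x => [|T IH] m x //=.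
rewrite -(kopD D)//; [|exact: Pop_dom|exact: Pop_dom].
by congr (K _ _ x); apply/funext => y.
Qed.

Lemma PopZ a T m h x : dom h -> P T m (fun x => a * h x) x = a * P T m h x.
Proof.
move=> dh; elim: T m x => [|T IH] m x //=.
rewrite -(kopZ D)//; last exact: Pop_dom.
by congr (K _ _ x); apply/funext => y.
Qed.

Lemma Pop_cst a T m x : P T m (fun=> a) x = a.
Proof.
elim: T m x => [|T IH] m x //=; rewrite -[RHS](kop_cst D a x (Ssg m.+1)).
by congr (K _ _ x); apply/funext => y.
Qed.

Lemma Pop_cat T1 T2 m h x :
  P (T1 + T2)%N m h x = P T1 m (P T2 (m + T1)%N h) x.
Proof.
elim: T1 m x => [|T1 IH] m x /=; first by rewrite add0n addn0.
by congr (K _ _ x); apply/funext => y; rewrite IH addSnnS.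
Qed.

(** A majorant that depends on the position alone evolves by the chain itself; this is how unbounded
    functions of [V] come to bound the bounded [F]. *)
Lemma Eop_le_Pop T m F h z x : bjm F -> dom h ->
  (forall z x, F z x <= h x) -> E T m F z x <= P T m h x.
Proof.
move=> bF dh Fh; elim: T m z x => [|T IH] m z x //=.
by apply: (kop_le D) => //; [exact: Eop_dom|exact: Pop_dom].
Qed.

Lemma Eop_snd T m h z x : E T m (fun _ x => h x) z x = P T m h x.
Proof.
elim: T m z x => [|T IH] m z x //=.
by congr (K _ _ x); apply/funext => y.
Qed.

Lemma PopV T m x :
  P T m V x <= lam ^+ T * V x + b / (1 - lam) * (1 - lam ^+ T).
Proof.
have lam1 : 1 - lam != 0 by rewrite subr_eq0 gt_eqF//; case/andP: (dm_lam D).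
elim: T m x => [|T IH] m x /=; first by rewrite expr0 mul1r subrr mulr0 addr0.
set c := b / (1 - lam) * (1 - lam ^+ T).
have dV : dom V by exact: VdomV.
have le1 : K (sg m.+1) (P T m.+1 V) x <=
    K (sg m.+1) (fun y => lam ^+ T * V y + c) x.
  apply: (kop_le D) => //; first exact: Pop_dom.
  by apply: VdomD; [exact: VdomZ|exact: Vdom_cst].
apply: (le_trans le1); rewrite (kopD D)//; [|exact: VdomZ|exact: Vdom_cst].
rewrite (kopZ D)// (kop_cst D)//.
have := ler_wpM2l (exprn_ge0 T lam0) (kopV_le D x (Ssg m.+1)).
rewrite -(lerD2r c) => /le_trans; apply.
rewrite le_eqVlt /c; apply/orP; left; apply/eqP.
by rewrite exprS; field.
Qed.

Lemma PopV_le T m x : P T m V x <= V x + b / (1 - lam).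
Proof.
apply: (le_trans (PopV T m x)).
have lT : 0 <= lam ^+ T <= 1.
  rewrite exprn_ge0//= exprn_ile1// ltW//; by case/andP: (dm_lam D).
have bb : 0 <= b / (1 - lam).
  by rewrite divr_ge0// subr_ge0 ltW//; case/andP: (dm_lam D).
by case/andP: lT => l0 l1; apply: lerD; [rewrite ler_piMl|rewrite ler_piMr// gerBl].
Qed.

End fixed_parameters.

Lemma eq_Eop sg sg' T m m' F z x :
  (forall i, (0 < i <= T)%N -> sg (m + i)%N = sg' (m' + i)%N) ->
  Eop sg T m F z x = Eop sg' T m' F z x.
Proof.
elim: T m m' z x => [//|T IH] m m' z x ss' /=.
have -> : sg m.+1 = sg' m'.+1 by rewrite -addn1 (ss' 1%N)// addn1.
congr (K _ _ x); apply/funext => y; apply: IH => i /andP[i0 iT].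
by rewrite !addSnnS; apply: ss'.
Qed.

(** A step costs [M] for the change of kernel and inflates the error already present by [lam + b],
    since [K V <= lam V + b <= (lam + b) V]. No uniformity in [T] is claimed: the constant is
    applied to blocks of fixed length. *)
Fixpoint perturb_cst (T : nat) : R :=
  if T is T'.+1 then M + perturb_cst T' * (lam + b) else 0.

Lemma perturb_cst_ge0 T : 0 <= perturb_cst T.
Proof.
elim: T => [//|T IH] /=; rewrite addr_ge0 ?mulr_ge0 ?addr_ge0//.
exact: dm_M D.
Qed.

Lemma Eop_perturb sg sg' T m m' F e z x :
  (forall n, S (sg n)) -> (forall n, S (sg' n)) ->
  bjm F -> (forall z x, `|F z x| <= 1) -> 0 <= e ->
  (forall i, (0 < i <= T)%N -> `|sg (m + i)%N - sg' (m' + i)%N| <= e) ->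
  `|Eop sg T m F z x - Eop sg' T m' F z x| <= e * perturb_cst T * V x.
Proof.
move=> Ssg Ssg' bF F1 e0; elim: T m m' z x => [|T IH] m m' z x ss' /=.
  by rewrite subrr normr0 mulr0 mul0r.
set f := Eop sg T _ F _; set f' := Eop sg' T _ F _.
have df : dom f by exact: Eop_dom.
have df' : dom f' by exact: Eop_dom.
have dV : dom V by exact: VdomV.
have f1 y : `|f y| <= 1.
  rewrite /f ler_norml; apply/andP; split.
    rewrite -(Eop_cst Ssg (-1) T m.+1 (z + g x) y).
    apply: Eop_le => //; first exact: bjm_cst.
    by move=> z' y'; have := F1 z' y'; rewrite ler_norml => /andP[].
  rewrite -[leRHS](Eop_cst Ssg 1 T m.+1 (z + g x) y).
  apply: Eop_le => //; first exact: bjm_cst.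
  by move=> z' y'; have := F1 z' y'; rewrite ler_norml => /andP[].
have -> : K (sg m.+1) f x - K (sg' m'.+1) f' x =
    (K (sg m.+1) f x - K (sg' m'.+1) f x) + K (sg' m'.+1) (fun y => f y - f' y) x.
  by rewrite (kopB D)//; ring.
apply: (le_trans (ler_normD _ _)).
have e1 : `|sg m.+1 - sg' m'.+1| <= e by have := ss' 1%N isT; rewrite !addn1.
have A1 : `|K (sg m.+1) f x - K (sg' m'.+1) f x| <= e * M * V x.
  have := @kop_lip _ _ _ _ _ _ _ _ _ _ D (sg m.+1) (sg' m'.+1) f 1 x
    (Ssg _) (Ssg' _) df.1 ler01.
  move=> h; apply: (le_trans (h _)).
    by move=> y; rewrite mul1r (le_trans (f1 y)).
  rewrite mul1r mulrC mulrA -!mulrA [V x * _]mulrC !mulrA ler_wpM2r// mulrC.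
  by rewrite ler_wpM2r// (dm_M D).
have A2 : `|K (sg' m'.+1) (fun y => f y - f' y) x| <=
    e * perturb_cst T * ((lam + b) * V x).
  apply: (le_trans (kop_norm D x (Ssg' _) (VdomB df df'))).
  apply: (@le_trans _ _ (K (sg' m'.+1) (fun y => e * perturb_cst T * V y) x)).
    apply: (kop_le D) => //; [exact/Vdom_norm/VdomB|exact: VdomZ|].
    move=> y; apply: IH => i /andP[i0 iT].
    by rewrite !addSnnS; apply: ss'.
  rewrite (kopZ D)// ler_wpM2l ?mulr_ge0 ?perturb_cst_ge0//.
  apply: (le_trans (kopV_le D x (Ssg' _))).
  by rewrite mulrDl lerD2l ler_peMr.
apply: (le_trans (lerD A1 A2)).
by rewrite le_eqVlt; apply/orP; left; apply/eqP; ring.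
Qed.

End path_operators.

(** * Second moments of the path sums *)

Definition sqrtV {R : realType} (V : R -> R) (x : R) : R := Num.sqrt (V x).

Section partial_sums.
Context {R : realType}.
Local Notation RR := (measurableTypeR R).
Context (S : set R) (k : R -> R.-pker RR ~> RR) (V : R -> R)
  (C : set RR) (nu : probability RR R) (theta lam b M : R)
  (D : drift_minor S k V C nu theta lam b M).
Context (g : R -> R) (mg : measurable_fun [set: RR] (g : RR -> RR))
  (G : R) (gG : forall x, `|g x| <= G * sqrtV V x).
Local Notation K := (kop k).
Local Notation dom := (Vdom V).
Local Notation N f := (\int[nu]_y f y).

Let mV := dm_mV D.
Let V1 := dm_V1 D.
Let V0 x : 0 <= V x. Proof. exact: le_trans (V1 x). Qed.
Let lam0 : 0 < lam. Proof. by case/andP: (dm_lam D). Qed.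
Let lam1 : lam < 1. Proof. by case/andP: (dm_lam D). Qed.
Let b0 : 0 < b. Proof. exact: dm_b D. Qed.
Let theta0 : 0 < theta. Proof. by case/andP: (dm_theta D). Qed.
Let M0 : 0 <= M. Proof. exact: dm_M D. Qed.

Local Notation sV := (sqrtV V).

Let sV1 x : 1 <= sV x.
Proof. by rewrite /sqrtV -[leLHS]sqrtr1 ler_sqrt// (lt_le_trans _ (V1 x)). Qed.

Let sV0 x : 0 <= sV x. Proof. exact: sqrtr_ge0. Qed.

Let sVsq x : sV x ^+ 2 = V x. Proof. by rewrite /sqrtV sqr_sqrtr. Qed.

Let sV_le x : sV x <= V x.
Proof. by rewrite -[leRHS]sVsq expr2 ler_peMr. Qed.

Let dV : dom V. Proof. exact: VdomV. Qed.

Let dsV : dom sV.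
Proof.
apply: (Vdom_le _ dV).
  apply: (@measurableT_comp _ _ _ RR RR RR Num.sqrt) mV.
  by apply: continuous_measurable_fun; exact: sqrt_continuous.
by move=> x; rewrite !ger0_norm.
Qed.

Let G0 : 0 <= G.
Proof.
have := le_trans (normr_ge0 _) (gG 0).
by rewrite pmulr_lge0// (lt_le_trans _ (sV1 0)).
Qed.

Let dg : dom g.
Proof.
split=> //; exists G => x; rewrite (le_trans (gG x))//.
exact: ler_wpM2l.
Qed.

Local Notation l2 := (Num.sqrt lam).
Local Notation b2 := (Num.sqrt b).

Let l20 : 0 < l2. Proof. by rewrite sqrtr_gt0. Qed.
Let l21 : l2 < 1. Proof. by rewrite -[ltRHS]sqrtr1 ltr_sqrt. Qed.
Let b20 : 0 < b2. Proof. by rewrite sqrtr_gt0. Qed.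

(* Jensen: [0 <= K ((sV - c) ^ 2)] with c the square root of the drift bound. *)
Lemma kop_sqrtV s x : S s -> K s sV x <= l2 * sV x + b2 * \1_C x.
Proof.
move=> Ss; set q := lam * V x + b * \1_C x.
have i01 := indicC01 C x; case/andP: i01 => i0 i1.
have q0 : 0 < q.
  by rewrite ltr_wpDr ?mulr_ge0 ?(ltW b0)// mulr_gt0// (lt_le_trans _ (V1 x)).
set c := Num.sqrt q; have c0 : 0 < c by rewrite sqrtr_gt0.
have cc : c ^+ 2 = q by rewrite sqr_sqrtr// ltW.
have h : 0 <= K s (fun y => V y + - ((2 * c) * sV y - c ^+ 2)) x.
  rewrite -(kop_cst D 0 x Ss); apply: (kop_le D) => //.
  - exact: Vdom_cst.
  - by apply: VdomD => //; apply: VdomN; apply: VdomB; [exact: VdomZ|exact: Vdom_cst].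
  - move=> y; rewrite -sVsq (_ : _ + _ = (sV y - c) ^+ 2); last by ring.
    exact: sqr_ge0.
move: h; rewrite (kopB D)//; last by apply: VdomB; [exact: VdomZ|exact: Vdom_cst].
rewrite (kopB D)//; [|exact: VdomZ|exact: Vdom_cst].
rewrite (kopZ D)// (kop_cst D)// cc => h.
have Kc : K s sV x <= c.
  rewrite -(ler_pM2l c0) -expr2 cc.
  by have := kopV D x Ss; rewrite -/q; lra.
apply: (le_trans Kc); rewrite -ler_sqr ?nnegrE ?(ltW c0)//; last first.
  by rewrite addr_ge0// mulr_ge0// ltW.
rewrite cc sqrrD !exprMn sVsq !sqr_sqrtr ?(ltW lam0) ?(ltW b0)//.
have -> : (\1_C x : R) ^+ 2 = \1_C x.
  by rewrite indicE; case: (_ \in _); rewrite ?expr1n ?expr0n.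
by rewrite /q -addrA lerD2l lerDr mulrn_wge0// !mulr_ge0// ltW.
Qed.

(** [al] and [be] solve [1 + al * l2 = al] and [theta * be = al * b2]: the first absorbs a source
    term of size [sqrt V], the second makes the mass [theta * be] lost at a regeneration offset the
    excess [al * b2] of the drift on [C]. *)
Definition al : R := (1 - l2)^-1.
Definition be : R := al * b2 / theta.

Let al0 : 0 < al. Proof. by rewrite invr_gt0 subr_gt0. Qed.
Let be0 : 0 < be. Proof. by rewrite !mulr_gt0// invr_gt0. Qed.

Let albe0 : 0 <= al + be. Proof. by apply: addr_ge0; exact: ltW. Qed.

Let alE : 1 + al * l2 = al.
Proof.
have n0 : 1 - l2 != 0 by rewrite subr_eq0 gt_eqF.
by rewrite /al; field.
Qed.

Let beE : theta * be = al * b2.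
Proof. by rewrite /be mulrC mulfVK// gt_eqF. Qed.

Local Notation W := (fun x => al * sV x + be).

Let dW : dom W. Proof. by apply: VdomD; [exact: VdomZ|exact: Vdom_cst]. Qed.

(* [al * sqrt V + be] is a supersolution for the chain killed at regeneration. *)
Lemma poisson_bound s (q u : R -> R) c x : S s -> dom u -> N u = 0 -> 0 <= c ->
  (forall y, `|u y| <= c * W y) -> `|q x| <= c * sV x ->
  `|q x + K s u x| <= c * W x.
Proof.
move=> Ss du Nu c0 uc qx.
have dcW : dom (fun y => c * W y) by exact: VdomZ.
have KW : K s W x <= al * (l2 * sV x + b2 * \1_C x) + be.
  rewrite (kopD D)//; [|exact: VdomZ|exact: Vdom_cst].
  rewrite (kopZ D)// (kop_cst D)// lerD2r ler_wpM2l ?(ltW al0)//.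
  exact: kop_sqrtV.
have Ku : `|K s u x| <= c * (al * l2 * sV x + be).
  have [Cx|nCx] := pselect (C x); last first.
    apply: (le_trans (kop_norm D x Ss du)).
    apply: (@le_trans _ _ (K s (fun y => c * W y) x)).
      by apply: (kop_le D) => //; exact: Vdom_norm.
    rewrite (kopZ D)// ler_wpM2l// (le_trans KW)//.
    by rewrite indicE memNset//= mulr0 addr0 mulrA.
  have NW : theta * (c * be) <= theta * (c * N W).
    rewrite ler_wpM2l ?(ltW theta0)// ler_wpM2l//.
    rewrite -[leLHS](Vint_cst (Vprob_nu D)).
    apply: (Vint_le mV V1 (Vprob_nu D)) => //; first exact: Vdom_cst.
    by move=> y; rewrite lerDr mulr_ge0// ltW.
  have cKW : c * K s W x <= c * (al * l2 * sV x + be) + theta * (c * be).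
    apply: (le_trans (ler_wpM2l c0 KW)).
    rewrite indicE mem_set//= mulr1 mulrCA beE le_eqVlt; apply/orP; left.
    by apply/eqP; ring.
  rewrite ler_norml; apply/andP; split.
    (* Minorization is applied to the nonnegative functions [c W + u] and, below, [c W - u]. As [u]
       has [nu]-mean 0, both times at least [theta * c * be] is gained, which cancels the excess on
       [C]. *)
    have h : theta * N (fun y => c * W y + u y) <= K s (fun y => c * W y + u y) x.
      apply: (kop_minor D) => //; first exact: VdomD.
      by move=> y; have := uc y; rewrite ler_norml => /andP[h _]; lra.
    move: h; rewrite (VintD mV V1 (Vprob_nu D))// (VintZ mV V1 (Vprob_nu D))//.
    by rewrite Nu addr0 (kopD D)// (kopZ D)// => h; lra.
  have h : theta * N (fun y => c * W y - u y) <= K s (fun y => c * W y - u y) x.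
    apply: (kop_minor D) => //; first exact: VdomB.
    by move=> y; have := uc y; rewrite ler_norml => /andP[_ h]; lra.
  move: h; rewrite (VintB mV V1 (Vprob_nu D))// (VintZ mV V1 (Vprob_nu D))//.
  by rewrite Nu subr0 (kopB D)// (kopZ D)// => h; lra.
apply: (le_trans (ler_normD _ _)); apply: (le_trans (lerD qx Ku)).
rewrite /= (_ : al * sV x = (1 + al * l2) * sV x); last by rewrite alE.
by rewrite le_eqVlt; apply/orP; left; apply/eqP; ring.
Qed.

Fixpoint Hsum (sg : nat -> R) (T m : nat) (x : R) : R :=
  if T is T'.+1 then g x + K (sg m.+1) (Hsum sg T' m.+1) x else 0.

Section fixed_parameters.
Context (sg : nat -> R) (Ssg : forall n, S (sg n)).
Local Notation H := (Hsum sg).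
Local Notation bb := (b / (1 - lam)).

Let d1lam : 0 < 1 - lam. Proof. by rewrite subr_gt0. Qed.
Let bb0 : 0 < bb. Proof. by rewrite divr_gt0. Qed.
Let bbE : bb * (1 - lam) = b. Proof. by rewrite mulfVK// gt_eqF. Qed.

Lemma Hsum_dom T m : dom (H T m).
Proof.
elim: T m => [|T IH] m; first exact: Vdom_cst.
by apply: VdomD => //; exact: (kop_dom D).
Qed.

(** The centring that keeps [usum], the solution of the time-dependent Poisson equation [usumS], at
    [nu]-mean 0. It stands in for the mean of [g] under an invariant law. *)
Definition incr T m : R := N (H T.+1 m) - N (H T m.+1).
Definition usum T m x : R := H T m x - N (H T m).

Lemma usum_dom T m : dom (usum T m).
Proof. by apply: VdomB; [exact: Hsum_dom|exact: Vdom_cst]. Qed.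

Lemma usum_nu T m : N (usum T m) = 0.
Proof.
rewrite (VintB mV V1 (Vprob_nu D)) ?(Vint_cst (Vprob_nu D)) ?subrr//.
  exact: Hsum_dom.
exact: Vdom_cst.
Qed.

Lemma usumS T m x :
  usum T.+1 m x = (g x - incr T m) + K (sg m.+1) (usum T m.+1) x.
Proof.
rewrite /usum (kopB D)//; [|exact: Hsum_dom|exact: Vdom_cst].
by rewrite (kop_cst D)// /incr /=; ring.
Qed.

(** In [usumS] the source [g - incr] is of size [(G + L) sqrt V] and the data have [nu]-mean 0, so
    [poisson_bound] reproduces the same bound at every step, without growth in [T]. *)
Lemma usum_bound (L : R) T m x : 0 <= L ->
  (forall T' m', (T' < T)%N -> `|incr T' m'| <= L) ->
  `|usum T m x| <= (G + L) * W x.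
Proof.
move=> L0; elim: T m x => [|T IH] m x iL.
  rewrite /usum (Vint_cst (Vprob_nu D)) subrr normr0 mulr_ge0 ?addr_ge0//.
    by rewrite mulr_ge0// ltW.
  exact: ltW.
rewrite usumS.
apply: (@poisson_bound _ (fun y => g y - incr T m) (usum T m.+1) _ _ (Ssg m.+1)).
- exact: usum_dom.
- exact: usum_nu.
- exact: addr_ge0.
- by move=> y; apply: IH => T' m' TT'; apply: iL; exact: ltnW.
- apply: (le_trans (ler_normB _ _)); rewrite mulrDl lerD//.
  by rewrite (le_trans (iL T m _))// ler_peMr.
Qed.

(** The difference is the expected value of [g] at the last position alone, and [|g| <= G V]. *)
Lemma last_term_bound T m x :
  `|H T.+1 m x - H T m x| <= G * (lam ^+ T * V x + bb * (1 - lam ^+ T)).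
Proof.
elim: T m x => [|T IH] m x.
  rewrite /= (kop_cst D)// addr0 subr0 expr0 mul1r subrr mulr0 addr0.
  by rewrite (le_trans (gG x))// ler_wpM2l.
have -> : H T.+2 m x - H T.+1 m x =
    K (sg m.+1) (fun y => H T.+1 m.+1 y - H T m.+1 y) x.
  by rewrite (kopB D)//; [rewrite /=; ring|exact: Hsum_dom|exact: Hsum_dom].
have dd : dom (fun y => H T.+1 m.+1 y - H T m.+1 y).
  by apply: VdomB; exact: Hsum_dom.
apply: (le_trans (kop_norm D x (Ssg _) dd)).
set c := bb * (1 - lam ^+ T).
apply: (@le_trans _ _ (K (sg m.+1) (fun y => G * (lam ^+ T * V y + c)) x)).
  apply: (kop_le D) => //; first exact: Vdom_norm.
  by apply/VdomZ/VdomD; [exact: VdomZ|exact: Vdom_cst].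
rewrite (kopZ D)//; last by apply: VdomD; [exact: VdomZ|exact: Vdom_cst].
rewrite ler_wpM2l// (kopD D)//; [|exact: VdomZ|exact: Vdom_cst].
rewrite (kopZ D)// (kop_cst D)//.
have := ler_wpM2l (exprn_ge0 T (ltW lam0)) (kopV_le D x (Ssg m.+1)).
rewrite -(lerD2r c) => /le_trans; apply.
rewrite le_eqVlt /c -{1}bbE; apply/orP; left; apply/eqP.
by rewrite exprS; ring.
Qed.

(** Starting one index later changes each kernel by at most [M e]. The errors, each of size [V], add
    up along the path, and the drift sums them to [V / (1 - lam) + T * bb]. *)
Lemma shift_bound (A e : R) T m x : 0 <= A -> 0 <= e ->
  (forall n, `|sg n.+1 - sg n| <= e) ->
  (forall T' m' y, (T' < T)%N -> `|usum T' m' y| <= A * V y) ->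
  `|H T m x - H T m.+1 x| <= M * e * A * (V x / (1 - lam) + T%:R * bb).
Proof.
move=> A0 e0 se; elim: T m x => [|T IH] m x uA.
  rewrite /= subrr normr0 mulr_ge0 ?mulr_ge0//.
  by rewrite mul0r addr0 divr_ge0// ltW.
set u := usum T m.+1.
have du : dom u by exact: usum_dom.
have dH n : dom (H T n) by exact: Hsum_dom.
(* The two kernels are compared on the centred [u] instead of [H]: constants cancel in the
   difference, and [u] is bounded by [A V] whatever [T], while [H] may grow with [T]. *)
have -> : H T.+1 m x - H T.+1 m.+1 x =
    (K (sg m.+1) u x - K (sg m.+2) u x) +
    K (sg m.+2) (fun y => H T m.+1 y - H T m.+2 y) x.
  rewrite (kopB D)// /u /usum !(kopB D)//; [|exact: Vdom_cst|exact: Vdom_cst].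
  by rewrite !(kop_cst D)//=; ring.
apply: (le_trans (ler_normD _ _)).
have B1 : `|K (sg m.+1) u x - K (sg m.+2) u x| <= M * e * A * V x.
  have := @kop_lip _ _ _ _ _ _ _ _ _ _ D (sg m.+1) (sg m.+2) u A x
    (Ssg _) (Ssg _) du.1 A0.
  move=> h; apply: (le_trans (h _)); first by move=> y; apply: uA.
  rewrite ler_wpM2r// [A * M]mulrC -!mulrA ler_wpM2l// mulrC ler_wpM2r//.
  by rewrite distrC.
set dd := fun y => H T m.+1 y - H T m.+2 y.
have ddom : dom dd by apply: VdomB.
have B2 : `|K (sg m.+2) dd x| <=
    M * e * A * ((lam * V x + b) / (1 - lam) + T%:R * bb).
  apply: (le_trans (kop_norm D x (Ssg _) ddom)).
  apply: (@le_trans _ _ (K (sg m.+2)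
      (fun y => M * e * A * ((1 - lam)^-1 * V y + T%:R * bb)) x)).
    apply: (kop_le D) => //; first exact: Vdom_norm.
    - by apply/VdomZ/VdomD; [exact: VdomZ|exact: Vdom_cst].
    - move=> y; rewrite [_^-1 * _]mulrC; apply: IH => T' m' z TT'.
      by apply: uA; exact: ltnW.
  rewrite (kopZ D)//; last by apply: VdomD; [exact: VdomZ|exact: Vdom_cst].
  rewrite ler_wpM2l ?mulr_ge0// (kopD D)//; [|exact: VdomZ|exact: Vdom_cst].
  rewrite (kop_cst D)// (kopZ D)// lerD2r [leRHS]mulrC ler_wpM2l ?invr_ge0 ?(ltW d1lam)//.
  exact: (kopV_le D x (Ssg _)).
apply: (le_trans (lerD B1 B2)); rewrite -mulrDr ler_wpM2l ?mulr_ge0//.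
have n0 : 1 - lam != 0 by rewrite gt_eqF.
rewrite le_eqVlt; apply/orP; left; apply/eqP.
by rewrite -[T.+1]addn1 natrD; field.
Qed.

(** The solution [L] of [L = G (N V + bb) + (G + L) / 2], the inequality met in [incr_le] once the
    shift error is at most half of [G + L]. [mixing_cst] is the factor of [e T (G + L)] in that
    error, integrated against [nu]. *)
Definition incr_bound : R := 2 * G * (N V + bb) + G.
Definition mixing_cst : R := M * (al + be) * (N V / (1 - lam) + bb).

Let NV1 : 1 <= N V.
Proof.
rewrite -[leLHS](Vint_cst (Vprob_nu D)).
by apply: (Vint_le mV V1 (Vprob_nu D)) => //; exact: Vdom_cst.
Qed.

Let NV0 : 0 <= N V. Proof. exact: le_trans NV1. Qed.

Lemma mixing_cst_ge0 : 0 <= mixing_cst.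
Proof.
apply: mulr_ge0; first by apply: mulr_ge0 => //; apply: addr_ge0; exact: ltW.
by apply: addr_ge0; [apply: divr_ge0 => //|]; exact: ltW.
Qed.

Lemma incr_bound_ge0 : 0 <= incr_bound.
Proof. by rewrite addr_ge0// !mulr_ge0// addr_ge0// ltW. Qed.

Lemma W_le_V x : W x <= (al + be) * V x.
Proof.
rewrite mulrDl lerD//; first by rewrite ler_wpM2l// ltW.
by rewrite ler_peMr// ltW.
Qed.

(* Only short horizons: on longer ones the perturbation of the kernels
   accumulates, and the bound would not close up. *)
Lemma incr_le (e : R) T m : 0 <= e -> (forall n, `|sg n.+1 - sg n| <= e) ->
  e * T.+1%:R * mixing_cst <= 1 / 2 -> `|incr T m| <= incr_bound.
Proof.
move=> e0 se; move: m; elim/ltn_ind: T => T IH m eT.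
have kap0 := mixing_cst_ge0.
set L := incr_bound; set A := (G + L) * (al + be).
have L0 : 0 <= L := incr_bound_ge0.
have GL0 : 0 <= G + L by exact: addr_ge0.
have A0 : 0 <= A by exact: mulr_ge0.
have iL T' m' : (T' < T)%N -> `|incr T' m'| <= L.
  move=> TT'; apply: IH => //; apply: le_trans eT.
  by rewrite ler_wpM2r// ler_wpM2l// ler_nat ltnS ltnW.
have uA T' m' y : (T' < T)%N -> `|usum T' m' y| <= A * V y.
  move=> TT'; apply: (@le_trans _ _ ((G + L) * W y)).
    by apply: usum_bound => // T'' m'' T''T'; apply: iL; exact: ltn_trans TT'.
  by rewrite /A -mulrA; apply: ler_wpM2l; [exact: addr_ge0|exact: W_le_V].
have d1 : dom (fun x => H T.+1 m x - H T m x) by apply: VdomB; exact: Hsum_dom.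
have d2 : dom (fun x => H T m x - H T m.+1 x) by apply: VdomB; exact: Hsum_dom.
(* A last term is added, then all parameters are shifted by one index. The drift bounds the first
   part; [shift_bound] bounds the second, with the bounds on [usum] supplied by the induction
   hypothesis. *)
have -> : incr T m = N (fun x => H T.+1 m x - H T m x) + N (fun x => H T m x - H T m.+1 x).
  by rewrite !(VintB mV V1 (Vprob_nu D)); [rewrite /incr; ring|exact: Hsum_dom..].
apply: (le_trans (ler_normD _ _)).
have B1 : `|N (fun x => H T.+1 m x - H T m x)| <= G * (N V + bb).
  apply: (le_trans (Vint_norm mV V1 (Vprob_nu D) d1)).
  apply: (@le_trans _ _ (N (fun x => G * (V x + bb)))).
    apply: (Vint_le mV V1 (Vprob_nu D)); first exact: Vdom_norm.
      by apply/VdomZ/VdomD => //; exact: Vdom_cst.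
    move=> x; apply: (le_trans (last_term_bound T m x)); rewrite ler_wpM2l//.
    have lT0 : 0 <= lam ^+ T by rewrite exprn_ge0// ltW.
    apply: lerD; first by rewrite ler_piMl// exprn_ile1// ltW.
    by rewrite ler_piMr ?(ltW bb0)// gerBl.
  rewrite (VintZ mV V1 (Vprob_nu D)); last by apply: VdomD => //; exact: Vdom_cst.
  rewrite (VintD mV V1 (Vprob_nu D))//; last exact: Vdom_cst.
  by rewrite (Vint_cst (Vprob_nu D)).
have B2 : `|N (fun x => H T m x - H T m.+1 x)| <= 1 / 2 * (G + L).
  apply: (le_trans (Vint_norm mV V1 (Vprob_nu D) d2)).
  apply: (@le_trans _ _
      (N (fun x => M * e * A * ((1 - lam)^-1 * V x + T%:R * bb)))).
    apply: (Vint_le mV V1 (Vprob_nu D)); first exact: Vdom_norm.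
      by apply/VdomZ/VdomD => //; [exact: VdomZ|exact: Vdom_cst].
    by move=> x; rewrite [_^-1 * _]mulrC; exact: shift_bound.
  have dl : dom (fun x => (1 - lam)^-1 * V x) by exact: VdomZ.
  rewrite (VintZ mV V1 (Vprob_nu D)); last by apply: VdomD => //; exact: Vdom_cst.
  rewrite (VintD mV V1 (Vprob_nu D))//; last exact: Vdom_cst.
  rewrite (Vint_cst (Vprob_nu D)) (VintZ mV V1 (Vprob_nu D))//.
  apply: (@le_trans _ _ (e * T.+1%:R * mixing_cst * (G + L))); last first.
    by rewrite ler_wpM2r// addr_ge0.
  rewrite (_ : e * _ * _ * _ = M * e * A *
      (T.+1%:R * ((1 - lam)^-1 * N V) + T.+1%:R * bb)); last first.
    by rewrite /mixing_cst /A; ring.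
  rewrite ler_wpM2l ?mulr_ge0//; apply: lerD.
    by rewrite ler_peMl ?mulr_ge0 ?invr_ge0 ?(ltW d1lam)// ler1n.
  by rewrite ler_wpM2r ?(ltW bb0)// ler_nat.
apply: (le_trans (lerD B1 B2)); rewrite /L /incr_bound.
by rewrite -[2 * G * _]mulrA; lra.
Qed.

(* [usum] and [wsum] are the mean and the mean square of the path sum centred
   at [N (H T m)]. *)
Fixpoint wsum (T m : nat) (x : R) : R :=
  if T is T'.+1 then
    (g x - incr T' m) ^+ 2 +
    2 * (g x - incr T' m) * K (sg m.+1) (usum T' m.+1) x +
    K (sg m.+1) (wsum T' m.+1) x
  else 0.

Definition usum_cst : R := (G + incr_bound) * (al + be).
Definition wsum_cst : R :=
  (G + incr_bound) ^+ 2 + 2 * (G + incr_bound) * (usum_cst * (l2 + b2)).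

Lemma usum_cst_ge0 : 0 <= usum_cst.
Proof. by apply: mulr_ge0 => //; apply: addr_ge0 => //; exact: incr_bound_ge0. Qed.

Lemma wsum_cst_ge0 : 0 <= wsum_cst.
Proof.
have GL0 : 0 <= G + incr_bound by apply: addr_ge0 => //; exact: incr_bound_ge0.
apply: addr_ge0; first exact: sqr_ge0.
apply: mulr_ge0; first exact: mulr_ge0.
by apply: mulr_ge0; [exact: usum_cst_ge0|apply: addr_ge0; exact: ltW].
Qed.

Section short_horizon.
Context (e : R) (e0 : 0 <= e) (se : forall n, `|sg n.+1 - sg n| <= e)
  (T0 : nat) (eT0 : e * T0%:R * mixing_cst <= 1 / 2).

Let kap0 := mixing_cst_ge0.

Lemma incr_short T m : (T < T0)%N -> `|incr T m| <= incr_bound.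
Proof.
move=> TT0; apply: (@incr_le e) => //; apply: le_trans eT0.
by rewrite ler_wpM2r// ler_wpM2l// ler_nat.
Qed.

Lemma usum_short T m x : (T <= T0)%N -> `|usum T m x| <= usum_cst * sV x.
Proof.
move=> TT0; apply: (@le_trans _ _ ((G + incr_bound) * W x)).
  apply: usum_bound; first exact: incr_bound_ge0.
  by move=> T' m' T'T; apply: incr_short; exact: leq_trans TT0.
rewrite /usum_cst -mulrA; apply: ler_wpM2l.
  by apply: addr_ge0 => //; exact: incr_bound_ge0.
by rewrite /= mulrDl lerD2l ler_peMr// ltW.
Qed.

Lemma gincr_short T m x : (T < T0)%N ->
  `|g x - incr T m| <= (G + incr_bound) * sV x.
Proof.
move=> TT0; apply: (le_trans (ler_normB _ _)); rewrite mulrDl lerD//.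
by rewrite (le_trans (incr_short m TT0))// ler_peMr// incr_bound_ge0.
Qed.

(** Both factors of each product are of size [sqrt V], hence a bound by [V]: here the growth
    condition on [g] is spent. *)
Lemma wsum_step T m x : (T < T0)%N ->
  `|(g x - incr T m) ^+ 2 +
    2 * (g x - incr T m) * K (sg m.+1) (usum T m.+1) x| <= wsum_cst * V x.
Proof.
move=> TT0; have q := gincr_short m x TT0.
have GL0 : 0 <= G + incr_bound by rewrite addr_ge0// incr_bound_ge0.
have Ku : `|K (sg m.+1) (usum T m.+1) x| <= usum_cst * (l2 + b2) * sV x.
  apply: (le_trans (kop_norm D x (Ssg _) (usum_dom T m.+1))).
  apply: (@le_trans _ _ (K (sg m.+1) (fun y => usum_cst * sV y) x)).
    apply: (kop_le D) => //; [exact/Vdom_norm/usum_dom|exact: VdomZ|].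
    by move=> y; apply: usum_short; exact: ltnW.
  rewrite (kopZ D)// -mulrA ler_wpM2l ?usum_cst_ge0//.
  apply: (le_trans (kop_sqrtV x (Ssg _))); rewrite mulrDl lerD2l.
  case/andP: (indicC01 C x) => _ i1.
  by rewrite ler_wpM2l ?(ltW b20)// (le_trans i1).
apply: (le_trans (ler_normD _ _)); rewrite /wsum_cst [leRHS]mulrDl lerD//.
  by rewrite normrX -sVsq -exprMn ler_sqr ?nnegrE// mulr_ge0.
rewrite !normrM ger0_norm// -sVsq.
rewrite (_ : 2 * _ * _ * _ =
  2 * ((G + incr_bound) * sV x) * (usum_cst * (l2 + b2) * sV x)); last by ring.
by rewrite -[leLHS]mulrA -[leRHS]mulrA; apply: ler_wpM2l => //; exact: ler_pM.
Qed.

(** Every step adds at most [wsum_cst V], and under the drift these increments sum to order [V + T]: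
    the linear growth of the variance. *)
Lemma wsum_bound T m : (T <= T0)%N -> dom (wsum T m) /\
  forall x, `|wsum T m x| <= wsum_cst * (V x / (1 - lam) + T%:R * bb).
Proof.
elim: T m => [|T IH] m TT0.
  split=> [|x]; first exact: Vdom_cst.
  rewrite normr0 mul0r addr0 mulr_ge0 ?wsum_cst_ge0// divr_ge0//.
  exact: ltW.
have [dw wb] := IH m.+1 (ltnW TT0).
have dgi : dom (fun x => g x - incr T m) by apply: VdomB => //; exact: Vdom_cst.
have dq : dom (fun x => (g x - incr T m) ^+ 2 +
    2 * (g x - incr T m) * K (sg m.+1) (usum T m.+1) x).
  apply: (Vdom_le _ (VdomZ wsum_cst dV)).
    apply: measurable_funD; first by apply: measurable_funX; exact: dgi.1.
    apply: measurable_funM; first by apply: measurable_funM => //; exact: dgi.1.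
    by have [] := kop_dom D (Ssg m.+1) (usum_dom T m.+1).
  move=> x; rewrite [leRHS]ger0_norm ?mulr_ge0 ?wsum_cst_ge0//.
  exact: wsum_step.
split=> [|x]; first by apply: VdomD => //; exact: (kop_dom D).
apply: (le_trans (ler_normD _ _)).
have B2 : `|K (sg m.+1) (wsum T m.+1) x| <=
    wsum_cst * ((lam * V x + b) / (1 - lam) + T%:R * bb).
  apply: (le_trans (kop_norm D x (Ssg _) dw)).
  apply: (@le_trans _ _ (K (sg m.+1)
      (fun y => wsum_cst * ((1 - lam)^-1 * V y + T%:R * bb)) x)).
    apply: (kop_le D) => //; first exact: Vdom_norm.
    - by apply/VdomZ/VdomD; [exact: VdomZ|exact: Vdom_cst].
    - by move=> y; rewrite [_^-1 * _]mulrC.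
  rewrite (kopZ D)//; last by apply: VdomD; [exact: VdomZ|exact: Vdom_cst].
  rewrite ler_wpM2l ?wsum_cst_ge0// (kopD D)//; [|exact: VdomZ|exact: Vdom_cst].
  rewrite (kop_cst D)// (kopZ D)// lerD2r [leRHS]mulrC ler_wpM2l ?invr_ge0 ?(ltW d1lam)//.
  exact: (kopV_le D x (Ssg _)).
apply: (le_trans (lerD (wsum_step m x TT0) B2)).
rewrite -mulrDr ler_wpM2l ?wsum_cst_ge0//.
have n0 : 1 - lam != 0 by rewrite gt_eqF.
rewrite le_eqVlt; apply/orP; left; apply/eqP.
by rewrite -[T.+1]addn1 natrD; field.
Qed.

Lemma kop_quadratic s (q c1 a1 r l c0 t : R) f h x :
  S s -> dom f -> dom h ->
  K s (fun y => q * (c1 + (a1 * f y + h y)) + r * (l * V y + c0) + t) x =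
  q * (c1 + (a1 * K s f x + K s h x)) + r * (l * K s V x + c0) + t.
Proof.
move=> Ss df dh.
have cst a : dom (fun=> a) by exact: Vdom_cst.
have d1 : dom (fun y => a1 * f y + h y) by apply: VdomD => //; exact: VdomZ.
have d2 : dom (fun y => c1 + (a1 * f y + h y)) by exact: VdomD.
have d3 : dom (fun y => l * V y) by exact: VdomZ.
have d4 : dom (fun y => l * V y + c0) by exact: VdomD.
rewrite (kopD D) ?(kop_cst D)//; last by apply: VdomD; exact: VdomZ.
congr (_ + _); rewrite (kopD D)//; [|exact: VdomZ|exact: VdomZ].
congr (_ + _); rewrite (kopZ D)//; congr (_ * _).
  rewrite (kopD D) ?(kop_cst D)//; congr (_ + _).
  rewrite (kopD D)//; [|exact: VdomZ]; congr (_ + _).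
  by rewrite (kopZ D).
by rewrite (kopD D) ?(kop_cst D)//; congr (_ + _); rewrite (kopZ D).
Qed.

(** Expanding the square around the [nu]-mean of the sum leaves the centred moments [usum] and
    [wsum]. The terms [r V + t] of the majorant are what a later window leaves behind, so that
    windows can be chained. *)
Lemma Eop_quadratic T m F (q c r t : R) z x : (T <= T0)%N -> bjm F ->
  0 <= q -> 0 <= r ->
  (forall z x, F z x <= q * (z - c) ^+ 2 + r * V x + t) ->
  Eop k g sg T m F z x <=
    q * ((z - (c - N (H T m))) ^+ 2 +
         2 * (z - (c - N (H T m))) * usum T m x + wsum T m x) +
    r * (lam ^+ T * V x + bb * (1 - lam ^+ T)) + t.
Proof.
move=> TT0 bF q0 r0 Fq; elim: T m z x TT0 => [|T IH] m z x TT0.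
  rewrite /= /usum (Vint_cst (Vprob_nu D)) !subr0 mulr0 !addr0 expr0 mul1r subrr.
  by rewrite mulr0 addr0.
have [dw _] := wsum_bound m.+1 (ltnW TT0).
have du := usum_dom T m.+1.
set d := z - (c - N (H T.+1 m)); set i := g x - incr T m.
have zd : z + g x - (c - N (H T m.+1)) = d + i by rewrite /d /i /incr; ring.
rewrite [Eop _ _ _ _ _ _ _ _]/=.
set c0 := bb * (1 - lam ^+ T).
have cst a : dom (fun=> a) by exact: Vdom_cst.
have dd : dom (fun y => 2 * (d + i) * usum T m.+1 y) by exact: VdomZ.
have d1 : dom (fun y => 2 * (d + i) * usum T m.+1 y + wsum T m.+1 y) by exact: VdomD.
have d2 : dom (fun y => (d + i) ^+ 2 + (2 * (d + i) * usum T m.+1 y + wsum T m.+1 y)).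
  by apply: VdomD => //; exact: Vdom_cst.
have d3 : dom (fun y => lam ^+ T * V y) by exact: VdomZ.
have d4 : dom (fun y => lam ^+ T * V y + c0) by apply: VdomD => //; exact: Vdom_cst.
apply: (@le_trans _ _ (K (sg m.+1) (fun y =>
   (q * ((d + i) ^+ 2 + ((2 * (d + i)) * usum T m.+1 y + wsum T m.+1 y)) +
   r * (lam ^+ T * V y + c0)) + t) x)).
  apply: (kop_le D) => //.
  - exact: (Eop_dom D).
  - apply: VdomD; last exact: cst.
    by apply: VdomD; apply: VdomZ.
  - move=> y; have := IH m.+1 (z + g x) y (ltnW TT0); rewrite zd => /le_trans.
    by apply; rewrite le_eqVlt /= /c0; apply/orP; left; apply/eqP; ring.
rewrite kop_quadratic// lerD2r.
apply: lerD.
  rewrite ler_wpM2l// le_eqVlt usumS /= -/i; apply/orP; left; apply/eqP.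
  by rewrite -/i; ring.
rewrite ler_wpM2l//.
have := ler_wpM2l (exprn_ge0 T (ltW lam0)) (kopV_le D x (Ssg m.+1)).
rewrite -(lerD2r c0) => /le_trans; apply.
rewrite le_eqVlt /c0 -{1}bbE; apply/orP; left; apply/eqP.
by rewrite exprS; ring.
Qed.

(** The cross term is split by [2 d u <= d ^ 2 + u ^ 2]: the square is doubled, but the bound has
    the same form as the assumption. *)
Lemma Eop_quadratic_simple T m F (q c r t : R) z x : (T <= T0)%N -> bjm F ->
  0 <= q -> 0 <= r ->
  (forall z x, F z x <= q * (z - c) ^+ 2 + r * V x + t) ->
  Eop k g sg T m F z x <=
    2 * q * (z - (c - N (H T m))) ^+ 2 +
    (q * (usum_cst ^+ 2 + wsum_cst / (1 - lam)) + r) * V x +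
    (q * (wsum_cst * bb) * T%:R + r * bb + t).
Proof.
move=> TT0 bF q0 r0 Fq.
apply: (le_trans (Eop_quadratic m z x TT0 bF q0 r0 Fq)).
set d := z - _.
have u2 : usum T m x ^+ 2 <= usum_cst ^+ 2 * V x.
  rewrite -sVsq -exprMn -[leLHS]ger0_norm ?sqr_ge0// normrX ler_sqr ?nnegrE//.
    exact: usum_short.
  by rewrite mulr_ge0// usum_cst_ge0.
have w2 : wsum T m x <= wsum_cst * (V x / (1 - lam) + T%:R * bb).
  by apply: (le_trans (ler_norm _)); have [_] := wsum_bound m TT0; apply.
have duw : d ^+ 2 + 2 * d * usum T m x + wsum T m x <=
    2 * d ^+ 2 + usum_cst ^+ 2 * V x + wsum_cst * (V x / (1 - lam) + T%:R * bb).
  have : 0 <= (d - usum T m x) ^+ 2 by exact: sqr_ge0.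
  by rewrite sqrrB -mulr_natl => h; lra.
have rV : r * (lam ^+ T * V x + bb * (1 - lam ^+ T)) <= r * (V x + bb).
  rewrite ler_wpM2l//.
  have lT0 : 0 <= lam ^+ T by rewrite exprn_ge0// ltW.
  apply: lerD; first by rewrite ler_piMl// exprn_ile1// ltW.
  by rewrite ler_piMr ?(ltW bb0)// gerBl.
have := lerD (ler_wpM2l q0 duw) rV; rewrite -(lerD2r t) => /le_trans; apply.
by rewrite le_eqVlt; apply/orP; left; apply/eqP; ring.
Qed.

End short_horizon.
End fixed_parameters.
End partial_sums.

(** * From short windows to the whole horizon *)

Section long_horizon.
Context {R : realType}.
Local Notation RR := (measurableTypeR R).
Context (S : set R) (k : R -> R.-pker RR ~> RR) (V : R -> R)
  (C : set RR) (nu : probability RR R) (theta lam b M : R)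
  (D : drift_minor S k V C nu theta lam b M).
Context (g : R -> R) (mg : measurable_fun [set: RR] (g : RR -> RR))
  (G : R) (gG : forall x, `|g x| <= G * sqrtV V x).

Let V1 := dm_V1 D.
Let V0 x : 0 <= V x. Proof. exact: le_trans (V1 x). Qed.
Let lam1 : lam < 1. Proof. by case/andP: (dm_lam D). Qed.
Let d1lam : 0 < 1 - lam. Proof. by rewrite subr_gt0. Qed.

Local Notation U := (usum_cst V nu theta lam b G).
Local Notation W := (wsum_cst V nu theta lam b G).
Local Notation bb := (b / (1 - lam)).

Let bb0 : 0 < bb. Proof. by rewrite divr_gt0// (dm_b D). Qed.
Let W0 : 0 <= W. Proof. exact: (wsum_cst_ge0 D gG). Qed.

(** Each window doubles the square, whence [2 ^ q]. This is harmless because the number [q] of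
    windows will not depend on the horizon. *)
Fixpoint long_cst (q : nat) : R :=
  if q is q'.+1 then
    2 ^+ q' * (U ^+ 2 + W / (1 - lam) + W * bb) + long_cst q' * (2 + bb)
  else 0.

Lemma long_cst_ge0 q : 0 <= long_cst q.
Proof.
elim: q => [//|q IH] /=; apply: addr_ge0.
  apply: mulr_ge0; first exact: exprn_ge0.
  apply: addr_ge0; last by apply: mulr_ge0 => //; exact: ltW.
  by apply: addr_ge0; [exact: sqr_ge0|apply: divr_ge0 => //; exact: ltW].
by apply: mulr_ge0 => //; apply: addr_ge0 => //; exact: ltW.
Qed.

Lemma long_quadratic (sg : nat -> R) (e : R) (w q T m : nat) :
  (forall n, S (sg n)) -> 0 <= e -> (forall n, `|sg n.+1 - sg n| <= e) ->
  e * w%:R * mixing_cst V nu theta lam b M <= 1 / 2 ->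
  (T <= q * w)%N ->
  exists a : R, forall c F z x, bjm F -> (forall z x, F z x <= (z - c) ^+ 2) ->
    Eop k g sg T m F z x <=
      2 ^+ q * (z - (c - a)) ^+ 2 + long_cst q * (V x + T%:R + 1).
Proof.
move=> Ssg e0 se ew; elim: q T m => [|q IH] T m Tq.
  have -> : T = 0%N by apply/eqP; rewrite -leqn0.
  by exists 0 => c F z x bF Fc; rewrite expr0 mul1r mul0r addr0 subr0; exact: Fc.
pose T1 := minn T w; pose T2 := (T - T1)%N.
have TT : T = (T1 + T2)%N by rewrite subnKC// geq_minl.
have T2q : (T2 <= q * w)%N.
  by rewrite /T2 /T1 leq_subLR; case: (leqP T w) => Tw; rewrite ?leq_addr// -mulSn.
have [a Ha] := IH T2 (m + T1)%N T2q.
(* The centre adds up the [nu]-means of the windows; it depends neither on the starting point nor on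
   the sum so far. *)
exists (a + \int[nu]_y (Hsum k g sg T1 m y)) => c F z x bF Fc.
rewrite TT Eop_cat.
have L0 := long_cst_ge0 q.
have p2 : (0 : R) <= 2 ^+ q by exact: exprn_ge0.
have := @Eop_quadratic_simple _ _ _ _ _ _ _ _ _ _ D _ mg _ gG _ Ssg _ e0 se _ ew
  T1 m (Eop k g sg T2 (m + T1)%N F) (2 ^+ q) (c - a) (long_cst q)
  (long_cst q * (T2%:R + 1)) z x (geq_minr _ _) (Eop_bjm D mg Ssg _ _ bF) p2 L0.
move=> h; apply: (le_trans (h _)).
  by move=> z' x'; apply: (le_trans (Ha c F z' x' bF Fc));
    rewrite le_eqVlt; apply/orP; left; apply/eqP; ring.
rewrite (exprS _ q).
have -> : c - a - \int[nu]_y Hsum k g sg T1 m y =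
  c - (a + \int[nu]_y Hsum k g sg T1 m y) by ring.
rewrite -addrA lerD2l [long_cst q.+1]/=.
set J := U ^+ 2 + W / (1 - lam); set L := long_cst q.
have J0 : 0 <= J.
  by apply: addr_ge0; [exact: sqr_ge0|apply: divr_ge0 => //; exact: ltW].
have Wb0 : 0 <= W * bb by apply: mulr_ge0 => //; exact: ltW.
rewrite natrD -subr_ge0.
have -> : (2 ^+ q * (J + W * bb) + L * (2 + bb)) * (V x + (T1%:R + T2%:R) + 1)
   - ((2 ^+ q * J + L) * V x
      + (2 ^+ q * (W * bb) * T1%:R + L * bb + L * (T2%:R + 1))) =
  2 ^+ q * J * (T1%:R + T2%:R + 1) + 2 ^+ q * (W * bb) * (V x + T2%:R + 1)
  + L * (V x + 2 * T1%:R + T2%:R + 1) + L * bb * (V x + T1%:R + T2%:R) by ring.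
have Lb0 : 0 <= L * bb by apply: mulr_ge0 => //; exact: ltW.
have n0 n : (0 : R) <= n%:R by exact: ler0n.
have vx := V0 x.
apply: addr_ge0; last by apply: mulr_ge0 => //; do 2 apply: addr_ge0 => //.
apply: addr_ge0; last first.
  apply: mulr_ge0 => //; do 3 apply: addr_ge0 => //; exact: mulr_ge0.
apply: addr_ge0.
  by apply: mulr_ge0; [exact: mulr_ge0|do 2 apply: addr_ge0 => //].
by apply: mulr_ge0; [exact: mulr_ge0|do 2 apply: addr_ge0 => //].
Qed.

End long_horizon.

(** * Non-degeneracy of the sums over regeneration blocks *)

Section regeneration_blocks.
Context {R : realType}.
Local Notation RR := (measurableTypeR R).
Context (S : set R) (k : R -> R.-pker RR ~> RR) (V : R -> R)
  (C : set RR) (nu : probability RR R) (theta lam b M : R)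
  (D : drift_minor S k V C nu theta lam b M).
Context (g : R -> R) (mg : measurable_fun [set: RR] (g : RR -> RR)).
Local Notation dom := (Vdom V).
Local Notation N f := (\int[nu]_y f y).

Let mV := dm_mV D.
Let V1 := dm_V1 D.
Let V0 x : 0 <= V x. Proof. exact: le_trans (V1 x). Qed.
Let lam1 : lam < 1. Proof. by case/andP: (dm_lam D). Qed.
Let theta0 : 0 < theta. Proof. by case/andP: (dm_theta D). Qed.
Let dV : dom V. Proof. exact: VdomV. Qed.

Definition ball_ind (c r w : R) : R := \1_[set w : RR | `|w - c| <= r] w.

Lemma measurable_ball_ind c r :
  measurable_fun [set: RR] (ball_ind c r : RR -> RR).
Proof.
apply: measurable_indic.
rewrite (_ : [set _ | _] = [set` `[c - r, c + r]])//.
by apply/seteqP; split=> w /=; rewrite in_itv /= ler_distl.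
Qed.

Lemma ball_indE c r w : ball_ind c r w = (`|w - c| <= r)%R%:R.
Proof. by rewrite /ball_ind indicE mem_setE. Qed.

Lemma ball_ind_in c r w : `|w - c| <= r -> ball_ind c r w = 1.
Proof. by rewrite ball_indE => ->. Qed.

Lemma ball_ind_out c r w : r < `|w - c| -> ball_ind c r w = 0.
Proof. by rewrite ball_indE ltNge => /negbTE ->. Qed.

Lemma ball_ind_ge0 c r w : 0 <= ball_ind c r w.
Proof. by rewrite ball_indE. Qed.

Lemma ball_ind_le1 c r w : ball_ind c r w <= 1.
Proof. by rewrite ball_indE lern1; case: (_ <= _). Qed.

Lemma ball_ind_norm c r w : `|ball_ind c r w| <= 1.
Proof. by rewrite ger0_norm ?ball_ind_ge0 ?ball_ind_le1. Qed.

(* [Qop sg l m psi] integrates [psi] against the law of the sum of [g] over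
   the first [l + 1] positions, restricted to the last one being in [C]. *)
Definition Qfun (psi : R -> R) (z x : R) : R := \1_C x * psi (z + g x).
Definition Qop (sg : nat -> R) (l m : nat) (psi : R -> R) : R :=
  N (Eop k g sg l m (Qfun psi) 0).

Lemma Qfun_bjm psi c : measurable_fun [set: RR] (psi : RR -> RR) ->
  (forall w, `|psi w| <= c) -> bjm (Qfun psi).
Proof.
move=> mpsi psic; apply: bjmM; first exact: (bjm_indic_snd (dm_mC D)).
by have := bjm_shift mg (bjm_fst mpsi psic).
Qed.

Lemma Qfun_ge0 psi z x : (forall w, 0 <= psi w) -> 0 <= Qfun psi z x.
Proof. by move=> p0; rewrite mulr_ge0//; case/andP: (indicC01 C x). Qed.

Section fixed_parameters.
Context (sg : nat -> R) (Ssg : forall n, S (sg n)).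
Local Notation E := (Eop k g sg).
Local Notation P := (Pop k sg).

Let Edom T m F z : bjm F -> dom (E T m F z).
Proof. by move=> bF; exact: (Eop_dom D). Qed.

(** The drift inequality telescopes: as [V >= 1], each step lowers the expected [V] by at least
    [1 - lam], up to [b] times the probability of being in [C], and [V] stays nonnegative. *)
Lemma visits_lower T m x :
  (1 - lam) * T%:R - V x <= b * \sum_(i < T) P i m \1_C x.
Proof.
have dC : dom \1_C by exact: (Vdom_indic V1 (dm_mC D)).
suff : P T m V x - V x + (1 - lam) * T%:R <= b * \sum_(i < T) P i m \1_C x.
  have : P 0%N m (fun=> 0) x <= P T m V x.
    rewrite /= -(Pop_cst D Ssg 0 T m x); apply: (Pop_le D) => //.
    exact: Vdom_cst.
  rewrite /=; lra.
elim: T => [|T IH]; first by rewrite big_ord0 mulr0 mulr0 addr0 subrr.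
rewrite big_ord_recr /= mulrDr.
have PV1 : 1 <= P T m V x.
  rewrite -(Pop_cst D Ssg 1 T m x); apply: (Pop_le D) => //; exact: Vdom_cst.
have : P T.+1 m V x <= lam * P T m V x + b * P T m \1_C x.
  rewrite -addn1 Pop_cat.
  rewrite -(PopZ D)// -(PopZ D)// -(PopD D)//; [|exact: VdomZ|exact: VdomZ].
  apply: (Pop_le D) => //.
  - exact: (kop_dom D).
  - by apply: VdomD; exact: VdomZ.
  - by move=> y /=; exact: (kopV D).
move=> /= h; have h0 := lerD IH (lexx (b * P T m \1_C x)).
apply: le_trans h0; rewrite -natr1.
have : (1 - lam) * 1 <= (1 - lam) * P T m V x by rewrite ler_wpM2l// subr_ge0 ltW.
by lra.
Qed.

Lemma Qop_le l m psi psi' c : measurable_fun [set: RR] (psi : RR -> RR) ->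
  measurable_fun [set: RR] (psi' : RR -> RR) ->
  (forall w, `|psi w| <= c) -> (forall w, `|psi' w| <= c) ->
  (forall w, psi w <= psi' w) -> Qop sg l m psi <= Qop sg l m psi'.
Proof.
move=> mpsi mpsi' psic psic' pp'.
have bp := Qfun_bjm mpsi psic; have bp' := Qfun_bjm mpsi' psic'.
apply: (Vint_le mV V1 (Vprob_nu D)); [exact: Edom|exact: Edom|] => x.
apply: (Eop_le D) => // z y; exact: ler_wpM2l.
Qed.

Lemma QopD l m psi psi' c : measurable_fun [set: RR] (psi : RR -> RR) ->
  measurable_fun [set: RR] (psi' : RR -> RR) ->
  (forall w, `|psi w| <= c) -> (forall w, `|psi' w| <= c) ->
  Qop sg l m (fun w => psi w + psi' w) = Qop sg l m psi + Qop sg l m psi'.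
Proof.
move=> mpsi mpsi' psic psic'.
have bp := Qfun_bjm mpsi psic; have bp' := Qfun_bjm mpsi' psic'.
rewrite /Qop -(VintD mV V1 (Vprob_nu D)); [|exact: Edom|exact: Edom].
congr (Rintegral _ _ _); apply/funext => x; rewrite -(EopD D)//.
congr (E _ _ _ _ x); apply/funext => z; apply/funext => y.
by rewrite /Qfun mulrDr.
Qed.

Lemma QopZ a l m psi c : measurable_fun [set: RR] (psi : RR -> RR) ->
  (forall w, `|psi w| <= c) ->
  Qop sg l m (fun w => a * psi w) = a * Qop sg l m psi.
Proof.
move=> mpsi psic; have bp := Qfun_bjm mpsi psic.
rewrite /Qop -(VintZ mV V1 (Vprob_nu D)); last exact: Edom.
congr (Rintegral _ _ _); apply/funext => x; rewrite -(EopZ D)//.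
congr (E _ _ _ _ x); apply/funext => z; apply/funext => y.
by rewrite /Qfun mulrCA.
Qed.

Let m1 : measurable_fun [set: RR] ((fun=> 1) : RR -> RR). Proof. by []. Qed.
Let n1 (w : R) : `|(1 : R)| <= 1. Proof. by rewrite normr1. Qed.

Lemma Qop_mass l m : Qop sg l m (fun=> 1) = N (P l m \1_C).
Proof.
congr (Rintegral _ _ _); apply/funext => x; rewrite -(Eop_snd _ g sg _ _ _ 0).
congr (E _ _ _ _ x); apply/funext => z; apply/funext => y.
by rewrite /Qfun mulr1.
Qed.

Lemma Qop_mass_le1 l m : Qop sg l m (fun=> 1) <= 1.
Proof.
have bp := Qfun_bjm m1 n1.
rewrite -[leRHS](Vint_cst (Vprob_nu D)).
apply: (Vint_le mV V1 (Vprob_nu D)); [exact: Edom|exact: Vdom_cst|] => x.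
rewrite -[leRHS](Eop_cst D g Ssg 1 l m 0 x); apply: (Eop_le D) => //.
  exact: bjm_cst.
by move=> z y; rewrite /Qfun mulr1; case/andP: (indicC01 C y).
Qed.

Lemma Qop_visits T m :
  (1 - lam) * T%:R - N V <= b * \sum_(l < T) Qop sg l m (fun=> 1).
Proof.
have dC : dom \1_C by exact: (Vdom_indic V1 (dm_mC D)).
have dP i : dom (P i m \1_C) by exact: (Pop_dom D).
have ds : forall n, dom (fun x => \sum_(i < n) P i m \1_C x) /\
    N (fun x => \sum_(i < n) P i m \1_C x) = \sum_(l < n) Qop sg l m (fun=> 1).
  elim=> [|n [dn Nn]].
    split.
      rewrite (_ : (fun _ => _) = (fun=> 0)); first exact: Vdom_cst.
      by apply/funext => x; rewrite big_ord0.
    rewrite big_ord0 -[RHS](Vint_cst (Vprob_nu D)).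
    by congr (Rintegral _ _ _); apply/funext => x; rewrite big_ord0.
  have e : (fun x => \sum_(i < n.+1) P i m \1_C x) =
      (fun x => \sum_(i < n) P i m \1_C x + P n m \1_C x).
    by apply/funext => x; rewrite big_ord_recr.
  rewrite e; split; first exact: VdomD.
  by rewrite (VintD mV V1 (Vprob_nu D))// Nn big_ord_recr /= Qop_mass.
have [dT NT] := ds T; rewrite -NT.
rewrite -(VintZ mV V1 (Vprob_nu D))// -[X in X - _](Vint_cst (Vprob_nu D)).
rewrite -(VintB mV V1 (Vprob_nu D))//; last exact: Vdom_cst.
apply: (Vint_le mV V1 (Vprob_nu D)); [|exact: VdomZ|exact: visits_lower].
by apply: VdomB => //; exact: Vdom_cst.
Qed.

(** One more step on the right: [Eop] leaves the last position out of the sum, whereas [Qfun] adds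
    [g] there. *)
Lemma Qop_le_Eop l m psi c : measurable_fun [set: RR] (psi : RR -> RR) ->
  (forall w, `|psi w| <= c) -> (forall w, 0 <= psi w) ->
  Qop sg l m psi <= N (E l.+1 m (z_only psi) 0).
Proof.
move=> mpsi psic p0; have bp := Qfun_bjm mpsi psic.
have bz : bjm (z_only psi) by exact: bjm_fst mpsi psic.
apply: (Vint_le mV V1 (Vprob_nu D)); [exact: Edom|exact: Edom|] => x.
rewrite -addn1 Eop_cat; apply: (Eop_le D) => //.
  exact: (Eop_bjm D).
move=> z y; rewrite /= /z_only (kop_cst D)// /Qfun.
by rewrite ler_piMl//; case/andP: (indicC01 C y).
Qed.

End fixed_parameters.

Section constant_parameter.
Context (s : R) (Ss : S s).
Local Notation sg := (fun=> s : R).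
Local Notation E := (Eop k g sg).
Local Notation Q l psi := (Qop sg l 0 psi).


(** After a first block ending in [C] the chain restarts from [nu] with weight [theta]. Blocks of
    [l.+1] and [l'.+1] positions join into one of [(l + l').+2] positions. *)
Lemma Q_concat l l' phi phi' psi c :
  measurable_fun [set: RR] (phi : RR -> RR) ->
  measurable_fun [set: RR] (phi' : RR -> RR) ->
  measurable_fun [set: RR] (psi : RR -> RR) ->
  (forall w, `|phi w| <= c) -> (forall w, `|phi' w| <= c) ->
  (forall w, `|psi w| <= c) -> (forall w, 0 <= phi w) ->
  (forall w, 0 <= psi w) ->
  (forall w w', phi w * phi' w' <= psi (w + w')) ->
  theta * (Q l phi * Q l' phi') <= Q (l + l').+1 psi.
Proof.
move=> mphi mphi' mpsi phic phic' psic phi0 psi0 pp.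
have bphi := Qfun_bjm mphi phic; have bphi' := Qfun_bjm mphi' phic'.
have bpsi := Qfun_bjm mpsi psic.
set q' := Q l' phi'.
have -> : theta * (Q l phi * q') =
    N (E l 0%N (fun z y => (theta * q') * Qfun phi z y) 0).
  rewrite [Q l phi * q']mulrC mulrA /Qop -(VintZ mV V1 (Vprob_nu D)).
    by congr (Rintegral _ _ _); apply/funext => x; rewrite (EopZ D).
  exact: (Eop_dom D).
rewrite /Qop; apply: (Vint_le mV V1 (Vprob_nu D)).
- by apply: (Eop_dom D) => //; exact: bjmZ.
- exact: (Eop_dom D).
move=> x; rewrite -addnS Eop_cat; apply: (Eop_le D) => //.
- exact: bjmZ.
- exact: (Eop_bjm D).
move=> z y; rewrite add0n [leRHS]/=.
set f := E l' l.+1 _ _.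
have df : dom f by exact: (Eop_dom D).
have f0 u : 0 <= f u by apply: (Eop_ge0 D) => // z' y'; exact: Qfun_ge0.
have [Cy|nCy] := pselect (C y); last first.
  rewrite /Qfun indicE memNset// mul0r mulr0 -[leLHS](kop_cst D 0 y Ss).
  by apply: (kop_le D) => //; exact: Vdom_cst.
apply: (le_trans _ (kop_minor D Ss df f0 Cy)).
rewrite -mulrA ler_wpM2l ?(ltW theta0)//.
rewrite /Qfun indicE mem_set// mul1r mulrC.
rewrite /q' /Qop -(VintZ mV V1 (Vprob_nu D)); last exact: (Eop_dom D).
apply: (Vint_le mV V1 (Vprob_nu D)) => //.
  by apply: VdomZ; exact: (Eop_dom D).
move=> u; rewrite -(EopZ D)//.
have -> : f u = E l' 0%N (fun z' y' => Qfun psi (z' + (z + g y)) y') 0 u.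
  by rewrite Eop_translate add0r /f; exact: eq_Eop.
apply: (Eop_le D) => //.
- exact: bjmZ.
- exact: bjm_translate.
move=> z' y'; rewrite /Qfun mulrCA ler_wpM2l//.
by apply: (le_trans (pp _ _)); rewrite addrA [z + g y + z']addrC.
Qed.

Lemma Q_concat_ball l l' c r c' r' :
  0 < Q l (ball_ind c r) -> 0 < Q l' (ball_ind c' r') ->
  0 < Q (l + l').+1 (ball_ind (c + c') (r + r')).
Proof.
move=> Q1 Q2; apply: (@lt_le_trans _ _ (theta * (Q l (ball_ind c r) * Q l' (ball_ind c' r')))).
  by rewrite !mulr_gt0.
apply: (@Q_concat _ _ _ _ _ 1) => //; try exact: measurable_ball_ind;
  try exact: ball_ind_norm; try exact: ball_ind_ge0.
move=> w w'; rewrite !ball_indE -natrM ler_nat.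
case: (leP `|w - c| r) => [h|_]; last by rewrite mul0n.
case: (leP `|w' - c'| r') => [h'|_]; last by rewrite muln0.
rewrite mul1n lt0b; rewrite (_ : _ - _ = (w - c) + (w' - c')); last by ring.
by rewrite (le_trans (ler_normD _ _))// lerD.
Qed.

Lemma Q_iterate l c r j : 0 < Q l (ball_ind c r) ->
  0 < Q (l + j * l.+1)%N (ball_ind (j.+1%:R * c) (j.+1%:R * r)).
Proof.
move=> Q0; elim: j => [|j IH]; first by rewrite mul0n addn0 !mul1r.
have := Q_concat_ball Q0 IH.
rewrite -{1}[c]mul1r -{1}[r]mul1r -!mulrDl -[1]/(1%:R) -!natrD !add1n.
by rewrite mulSn addSn addnS.
Qed.

(** The inequality puts the two intervals at positive distance; the common length [l] makes them two
    outcomes of the same block. *)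
Definition separated_blocks : Prop :=
  exists l c r c' r', [/\ r + r' < `|c - c'|,
    0 < Q l (ball_ind c r) & 0 < Q l (ball_ind c' r')].

End constant_parameter.
End regeneration_blocks.

(** * Rigidity of blocks without separated intervals *)

Section nondegeneracy.
Context {R : realType}.
Local Notation RR := (measurableTypeR R).
Context (S : set R) (k : R -> R.-pker RR ~> RR) (V : R -> R)
  (C : set RR) (nu : probability RR R) (theta lam b M : R)
  (D : drift_minor S k V C nu theta lam b M).
Context (g : R -> R) (mg : measurable_fun [set: RR] (g : RR -> RR))
  (G : R) (gG : forall x, `|g x| <= G * sqrtV V x).
Local Notation dom := (Vdom V).
Local Notation N f := (\int[nu]_y f y).
Local Notation Q s l psi := (Qop k C nu g (fun=> s) l 0 psi).
Local Notation sep s := (separated_blocks k C nu g s).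

Let mV := dm_mV D.
Let V1 := dm_V1 D.
Let V0 x : 0 <= V x. Proof. exact: le_trans (V1 x). Qed.
Let lam1 : lam < 1. Proof. by case/andP: (dm_lam D). Qed.
Let b0 : 0 < b. Proof. exact: dm_b D. Qed.
Let dV : dom V. Proof. exact: VdomV. Qed.
Let NV0 : 0 <= N V. Proof. exact: Rintegral_ge0. Qed.

Lemma Qop_perturb sg sg' l m m' psi (e : R) :
  (forall n, S (sg n)) -> (forall n, S (sg' n)) ->
  measurable_fun [set: RR] (psi : RR -> RR) -> (forall w, `|psi w| <= 1) ->
  0 <= e ->
  (forall i, (0 < i <= l)%N -> `|sg (m + i)%N - sg' (m' + i)%N| <= e) ->
  `|Qop k C nu g sg l m psi - Qop k C nu g sg' l m' psi| <=
    e * perturb_cst lam b M l * N V.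
Proof.
move=> Ssg Ssg' mpsi psi1 e0 ss'.
have bp := Qfun_bjm D mg mpsi psi1.
have d1 : dom (Eop k g sg l m (Qfun C g psi) 0) by exact: (Eop_dom D).
have d2 : dom (Eop k g sg' l m' (Qfun C g psi) 0) by exact: (Eop_dom D).
rewrite /Qop -(VintB mV V1 (Vprob_nu D))// -(VintZ mV V1 (Vprob_nu D))//.
apply: (le_trans (Vint_norm mV V1 (Vprob_nu D) (VdomB d1 d2))).
apply: (Vint_le mV V1 (Vprob_nu D)); [exact/Vdom_norm/VdomB|exact: VdomZ|] => x.
apply: (Eop_perturb D) => // z y; rewrite /Qfun normrM.
rewrite -[leRHS]mulr1 ler_pM//.
by have /andP[i0 i1] := indicC01 C y; rewrite ger0_norm.
Qed.

Section one_parameter.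
Context (s : R) (Ss : S s) (ms c0 : R)
  (Hm : forall T, `|T%:R * ms - N (Hsum k g (fun=> s) T 0)| <= c0).

Let Ssg (n : nat) : S ((fun=> s) n). Proof. exact: Ss. Qed.
Local Notation H T := (N (Hsum k g (fun=> s) T 0)).

Let m1 : measurable_fun [set: RR] ((fun=> 1) : RR -> RR). Proof. by []. Qed.

Let mcompl c r :
  measurable_fun [set: RR] ((fun w => 1 - ball_ind c r w) : RR -> RR).
Proof. by apply: measurable_funB => //; exact: measurable_ball_ind. Qed.

Let compl_ge0 (c r w : R) : 0 <= 1 - ball_ind c r w :> R.
Proof. by rewrite subr_ge0 ball_ind_le1. Qed.

Let compl_norm (c r w : R) : `|1 - ball_ind c r w| <= 1 :> R.
Proof. by rewrite ger0_norm ?compl_ge0// gerBl ball_ind_ge0. Qed.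

(** With a constant parameter the second moment bound holds with [e = 0], hence on every horizon, so
    [B] does not depend on [l]. *)
Lemma Q_chebyshev : exists2 B : R, 0 <= B & forall l (eta : R), 0 < eta ->
  Q s l (fun w => 1 - ball_ind (H l.+1) eta w) <= B * l.+1%:R / eta ^+ 2.
Proof.
pose U := usum_cst V nu theta lam b G.
pose W := wsum_cst V nu theta lam b G.
pose J := U ^+ 2 + W / (1 - lam).
have W0 : 0 <= W by exact: (wsum_cst_ge0 D gG).
have d1 : 0 < 1 - lam by rewrite subr_gt0.
have J0 : 0 <= J.
  by apply: addr_ge0; [exact: sqr_ge0|apply: divr_ge0 => //; exact: ltW].
have bb0 : 0 <= b / (1 - lam) by apply: divr_ge0; exact: ltW.
exists (J * N V + W * (b / (1 - lam))).
  by apply: addr_ge0; exact: mulr_ge0.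
move=> l eta eta0; pose psi (w : R) := 1 - ball_ind (H l.+1) eta w.
change (Q s l psi <= (J * N V + W * (b / (1 - lam))) * l.+1%:R / eta ^+ 2).
have mpsi : measurable_fun [set: RR] (psi : RR -> RR) by exact: mcompl.
apply: (le_trans (Qop_le_Eop D mg Ssg l 0 mpsi (compl_norm _ _) (compl_ge0 _ _))).
set q := (eta ^+ 2)^-1; have q0 : 0 <= q by rewrite invr_ge0 sqr_ge0.
have bz : bjm (z_only psi) by exact: bjm_fst mpsi (compl_norm _ _).
have ew : 0 * l.+1%:R * mixing_cst V nu theta lam b M <= 1 / 2.
  by rewrite !mul0r divr_ge0.
have se n : `|(fun=> s) n.+1 - (fun=> s) n : R| <= 0 by rewrite subrr normr0.
have Fc z x : z_only psi z x <= q * (z - H l.+1) ^+ 2 + 0 * V x + 0.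
  rewrite mul0r !addr0 /z_only /psi.
  have [h|h] := leP `|z - H l.+1| eta.
    by rewrite (ball_ind_in h) subrr mulr_ge0// sqr_ge0.
  rewrite (ball_ind_out h) subr0 /q ler_pdivlMl ?exprn_gt0// mulr1 -[leRHS]ger0_norm ?sqr_ge0//.
  by rewrite normrX ler_sqr ?nnegrE// ltW.
have h x := Eop_quadratic_simple D mg gG Ssg (lexx 0) se ew 0 0 x (leqnn _) bz q0 (lexx 0) Fc.
have dq : dom (fun x => q * J * V x + q * (W * (b / (1 - lam))) * l.+1%:R).
  by apply: VdomD; [exact: VdomZ|exact: Vdom_cst].
apply: (@le_trans _ _ (N (fun x => q * J * V x + q * (W * (b / (1 - lam))) * l.+1%:R))).
  apply: (Vint_le mV V1 (Vprob_nu D)) => //; first exact: (Eop_dom D).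
  move=> x; apply: (le_trans (h x)); rewrite -/U -/W -/J.
  by rewrite subrr subr0 expr0n mulr0 add0r mul0r !addr0.
rewrite (VintD mV V1 (Vprob_nu D)); [|exact: VdomZ|exact: Vdom_cst].
rewrite (VintZ mV V1 (Vprob_nu D))// (Vint_cst (Vprob_nu D)).
have -> : q * J * N V + q * (W * (b / (1 - lam))) * l.+1%:R =
  q * (J * N V + W * (b / (1 - lam)) * l.+1%:R) by ring.
rewrite [leRHS]mulrC -/q; apply: ler_wpM2l => //.
rewrite [leRHS]mulrDl lerD2r ler_peMr ?ler1n//; exact: mulr_ge0.
Qed.

(** Otherwise at most [l0 + T c] visits to [C] are expected up to time [T], with
    [b c = (1 - lam) / 2]: too few for [Qop_visits] once [T] is large. *)
Lemma Q_frequent l0 : exists2 l, (l0 <= l)%N &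
  (1 - lam) / (2 * b) <= Q s l (fun=> 1).
Proof.
apply: contrapT => nQ.
have d1 : 0 < 1 - lam by rewrite subr_gt0.
set c : R := (1 - lam) / (2 * b) in nQ *.
have c_ge0 : 0 <= c by rewrite divr_ge0 ?mulr_ge0// ltW.
have Qc l : (l0 <= l)%N -> Q s l (fun=> 1) <= c.
  move=> l0l; rewrite leNgt; apply/negP => cQ; apply: nQ.
  by exists l => //; exact: ltW.
pose T := (Num.truncn ((N V + b * l0%:R) * 2 / (1 - lam))).+1.
have Tbig : N V + b * l0%:R < (1 - lam) * T%:R / 2.
  rewrite ltr_pdivlMr// -ltr_pdivrMl// mulrC.
  exact: truncnS_gt.
have QT n : \sum_(l < n) Q s l (fun=> 1) <= (minn n l0)%:R + n%:R * c.
  elim: n => [|n IH]; first by rewrite big_ord0 min0n mul0r addr0.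
  rewrite big_ord_recr /=; have [nl0|l0n] := ltnP n l0.
    have -> : minn n.+1 l0 = (minn n l0).+1.
      by rewrite (minn_idPl nl0) (minn_idPl (ltnW nl0)).
    have := Qop_mass_le1 D mg Ssg n 0; rewrite -!natr1 => Q1.
    by apply: (le_trans (lerD IH Q1)); rewrite mulrDl mul1r; lra.
  have -> : minn n.+1 l0 = minn n l0.
    by rewrite (minn_idPr l0n) (minn_idPr (leqW l0n)).
  apply: (le_trans (lerD IH (Qc _ l0n))).
  by rewrite -[n.+1%:R]natr1 mulrDl mul1r addrA.
have := Qop_visits D g Ssg T 0.
have QT' : \sum_(l < T) Q s l (fun=> 1) <= l0%:R + T%:R * c.
  by apply: (le_trans (QT T)); rewrite lerD2r ler_nat geq_minr.
move=> h; have {h} := le_trans h (ler_wpM2l (ltW b0) QT').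
rewrite mulrDr mulrCA (_ : b * c = (1 - lam) / 2); last first.
  by rewrite /c; field; rewrite gt_eqF.
by move=> h; lra.
Qed.

(** At radius [eps n / 2] Chebyshev's inequality loses only [4 B / (eps ^ 2 n)], less than the mass
    which [Q_frequent] guarantees at arbitrarily large [n]. The other half of the radius absorbs
    [c0]. *)
Lemma Q_concentrated (eps : R) : 0 < eps ->
  exists l, 0 < Q s l (ball_ind (l.+1%:R * ms) (eps * l.+1%:R)).
Proof.
move=> eps0; have [B B0 HB] := Q_chebyshev.
set q := (1 - lam) / (2 * b).
have q0 : 0 < q by rewrite divr_gt0 ?subr_gt0// mulr_gt0.
have [l Ll Ql] := Q_frequent
  (Num.truncn (4 * B / (eps ^+ 2 * q)) + Num.truncn (2 * c0 / eps)).
exists l; set n : R := l.+1%:R.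
have n0 : 0 < n by rewrite ltr0n.
have n1' : 4 * B / (eps ^+ 2 * q) < n.
  apply: (lt_le_trans (truncnS_gt _)); rewrite ler_nat ltnS.
  by apply: leq_trans Ll; exact: leq_addr.
have n2 : 2 * c0 / eps < n.
  apply: (lt_le_trans (truncnS_gt _)); rewrite ler_nat ltnS.
  by apply: leq_trans Ll; exact: leq_addl.
set eta := eps * n / 2; have eta0 : 0 < eta by rewrite divr_gt0 ?mulr_gt0.
have c0eta : c0 <= eta.
  rewrite /eta ler_pdivlMr// mulrC [eps * n]mulrC -ler_pdivrMr//.
  exact: ltW.
apply: (@lt_le_trans _ _ (Q s l (ball_ind (H l.+1) eta))); last first.
  apply: (Qop_le D mg Ssg _ _ _ _ (ball_ind_norm _ _) (ball_ind_norm _ _));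
    try exact: measurable_ball_ind.
  move=> w; have [h|h] := leP `|w - H l.+1| eta; last first.
    by rewrite (ball_ind_out h) ball_ind_ge0.
  rewrite (ball_ind_in h) ball_ind_in//.
  rewrite (_ : w - n * ms = (w - H l.+1) - (n * ms - H l.+1)); last by ring.
  apply: (le_trans (ler_normB _ _)); rewrite (_ : eps * n = eta + eta).
    by rewrite lerD// (le_trans (Hm l.+1)).
  by rewrite /eta; field.
have sum1 : Q s l (fun=> 1) = Q s l (ball_ind (H l.+1) eta) +
    Q s l (fun w => 1 - ball_ind (H l.+1) eta w).
  rewrite -(QopD D mg Ssg _ _ _ _ (ball_ind_norm _ _) (compl_norm _ _)) //.
    by congr (Qop _ _ _ _ _ _ _ _); apply/funext => w; rewrite addrC subrK.
  exact: measurable_ball_ind.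
have Bq : B * n / eta ^+ 2 < q.
  rewrite ltr_pdivrMr ?exprn_gt0// /eta.
  rewrite ltr_pdivrMr in n1'; last by rewrite mulr_gt0// exprn_gt0.
  have -> : q * (eps * n / 2) ^+ 2 = (n * (eps ^+ 2 * q)) * n / 4 by field.
  rewrite ltr_pdivlMr// mulrAC ltr_pM2r// mulrC.
  exact: n1'.
apply: (@lt_le_trans _ _ (q - B * n / eta ^+ 2)); first by rewrite subr_gt0.
by rewrite lerBlDr (le_trans Ql)// sum1 lerD2l; exact: HB.
Qed.

Context (nsep : ~ sep s).

(** [j.+1] copies of the given block are as long as [l.+1] copies of a block of [j.+1] positions
    concentrated near its mean. The two resulting intervals must meet, or they would be separated;
    dividing by [j.+1] leaves [r] up to an arbitrary error. *)
Lemma Q_ball_mean l c r : 0 < Q s l (ball_ind c r) ->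
  `|c - l.+1%:R * ms| <= r.
Proof.
move=> Q0; apply/ler_addgt0Pr => e e0.
set n0 : R := l.+1%:R; have n00 : 0 < n0 by rewrite ltr0n.
have [j Qj] := Q_concentrated (divr_gt0 e0 n00).
set n : R := j.+1%:R; have nn0 : 0 < n by rewrite ltr0n.
have A1 := Q_iterate D mg Ss j Q0.
have A2 := Q_iterate D mg Ss l Qj.
have idx : (j + l * j.+1 = l + j * l.+1)%N by rewrite !mulnS addnCA mulnC.
rewrite idx -/n0 -/n in A2; rewrite -/n in A1.
have le1 : `|n * c - n0 * (n * ms)| <= n * r + n0 * (e / n0 * n).
  rewrite leNgt; apply/negP => h; apply: nsep.
  by exists (l + j * l.+1)%N, (n * c), (n * r), (n0 * (n * ms)), (n0 * (e / n0 * n)).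
rewrite -(ler_pM2l nn0) -[n in leLHS]gtr0_norm// -normrM.
rewrite (_ : n * (c - n0 * ms) = n * c - n0 * (n * ms)); last by ring.
apply: (le_trans le1); rewrite le_eqVlt; apply/orP; left; apply/eqP.
by field; rewrite gt_eqF.
Qed.

(** Balls that miss the mean carry no mass. Two of them and the [eta]-ball at the mean cover
    everything but a tail, which holds at most half of the mass. *)
Lemma Q_all_at_mean l (eta : R) : 0 < eta -> 0 < Q s l (fun=> 1) ->
  Q s l (fun=> 1) / 2 <= Q s l (ball_ind (l.+1%:R * ms) eta).
Proof.
move=> eta0 Q0; have [B B0 HB] := Q_chebyshev.
set q := Q s l (fun=> 1) in Q0 *; set a := l.+1%:R * ms.
set n : R := l.+1%:R; have n0 : 0 < n by rewrite ltr0n.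
(* At this radius the bound of [Q_chebyshev] is at most [q / 2]. *)
pose r := Num.sqrt (2 * (B * n + 1) / q).
have r20 : 0 < 2 * (B * n + 1) / q.
  by rewrite divr_gt0// mulr_gt0// ltr_wpDl// mulr_ge0// ltW.
have r0 : 0 < r by rewrite sqrtr_gt0.
have hr : B * n / r ^+ 2 <= q / 2.
  rewrite sqr_sqrtr ?(ltW r20)// invf_div mulrA ler_pdivrMr; last first.
    by rewrite mulr_gt0// ltr_wpDl// mulr_ge0// ltW.
  rewrite (_ : q / 2 * _ = (B * n + 1) * q); last by field.
  by rewrite ler_pM2r// lerDl.
pose h := H l.+1.
have [R0 R0E] : exists R0, R0 = r + `|h - a| + eta by eexists.
have R0eta : eta <= R0 by rewrite R0E lerDr addr_ge0// ltW.
have z (c : R) : (R0 - eta) / 2 < `|c - a| -> Q s l (ball_ind c ((R0 - eta) / 2)) <= 0.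
  move=> hc; rewrite leNgt; apply/negP => /Q_ball_mean.
  by rewrite -/n -/a leNgt hc.
(* The balls of radius [rho] around [a - dd] and [a + dd] fill the range [eta <= |w - a| <= R0] on
   either side of [a], and miss [a] because [rho < dd]. *)
set rho := (R0 - eta) / 2; set dd := (R0 + eta) / 2.
have dd0 : 0 <= dd by rewrite /dd; lra.
have z1 : Q s l (ball_ind (a + dd) rho) <= 0.
  apply: z; rewrite (addrC a) addrK ger0_norm//.
  by rewrite /rho /dd; lra.
have z2 : Q s l (ball_ind (a - dd) rho) <= 0.
  apply: z; rewrite (addrC a) addrK normrN ger0_norm//.
  by rewrite /rho /dd; lra.
have cover w : 1 <= ball_ind a eta w + (ball_ind (a + dd) rho w +
    (ball_ind (a - dd) rho w + (1 - ball_ind h r w))).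
  have b1 := ball_ind_ge0 a eta w; have b2 := ball_ind_ge0 (a + dd) rho w.
  have b3 := ball_ind_ge0 (a - dd) rho w; have b4 := ball_ind_le1 h r w.
  have [hw|hw] := leP `|w - h| r; last first.
    by rewrite (ball_ind_out hw); lra.
  have [h1|h1] := leP `|w - a| eta.
    by rewrite (ball_ind_in h1); lra.
  have waR : `|w - a| <= R0.
    rewrite (_ : w - a = (w - h) + (h - a)); last by ring.
    by apply: (le_trans (ler_normD _ _)); rewrite R0E; lra.
  have [wa|wa] := leP 0 (w - a).
    have : `|w - (a + dd)| <= rho.
      rewrite ger0_norm// in h1; rewrite ger0_norm// in waR.
      by rewrite ler_distl /dd /rho; apply/andP; split; lra.
    by move=> /ball_ind_in ->; lra.
  have : `|w - (a - dd)| <= rho.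
    rewrite ltr0_norm// in h1; rewrite ltr0_norm// in waR.
    by rewrite ler_distl /dd /rho; apply/andP; split; lra.
  by move=> /ball_ind_in ->; lra.
have mb (c' r' : R) : measurable_fun [set: RR] (ball_ind c' r' : RR -> RR).
  exact: measurable_ball_ind.
have bb' (c' r' w : R) : `|ball_ind c' r' w| <= 4.
  by apply: (le_trans (ball_ind_norm _ _ _)); rewrite ler1n.
have m3 : measurable_fun [set: RR] ((fun w => ball_ind (a - dd) rho w +
    (1 - ball_ind h r w)) : RR -> RR).
  exact: measurable_funD (mb _ _) (mcompl _ _).
have m2 : measurable_fun [set: RR] ((fun w => ball_ind (a + dd) rho w +
    (ball_ind (a - dd) rho w + (1 - ball_ind h r w))) : RR -> RR).
  exact: measurable_funD (mb _ _) m3.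
have n4 (w : R) : `|(1 : R)| <= 4 by rewrite normr1 ler1n.
have n3 (w : R) : `|1 - ball_ind h r w| <= 4 :> R.
  by apply: (le_trans (compl_norm _ _ _)); rewrite ler1n.
have nD (x y : R) (i j : nat) : `|x| <= i%:R -> `|y| <= j%:R ->
    `|x + y| <= (i + j)%:R.
  by move=> xi yj; rewrite natrD (le_trans (ler_normD _ _))// lerD.
have n2' (w : R) := nD _ _ 1%N 1%N (ball_ind_norm (a - dd) rho w) (compl_norm h r w).
have n1' (w : R) := nD _ _ 1%N 2%N (ball_ind_norm (a + dd) rho w) (n2' w).
have n0' (w : R) := nD _ _ 1%N 3%N (ball_ind_norm a eta w) (n1' w).
have ler24 : (2%:R : R) <= 4%:R by rewrite ler_nat.
have ler34 : (3%:R : R) <= 4%:R by rewrite ler_nat.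
have := Qop_le D mg Ssg l 0 m1 (measurable_funD (mb a eta) m2) n4 n0' cover.
rewrite (QopD D mg Ssg l 0 (mb _ _) m2 (bb' _ _) (fun w => le_trans (n1' w) ler34)).
rewrite (QopD D mg Ssg l 0 (mb _ _) m3 (bb' _ _) (fun w => le_trans (n2' w) ler24)).
rewrite (QopD D mg Ssg l 0 (mb _ _) (mcompl _ _) (bb' _ _) n3).
have := HB l r r0; rewrite -/n -/h -/q.
move=> h4 h5; have h6 := lerD z1 (lerD z2 (le_trans h4 hr)).
rewrite -(lerD2r (q / 2)) -splitr; apply: (le_trans h5); rewrite lerD2l.
by apply: (le_trans h6); rewrite !add0r.
Qed.

End one_parameter.

(** Without separation, every small ball around [l.+1 * ms] holds half of the mass [q] at [s].
    Passing to [t] loses at most [q / 4], so these balls are charged at [t] too and must contain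
    [l.+1 * mt]. As [tau] depends neither on [t] nor on the radius, the two means would coincide. *)
Lemma separated_blocks_exists s (ms cs : R) : S s ->
  (forall T, `|T%:R * ms - N (Hsum k g (fun=> s) T 0)| <= cs) ->
  exists2 tau : R, 0 < tau & forall t (mt ct : R), S t ->
  (forall T, `|T%:R * mt - N (Hsum k g (fun=> t) T 0)| <= ct) ->
  `|s - t| <= tau -> mt != ms -> sep s \/ sep t.
Proof.
move=> Ss Hs.
have [l _ Ql] := Q_frequent Ss 0.
set q := Q s l (fun=> 1) in Ql.
have q0 : 0 < q.
  by apply: lt_le_trans Ql; rewrite divr_gt0 ?subr_gt0// mulr_gt0.
pose A := perturb_cst lam b M l * N V + 1.
have A0 : 0 < A.
  by rewrite ltr_wpDl// mulr_ge0// (perturb_cst_ge0 D).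
exists (q / 4 / A); first by rewrite !divr_gt0.
move=> t mt ct St Ht st mst.
apply: contrapT => /not_orP[ns nt].
have key (eta : R) : 0 < eta -> `|l.+1%:R * ms - l.+1%:R * mt| <= eta.
  move=> eta0; have Qs := Q_all_at_mean Ss Hs ns eta0 q0.
  apply: (Q_ball_mean St Ht nt).
  have pe : `|Q s l (ball_ind (l.+1%:R * ms) eta) -
      Q t l (ball_ind (l.+1%:R * ms) eta)| <=
      q / 4 / A * perturb_cst lam b M l * N V.
    apply: Qop_perturb => //; first exact: measurable_ball_ind.
      exact: ball_ind_norm.
    by rewrite ltW// !divr_gt0.
  have : q / 4 / A * perturb_cst lam b M l * N V <= q / 4.
    have q4 : 0 <= q / 4 by rewrite divr_ge0// ltW.
    rewrite -mulrA [q / 4 / A * _]mulrAC ler_pdivrMr//.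
    by apply: ler_wpM2l => //; rewrite /A lerDl.
  move=> h; have {}pe := le_trans pe h; move: pe.
  by rewrite ler_norml => /andP[_ pe]; rewrite -/q in Qs; lra.
move/negP: mst; apply; rewrite eq_sym -subr_eq0.
have : `|l.+1%:R * ms - l.+1%:R * mt| <= 0.
  by apply/ler_addgt0Pr => e e0; rewrite add0r; exact: key.
rewrite normr_le0 -mulrBr mulf_eq0 pnatr_eq0 /=.
by [].
Qed.

End nondegeneracy.

(** * Contraction of the characteristic function *)

Section cosine_bounds.
Context {R : realType}.

(** From [cos v = 1 - 2 sin (v / 2) ^ 2] and [sin w >= w / 2] for small [w >= 0], the latter by the
    mean value theorem where the cosine exceeds 1/2. *)
Lemma cos_near0 : exists2 v0 : R, 0 < v0 &
  forall v : R, `|v| <= v0 -> 1 / 2 <= cos v <= 1 - v ^+ 2 / 8.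
Proof.
have : \forall x \near (0 : R), (1 / 2 : R) < cos x.
  have c0 : cos x @[x --> (0 : R)] --> (1 : R).
    by rewrite -[X in _ --> X](@cos0 R); exact: continuous_cos.
  by apply: (cvgr_gt _ c0); lra.
move=> /nbhs_ballP[d /= d0 Hd].
have cosd x : `|x| < d -> 1 / 2 < cos x.
  by move=> xd; apply: Hd; rewrite /ball /= sub0r normrN.
exists (d / 2); first exact: divr_gt0.
move=> v vd.
have vd' : `|v| < d by apply: (le_lt_trans vd); rewrite gtr_pMr ?invf_lt1 ?ltr1n.
rewrite (ltW (cosd _ vd'))/=.
set w := `|v| / 2; have w0 : 0 <= w by rewrite divr_ge0.
have sinw : w / 2 <= sin w.
  have [|c] := @MVT_segment R sin cos 0 w w0 (fun x _ => is_derive_sin x).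
    by apply: continuous_subspaceT => x; exact: continuous_sin.
  rewrite in_itv /= => /andP[c0 cw]; rewrite sin0 !subr0 => ->.
  have : 1 / 2 <= cos c.
    apply/ltW/cosd; rewrite ger0_norm// (le_lt_trans cw)//.
    by apply: le_lt_trans vd'; rewrite /w ler_pdivrMr// ler_peMr// ler1n.
  by move=> h; rewrite -[leLHS]mulr1 mulrAC -mulrA mulrC ler_wpM2r// mulrC.
have -> : cos v = 1 - sin w ^+ 2 *+ 2.
  rewrite -cos_norm (_ : `|v| = w *+ 2); last by rewrite /w -mulr_natr; field.
  by rewrite cos_mulr2n cos2sin2; ring.
rewrite lerD2l lerN2 (_ : v ^+ 2 / 8 = (w / 2) ^+ 2 *+ 2).
  by rewrite lerMn2r/= ler_sqr ?nnegrE ?divr_ge0// (le_trans _ sinw) ?divr_ge0.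
rewrite -[v ^+ 2]ger0_norm ?sqr_ge0// normrX /w -mulr_natr.
by field.
Qed.

End cosine_bounds.

(** * The gain from one regeneration block *)

Section blocks.
Context {R : realType}.
Local Notation RR := (measurableTypeR R).
Context (S : set R) (k : R -> R.-pker RR ~> RR) (V : R -> R)
  (C : set RR) (nu : probability RR R) (theta lam b M : R)
  (D : drift_minor S k V C nu theta lam b M).
Context (g : R -> R) (mg : measurable_fun [set: RR] (g : RR -> RR)).
Local Notation K := (kop k).
Local Notation dom := (Vdom V).
Local Notation N f := (\int[nu]_y f y).

Let mV := dm_mV D.
Let V1 := dm_V1 D.
Let theta0 : 0 < theta. Proof. by case/andP: (dm_theta D). Qed.

(* d'Alembert's equation: it replaces the complex exponential in the
   estimates of the characteristic function. *)
Definition dalembert (t : R) (F : R -> R -> R) : Prop :=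
  forall z w x, F (z + w) x + F (z - w) x = 2 * cos (t * w) * F z x.

Lemma measurable_nu_section F : bjm F ->
  measurable_fun [set: RR] ((fun z => N (F z)) : RR -> RR).
Proof.
move=> bF; have [mF [c Fc]] := bF.
have dF z : dom (F z) by exact: (bjm_dom D).
rewrite (_ : (fun z => _) = (fun z => N (fun y => F z y + c) - c)); last first.
  apply/funext => z; rewrite (VintD mV V1 (Vprob_nu D))//; last exact: Vdom_cst.
  by rewrite (Vint_cst (Vprob_nu D)) addrK.
apply: measurable_funB => //; apply: measurableT_comp => /=.
  exact: fine_measurable.
apply: (@measurable_fun_fubini_tonelli_F _ _ RR RR R nu
  (fun p => (F p.1 p.2 + c)%:E)).
  apply/measurable_EFinP; exact: measurable_funD.
move=> p; rewrite lee_fin; have := Fc p.1 p.2.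
by rewrite ler_norml -lerBlDr sub0r => /andP[].
Qed.

Section fixed_parameters.
Context (sg : nat -> R) (Ssg : forall n, S (sg n)).
Local Notation E := (Eop k g sg).
Local Notation P := (Pop k sg).

Lemma dalembert_Eop t T m F : bjm F -> dalembert t F -> dalembert t (E T m F).
Proof.
move=> bF dF; elim: T m => [//|T IH] m z w x /=.
have dE z' : dom (E T m.+1 F z') by exact: (Eop_dom D).
rewrite -(kopD D)// -(kopZ D)//; congr (K _ _ x); apply/funext => y.
by rewrite -(IH m.+1) addrAC [z - w + _]addrAC.
Qed.

(* From [C] the chain may regenerate, run through a block of [l + 1] positions
   ending in [C], and regenerate again. *)
Lemma block_gain l n Phi h z x : bjm Phi -> dom h ->
  (forall z x, Phi z x <= h x) -> C x ->
  E l.+2 n Phi z x <= P l.+2 n h x -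
    theta ^+ 2 * Qop k C nu g sg l n.+1 (fun w => N h - N (Phi (z + g x + w))).
Proof.
move=> bP dh Ph Cx.
have [mP [c Pc]] := bP.
set psi := fun w : R => N (Phi w).
have mpsi : measurable_fun [set: RR] (psi : RR -> RR).
  exact: measurable_nu_section.
have psic w : `|psi w| <= c.
  have dPw : dom (Phi w) by exact: (bjm_dom D).
  apply: (le_trans (Vint_norm mV V1 (Vprob_nu D) dPw)).
  rewrite -[leRHS](Vint_cst (Vprob_nu D)).
  apply: (Vint_le mV V1 (Vprob_nu D)) => //; first exact: Vdom_norm.
  exact: Vdom_cst.
have psiA w : psi w <= N h.
  by apply: (Vint_le mV V1 (Vprob_nu D)) => //; exact: (bjm_dom D).
set phi := fun w : R => N h - psi w.
have mphi : measurable_fun [set: RR] (phi : RR -> RR) by exact: measurable_funB.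
have phi0 w : 0 <= phi w by rewrite subr_ge0.
have phic w : `|phi w| <= `|N h| + c.
  by apply: (le_trans (ler_normB _ _)); rewrite lerD2l.
have bq := Qfun_bjm D mg mphi phic.
pose Phi1 := E 1%N (n.+1 + l)%N Phi; pose h1 := P 1%N (n.+1 + l)%N h.
have bP1 : bjm Phi1 by exact: (Eop_bjm D).
have dh1 : dom h1 by exact: (Pop_dom D).
(* In backward order the last regeneration comes first: at a block end in [C] the majorant [h1] has
   the slack [theta * phi]. The first regeneration, out of [x], supplies the second factor [theta]
   at the end. *)
have step1 w y : Phi1 w y + theta * Qfun C g phi w y <= h1 y.
  rewrite /Phi1 /h1 /= -lerBrDl.
  have dPw : dom (Phi (w + g y)) by exact: (bjm_dom D).
  rewrite -(kopB D)//.
  have dd : dom (fun u => h u - Phi (w + g y) u) by exact: VdomB.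
  have dd0 u : 0 <= h u - Phi (w + g y) u by rewrite subr_ge0.
  have [Cy|nCy] := pselect (C y); last first.
    rewrite /Qfun indicE memNset// mul0r mulr0 -[leLHS](kop_cst D 0 y (Ssg (n.+1 + l).+1)).
    by apply: (kop_le D) => //; exact: Vdom_cst.
  apply: (le_trans _ (kop_minor D (Ssg _) dd dd0 Cy)).
  rewrite /Qfun indicE mem_set// mul1r ler_wpM2l ?(ltW theta0)//.
  by rewrite (VintB mV V1 (Vprob_nu D)).
pose f := E l n.+1 Phi1 (z + g x); pose h2 := P l n.+1 h1.
have step2 y : f y + theta * E l n.+1 (Qfun C g phi) (z + g x) y <= h2 y.
  rewrite /f -(EopZ D)// -(EopD D)//; last exact: bjmZ.
  apply: (Eop_le_Pop D) => //.
  by apply: bjmD => //; exact: bjmZ.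
have df : dom f by exact: (Eop_dom D).
have dh2 : dom h2 by exact: (Pop_dom D).
have dq : dom (E l n.+1 (Qfun C g phi) (z + g x)) by exact: (Eop_dom D).
have -> : E l.+2 n Phi z x = K (sg n.+1) f x.
  rewrite /= /f -/(E l.+1 n.+1 Phi (z + g x)).
  by congr (K _ _ x); apply/funext => y; rewrite -[in LHS]addn1 Eop_cat.
have -> : P l.+2 n h x = K (sg n.+1) h2 x.
  rewrite /= /h2 -/(P l.+1 n.+1 h).
  by congr (K _ _ x); apply/funext => y; rewrite -[in LHS]addn1 Pop_cat.
have aux (u v w : R) : w <= v - u -> u <= v - w by lra.
apply: aux; rewrite -(kopB D)//.
have dd : dom (fun u => h2 u - f u) by exact: VdomB.
have eq0 u : 0 <= E l n.+1 (Qfun C g phi) (z + g x) u.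
  by apply: (Eop_ge0 D) => // z' y'; exact: Qfun_ge0.
have dd0 u : 0 <= h2 u - f u.
  rewrite subr_ge0 (le_trans _ (step2 u))// lerDl mulr_ge0//; exact: ltW.
apply: (le_trans _ (kop_minor D (Ssg _) dd dd0 Cx)).
rewrite expr2 -mulrA ler_wpM2l ?(ltW theta0)//.
have dQ' : dom (E l n.+1 (Qfun C g (fun w => N h - N (Phi (z + g x + w)))) 0).
  apply: (Eop_dom D) => //.
  rewrite (_ : Qfun _ _ _ = fun z' y => Qfun C g phi (z' + (z + g x)) y).
    exact: bjm_translate.
  apply/funext => z'; apply/funext => y; rewrite /Qfun /phi /psi.
  by rewrite (_ : z + g x + (z' + g y) = z' + (z + g x) + g y)//; ring.
rewrite /Qop -(VintZ mV V1 (Vprob_nu D))//.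
apply: (Vint_le mV V1 (Vprob_nu D)) => //; first exact: VdomZ.
move=> u; rewrite lerBrDl (le_trans _ (step2 u))// lerD2l.
rewrite ler_wpM2l ?(ltW theta0)//.
rewrite le_eqVlt; apply/orP; left; apply/eqP.
rewrite -[z + g x in RHS]add0r -Eop_translate.
congr (E _ _ _ _ u); apply/funext => z'; apply/funext => y.
rewrite /Qfun /phi /psi.
by rewrite (_ : z + g x + (z' + g y) = z' + (z + g x) + g y)//; ring.
Qed.

End fixed_parameters.
End blocks.

Section block_contraction.
Context {R : realType}.
Local Notation RR := (measurableTypeR R).
Context (S : set R) (k : R -> R.-pker RR ~> RR) (V : R -> R)
  (C : set RR) (nu : probability RR R) (theta lam b M : R)
  (D : drift_minor S k V C nu theta lam b M).
Context (g : R -> R) (mg : measurable_fun [set: RR] (g : RR -> RR)).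
Local Notation dom := (Vdom V).
Local Notation N f := (\int[nu]_y f y).

Let mV := dm_mV D.
Let V1 := dm_V1 D.
Let V0 x : 0 <= V x. Proof. exact: le_trans (V1 x). Qed.
Let lam0 : 0 < lam. Proof. by case/andP: (dm_lam D). Qed.
Let lam1 : lam < 1. Proof. by case/andP: (dm_lam D). Qed.
Let b0 : 0 < b. Proof. exact: dm_b D. Qed.
Let theta0 : 0 < theta. Proof. by case/andP: (dm_theta D). Qed.
Let dV : dom V. Proof. exact: VdomV. Qed.
Let NV0 : 0 <= N V. Proof. exact: Rintegral_ge0. Qed.

(* By d'Alembert's equation, psi cannot be close to its upper bound A on both
   of two separated intervals. *)
Lemma Qop_gap sg l m (psi : R -> R) (A c t v0 c1 r1 c2 r2 q z : R) :
  (forall n, S (sg n)) ->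
  (forall v : R, `|v| <= v0 -> 1 / 2 <= cos v <= 1 - v ^+ 2 / 8) ->
  measurable_fun [set: RR] (psi : RR -> RR) -> (forall w, `|psi w| <= c) ->
  (forall w, psi w <= A) -> 0 <= A ->
  (forall w v, psi (w + v) + psi (w - v) = 2 * cos (t * v) * psi w) ->
  0 <= t -> t * ((`|c1 - c2| + (r1 + r2)) / 2) <= v0 ->
  r1 + r2 < `|c1 - c2| -> 0 <= q ->
  q <= Qop k C nu g sg l m (ball_ind c1 r1) ->
  q <= Qop k C nu g sg l m (ball_ind c2 r2) ->
  A * (((`|c1 - c2| - (r1 + r2)) / 2) ^+ 2 / 8 * t ^+ 2) * q <=
  Qop k C nu g sg l m (fun w => A - psi (z + w)).
Proof.
move=> Ssg cosv mpsi psic psiA A0 dpsi t0 tv r12 q0 q1 q2.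
set eta := (_ - _) / 2; set kap := eta ^+ 2 / 8 * t ^+ 2.
have eta0 : 0 < eta by rewrite divr_gt0// subr_gt0.
have kap0 : 0 <= kap by rewrite mulr_ge0 ?divr_ge0 ?sqr_ge0.
have Ak0 : 0 <= A * kap by exact: mulr_ge0.
have mphi : measurable_fun [set: RR] ((fun w => A - psi (z + w)) : RR -> RR).
  apply: measurable_funB => //; apply: (measurableT_comp mpsi).
  exact: measurable_funD.
have phic w : `|A - psi (z + w)| <= `|A| + c.
  by apply: (le_trans (ler_normB _ _)); rewrite lerD2l.
have gain c' r' : q <= Qop k C nu g sg l m (ball_ind c' r') ->
    (forall w, `|w - c'| <= r' -> psi (z + w) <= A - A * kap) ->
    A * kap * q <= Qop k C nu g sg l m (fun w => A - psi (z + w)).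
  move=> qb hb; apply: (le_trans (ler_wpM2l Ak0 qb)).
  rewrite -(QopZ D mg Ssg _ _ _ (measurable_ball_ind _ _) (ball_ind_norm _ _)).
  have nb w : `|A * kap * ball_ind c' r' w| <= A * kap + (`|A| + c).
    rewrite normrM ger0_norm//; apply: (@le_trans _ _ (A * kap)).
      by rewrite ler_piMr// ball_ind_norm.
    by rewrite lerDl (le_trans _ (phic 0)).
  have nb' w : `|A - psi (z + w)| <= A * kap + (`|A| + c).
    by rewrite (le_trans (phic w))// lerDr.
  apply: (Qop_le D mg Ssg l m _ mphi nb nb').
    by apply: measurable_funM => //; exact: measurable_ball_ind.
  move=> w; have [hw|hw] := leP `|w - c'| r'.
    rewrite (ball_ind_in hw) mulr1; have := hb w hw.
    by rewrite lerBrDr addrC -lerBrDr.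
  by rewrite (ball_ind_out hw) mulr0 subr_ge0.
(* Either [psi] is at most [A - A * kap] over the whole first interval, or it exceeds this value at
   some [w1], which forces it below throughout the second interval. *)
have [h1|/existsNP[w1 /not_implyP[b1 h1]]] :=
    pselect (forall w, `|w - c1| <= r1 -> psi (z + w) <= A - A * kap).
  exact: gain h1.
apply: gain q2 _ => w2 b2.
have {}h1 : A - A * kap < psi (z + w1) by rewrite ltNge; exact/negP.
(* [z + w1] and [z + w2] are symmetric about [mid], so the values of [psi] there add up to
   [2 cos (t v) psi mid <= 2 (1 - kap) A]: an excess at [w1] is a deficit at [w2]. *)
pose v := (w1 - w2) / 2; pose mid := z + (w1 + w2) / 2.
have e1 : mid + v = z + w1 by rewrite /mid /v; field.
have e2 : mid - v = z + w2 by rewrite /mid /v; field.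
have dist : `|c1 - c2| - (r1 + r2) <= `|w1 - w2| <= `|c1 - c2| + (r1 + r2).
  apply/andP; split.
    rewrite lerBlDr (_ : c1 - c2 = (w1 - w2) - ((w1 - c1) - (w2 - c2))); last by ring.
    apply: (le_trans (ler_normB _ _)); rewrite lerD2l.
    by apply: (le_trans (ler_normB _ _)); exact: lerD.
  rewrite (_ : w1 - w2 = (c1 - c2) + ((w1 - c1) - (w2 - c2))); last by ring.
  apply: (le_trans (ler_normD _ _)); rewrite lerD2l.
  by apply: (le_trans (ler_normB _ _)); exact: lerD.
have [d1 d2] := andP dist.
have vE : `|v| = `|w1 - w2| / 2 by rewrite normrM (@ger0_norm _ 2^-1)// invr_ge0.
have veta : eta <= `|v| by rewrite vE ler_pM2r ?invr_gt0.
have tvv0 : `|t * v| <= v0.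
  rewrite normrM (ger0_norm t0) (le_trans _ tv)// ler_wpM2l// vE.
  by rewrite ler_pM2r ?invr_gt0.
have /andP[cos1 cos2] := cosv _ tvv0.
have cosk : cos (t * v) <= 1 - kap.
  apply: (le_trans cos2); rewrite lerD2l lerN2 /kap mulrAC ler_wpM2r ?invr_ge0//.
  rewrite (exprMn 2 t v) [leLHS]mulrC; apply: ler_wpM2l; first exact: sqr_ge0.
  rewrite -[leRHS]ger0_norm ?sqr_ge0// normrX.
  by rewrite ler_sqr ?nnegrE// ltW.
have := dpsi mid v; rewrite e1 e2 => e3.
have : 2 * cos (t * v) * psi mid <= 2 * (1 - kap) * A.
  apply: (@le_trans _ _ (2 * cos (t * v) * A)).
    by rewrite ler_wpM2l// mulr_ge0// (le_trans _ cos1).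
  by rewrite ler_wpM2r// ler_wpM2l.
rewrite -e3 => h2.
have -> : psi (z + w2) = (psi (z + w1) + psi (z + w2)) - psi (z + w1) by ring.
rewrite lerBlDr (le_trans h2)// [X in X <= _](_ : _ = (A - A * kap) + (A - A * kap)).
  by rewrite lerD2l ltW.
by ring.
Qed.

(** If [V x] is large, the drift lowers the [V] term by enough to yield [kap]. Otherwise [C] is
    occupied at one of the first [L0] times with probability at least [1 / L0], and [block_gain]
    applies from there. *)
Lemma block_contraction s0 : S s0 -> separated_blocks k C nu g s0 ->
  exists (L : nat) (kap rho t0 tau : R),
  [/\ (0 < L)%N, 0 < kap, 0 <= rho, 0 < t0 & 0 < tau] /\
  forall (sg : nat -> R) (m : nat) (t beta : R) (Phi : R -> R -> R),
  (forall n, S (sg n)) -> 0 <= t <= t0 -> beta <= 1 / 2 ->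
  (forall i, (0 < i <= L)%N -> `|sg (m + i)%N - s0| <= tau) ->
  bjm Phi -> dalembert t Phi ->
  (forall z x, Phi z x <= 1 - beta + rho * t ^+ 2 * V x) ->
  forall z x, Eop k g sg L m Phi z x <=
    1 - beta - kap * t ^+ 2 + rho * t ^+ 2 * V x.
Proof.
move=> Ss0 [l [c1 [r1 [c2 [r2 [r12 Q1 Q2]]]]]].
have [v0 v00 cosv] := @cos_near0 R.
set q1 := Qop _ _ _ _ _ _ _ _ in Q1; set q2 := Qop _ _ _ _ _ _ _ _ in Q2.
(* Half of the smaller mass is given up to the change of parameters from [s0] to [sg]; [q / Bl] is
   the distance that this allows. *)
pose q := Num.min q1 q2 / 2.
have q0 : 0 < q by rewrite divr_gt0// lt_min Q1.
pose bb := b / (1 - lam).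
have bb0 : 0 < bb by rewrite divr_gt0// subr_gt0.
(* Above the level [vv] the drift lowers [V] by [(1 - lam) V >= 2 bb], of which [bb] pays for its
   additive constant and [bb] is left for [kap = rho * bb]. From below [vv], [L0] is long enough for
   two expected visits to [C]. *)
pose vv := 2 * bb / (1 - lam).
have d1 : 0 < 1 - lam by rewrite subr_gt0.
pose L0 := (Num.truncn ((vv + 2 * b) / (1 - lam))).+1.
have L0b : vv + 2 * b <= (1 - lam) * L0%:R.
  by rewrite -ler_pdivrMl// mulrC ltW// truncnS_gt.
pose L := (L0 + l.+2)%N.
pose eta := (`|c1 - c2| - (r1 + r2)) / 2.
have eta0 : 0 < eta by rewrite divr_gt0// subr_gt0.
(* Gain from a visit to [C], in units of [t ^ 2]: two regenerations, the lower bound 1/2 of the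
   majorant, the deficit of the cosine and the mass [q]. *)
pose gam := theta ^+ 2 * (1 / 2 * (eta ^+ 2 / 8) * q).
have gam0 : 0 < gam.
  have e8 : 0 < eta ^+ 2 / 8 by apply: divr_gt0 => //; exact: exprn_gt0.
  apply: mulr_gt0; first exact: exprn_gt0.
  by apply: mulr_gt0 => //; apply: mulr_gt0 => //; exact: divr_gt0.
have L00 : 0 < L0%:R :> R by rewrite ltr0n.
(* Then [rho * bb = gam / (2 * L0)]: the possible increase of the [V] term costs half of the
   expected gain [gam / L0], and the other half is [kap]. *)
pose rho := gam / (2 * bb * L0%:R).
have rho0 : 0 < rho.
  by apply: divr_gt0 => //; apply: mulr_gt0 => //; exact: mulr_gt0.
pose kap := rho * bb.
pose w0 := (`|c1 - c2| + (r1 + r2)) / 2.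
have r0 c r : 0 < Qop k C nu g (fun=> s0) l 0 (ball_ind c r) -> 0 <= r.
  move=> Qp; rewrite leNgt; apply/negP => rn.
  suff : Qop k C nu g (fun=> s0) l 0 (ball_ind c r) = 0 by move=> e; rewrite e ltxx in Qp.
  have -> : ball_ind c r = (fun=> 0).
    by apply/funext => w; rewrite ball_ind_out// (lt_le_trans rn).
  rewrite (_ : (fun=> 0) = (fun w : R => 0 * 1)); last by apply/funext => w; rewrite mul0r.
  rewrite (QopZ D mg (fun=> Ss0) _ _ _ (c := 1)) ?mul0r//.
  by move=> w; rewrite normr1.
have w00 : 0 < w0.
  have := r0 _ _ Q1; have := r0 _ _ Q2 => r20 r10.
  by rewrite divr_gt0// ltr_wpDr ?addr_ge0// (le_lt_trans _ r12)// addr_ge0.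
pose Bl := perturb_cst lam b M l * N V + 1.
have Bl0 : 0 < Bl by rewrite ltr_wpDl// mulr_ge0// (perturb_cst_ge0 D).
exists L, kap, rho, (v0 / w0), (q / Bl); split.
  split=> //; [exact: mulr_gt0|exact: ltW|exact: divr_gt0|exact: divr_gt0].
move=> sg m t beta Phi Ssg /andP[t0 tv] beta1 near_s0 bP dP Ph.
have cst a : dom (fun=> a) by exact: Vdom_cst.
set h := fun x => 1 - beta + rho * t ^+ 2 * V x in Ph.
have dh : dom h by apply: VdomD => //; exact: VdomZ.
have rt0 : 0 <= rho * t ^+ 2 by apply: mulr_ge0; [exact: ltW|exact: sqr_ge0].
have h12 x : 1 / 2 <= h x.
  have hV : 0 <= rho * t ^+ 2 * V x by exact: mulr_ge0.
  have aux (u w : R) : u <= 1 / 2 -> 0 <= w -> 1 / 2 <= 1 - u + w by lra.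
  exact: aux.
have Ph1 T n x : Pop k sg T n h x = 1 - beta + rho * t ^+ 2 * Pop k sg T n V x.
  by rewrite (PopD D)//; [rewrite (Pop_cst D)// (PopZ D)|exact: VdomZ].
have PV T n x := PopV D Ssg T n x.
have step (i : nat) z x : (i < L0)%N ->
    Eop k g sg L m Phi z x <= Pop k sg L m h x -
      gam * t ^+ 2 * Pop k sg i m \1_C x.
  move=> iL0.
  (* Padding after the block keeps the total length [L] independent of the time [i] of the visit. *)
  pose rest := (L0 - i)%N.
  have LE : L = (i + (l.+2 + rest))%N.
    by rewrite /L /rest addnCA addnC subnKC// ltnW.
  rewrite LE Eop_cat Pop_cat.
  pose Phir := Eop k g sg rest (m + i + l.+2)%N Phi.
  pose hr := Pop k sg rest (m + i + l.+2)%N h.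
  have bPr : bjm Phir by exact: (Eop_bjm D).
  have dhr : dom hr by exact: (Pop_dom D).
  have dPr : dalembert t Phir by exact: (dalembert_Eop D).
  have Phr z' x' : Phir z' x' <= hr x' by exact: (Eop_le_Pop D).
  have hr12 x' : 1 / 2 <= hr x'.
    rewrite -[leLHS](Pop_cst D Ssg (1 / 2) rest (m + i + l.+2)%N x').
    exact: (Pop_le D).
  have dC : dom \1_C by exact: (Vdom_indic V1 (dm_mC D)).
  have dPh : dom (Pop k sg (l.+2 + rest)%N (m + i)%N h) by exact: (Pop_dom D).
  have dgC : dom (fun x => gam * t ^+ 2 * \1_C x) by exact: VdomZ.
  have inner z' x' : Eop k g sg (l.+2 + rest)%N (m + i)%N Phi z' x' +
      gam * t ^+ 2 * \1_C x' <= Pop k sg (l.+2 + rest)%N (m + i)%N h x'.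
    rewrite Eop_cat Pop_cat -/Phir -/hr.
    have [Cx|nCx] := pselect (C x'); last first.
      by rewrite indicE memNset// mulr0 addr0; exact: (Eop_le_Pop D).
    rewrite indicE mem_set// mulr1 -lerBrDr.
    apply: (le_trans (block_gain D mg Ssg l (m + i) z' bPr dhr Phr Cx)).
    rewrite lerD2l lerN2 /gam -[leLHS]mulrA ler_wpM2l ?sqr_ge0//.
    set A := N hr.
    have A12 : 1 / 2 <= A.
      rewrite -[leLHS](Vint_cst (Vprob_nu D)).
      exact: (Vint_le mV V1 (Vprob_nu D)).
    pose psi := fun w : R => N (Phir w).
    have mpsi : measurable_fun [set: RR] (psi : RR -> RR).
      exact: (measurable_nu_section D).
    have [mPr [c Pc]] := bPr.
    have dPw w : dom (Phir w) by exact: (bjm_dom D).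
    have psic w : `|psi w| <= c.
      apply: (le_trans (Vint_norm mV V1 (Vprob_nu D) (dPw w))).
      rewrite -[leRHS](Vint_cst (Vprob_nu D)).
      by apply: (Vint_le mV V1 (Vprob_nu D)) => //; exact: Vdom_norm.
    have psiA w : psi w <= A by exact: (Vint_le mV V1 (Vprob_nu D)).
    have dpsi w v : psi (w + v) + psi (w - v) = 2 * cos (t * v) * psi w.
      rewrite /psi -(VintD mV V1 (Vprob_nu D))// -(VintZ mV V1 (Vprob_nu D))//.
      by congr (Rintegral _ _ _); apply/funext => y; rewrite dPr.
    have qq c' r' q' : q' = Qop k C nu g (fun=> s0) l 0 (ball_ind c' r') ->
        Num.min q1 q2 <= q' ->
        q <= Qop k C nu g sg l (m + i).+1 (ball_ind c' r').
      move=> q'E q'm.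
      have e0 : 0 <= q / Bl by rewrite divr_ge0// ltW.
      have hq : `|Qop k C nu g sg l (m + i).+1 (ball_ind c' r') -
          Qop k C nu g (fun=> s0) l 0 (ball_ind c' r')| <=
          q / Bl * perturb_cst lam b M l * N V.
        apply: (Qop_perturb D mg Ssg (fun=> Ss0) (measurable_ball_ind c' r')
          (ball_ind_norm c' r') e0) => j /andP[j0 jl].
        rewrite addSnnS -addnA; apply: near_s0.
        rewrite addnS ltn0Sn /= LE -addnS leq_add2l ltn_addr// ltnS.
        exact: leqW.
      rewrite -q'E in hq.
      have : q / Bl * perturb_cst lam b M l * N V <= q.
        rewrite -mulrA [_ / Bl * _]mulrAC ler_pdivrMr// ler_wpM2l ?(ltW q0)//.
        by rewrite /Bl lerDl.
      move=> h2; have {}hq := le_trans hq h2.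
      have qE : Num.min q1 q2 = q + q by rewrite /q -splitr.
      by move: hq; rewrite ler_norml => /andP[hq _]; rewrite qE in q'm; lra.
    have tw : t * w0 <= v0 by rewrite -ler_pdivlMr.
    have := @Qop_gap sg l (m + i).+1 psi A c t v0 c1 r1 c2 r2 q (z' + g x') Ssg
      cosv mpsi psic psiA (le_trans _ A12) dpsi t0 tw r12 (ltW q0)
      (qq _ _ _ erefl _) (qq _ _ _ erefl _).
    move=> gap; apply: (le_trans _ (gap _ _ _)) => //; last 2 first.
      by rewrite ge_min lexx.
      by rewrite ge_min lexx orbT.
    rewrite -/eta mulrAC ler_wpM2r ?(ltW q0)// -[leLHS]mulrA.
    by rewrite ler_wpM2r// mulr_ge0 ?divr_ge0 ?sqr_ge0.
  have aux (u v w : R) : u + w <= v -> u <= v - w by lra.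
  apply: aux.
  rewrite -(PopZ D)// -(Eop_snd _ g sg _ _ _ z).
  have bgC : bjm (fun _ x => gam * t ^+ 2 * \1_C x).
    by apply: bjmZ; exact: (bjm_indic_snd (dm_mC D)).
  rewrite -(EopD D)//; last exact: (Eop_bjm D).
  apply: (Eop_le_Pop D) => //.
  by apply: bjmD => //; exact: (Eop_bjm D).
move=> z x.
have lL : lam ^+ L <= lam.
  by rewrite -[leRHS]expr1 ler_wiXn2l// ltW.
have lL0 : 0 <= lam ^+ L by rewrite exprn_ge0// ltW.
have PVL : Pop k sg L m V x <= lam * V x + bb.
  apply: (le_trans (PV L m x)); apply: lerD; first by rewrite ler_wpM2r.
  by rewrite ler_piMr ?(ltW bb0)// gerBl.
have PhL := Ph1 L m x.
have t20 : 0 <= t ^+ 2 by exact: sqr_ge0.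
have [Vx|Vx] := leP (V x) vv; last first.
  have e1 : Eop k g sg L m Phi z x <= Pop k sg L m h x by exact: (Eop_le_Pop D).
  apply: (le_trans e1); rewrite PhL.
  have h2 : rho * t ^+ 2 * Pop k sg L m V x <= rho * t ^+ 2 * (lam * V x + bb).
    exact: ler_wpM2l.
  have h3 : rho * t ^+ 2 * (2 * bb) <= rho * t ^+ 2 * ((1 - lam) * V x).
    by apply: ler_wpM2l => //; rewrite -ler_pdivrMl// mulrC ltW.
  have h4 : rho * t ^+ 2 * (lam * V x + bb) + kap * t ^+ 2 =
      rho * t ^+ 2 * V x - rho * t ^+ 2 * ((1 - lam) * V x) + rho * t ^+ 2 * (2 * bb).
    by rewrite /kap; ring.
  have aux (a0 u v w y z0 k0 : R) : u <= v -> v + k0 = w - y + z0 -> z0 <= y ->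
      a0 + u <= a0 - k0 + w by lra.
  exact: aux h2 h4 h3.
have [i iL0 Pi] : exists2 i, (i < L0)%N & 1 / L0%:R <= Pop k sg i m \1_C x.
  apply: contrapT => nP.
  have Pl i : (i < L0)%N -> Pop k sg i m \1_C x <= 1 / L0%:R.
    move=> iL0; rewrite leNgt; apply/negP => hi; apply: nP.
    by exists i => //; exact: ltW.
  have sum1 : \sum_(i < L0) Pop k sg i m \1_C x <= 1.
    have : \sum_(i < L0) Pop k sg i m \1_C x <= \sum_(i < L0) (1 / L0%:R : R).
      by apply: ler_sum => i _; exact: Pl.
    by rewrite sumr_const card_ord -[_ *+ L0]mulr_natr mul1r mulVf ?gt_eqF.
  have h1 := le_trans (visits_lower D Ssg L0 m x) (ler_wpM2l (ltW b0) sum1).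
  have aux (u v w y : R) : 0 < y -> u <= v -> v + 2 * y <= w -> w - u <= y * 1 -> False.
    by move=> *; lra.
  exact: aux b0 Vx L0b h1.
apply: (le_trans (step i z x iL0)); rewrite PhL.
have g1 : gam * t ^+ 2 * (1 / L0%:R) <= gam * t ^+ 2 * Pop k sg i m \1_C x.
  by rewrite ler_wpM2l// mulr_ge0// ltW.
have g2 : gam * t ^+ 2 * (1 / L0%:R) = 2 * (kap * t ^+ 2).
  by rewrite /kap /rho; field; rewrite !gt_eqF.
have g3 : rho * t ^+ 2 * Pop k sg L m V x <= rho * t ^+ 2 * (V x + bb).
  apply: ler_wpM2l => //; apply: (le_trans PVL); rewrite lerD2r ler_piMl//.
  exact: ltW.
have g4 : rho * t ^+ 2 * (V x + bb) = rho * t ^+ 2 * V x + kap * t ^+ 2.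
  by rewrite /kap; ring.
have aux (a0 u v w y z0 k0 : R) : u <= v -> v = w + k0 -> z0 = 2 * k0 -> z0 <= y ->
    a0 + u - y <= a0 - k0 + w by move=> *; lra.
exact: aux g3 g4 g2 g1.
Qed.

Lemma iterated_contraction s0 : S s0 -> separated_blocks k C nu g s0 ->
  exists (L : nat) (kap rho t0 tau : R),
  [/\ (0 < L)%N, 0 < kap, 0 <= rho, 0 < t0 & 0 < tau] /\
  forall (sg : nat -> R) (m J : nat) (t : R) (Phi : R -> R -> R),
  (forall n, S (sg n)) -> 0 <= t <= t0 -> J%:R * kap * t ^+ 2 <= 1 / 2 ->
  (forall i, (0 < i <= J * L)%N -> `|sg (m + i)%N - s0| <= tau) ->
  bjm Phi -> dalembert t Phi -> (forall z x, Phi z x <= 1) ->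
  forall z x, Eop k g sg (J * L) m Phi z x <=
    1 - J%:R * kap * t ^+ 2 + rho * t ^+ 2 * V x.
Proof.
move=> Ss0 sep; have [L [kap [rho [t0 [tau [[L0 kap0 rho0 t00 tau0] H]]]]]] :=
  block_contraction Ss0 sep.
exists L, kap, rho, t0, tau; split => //.
move=> sg m J t Phi Ssg tt; elim: J m => [|J IH] m Jt near_s0 bP dP P1 z x.
  rewrite mul0n !mul0r subr0 /= (le_trans (P1 z x))// lerDl.
  by apply: mulr_ge0 => //; apply: mulr_ge0 => //; exact: sqr_ge0.
have kt : 0 <= kap * t ^+ 2 by rewrite mulr_ge0 ?sqr_ge0// ltW.
have Jt' : J%:R * kap * t ^+ 2 <= 1 / 2.
  apply: le_trans Jt; rewrite -!mulrA ler_wpM2r// ler_nat; exact: leqnSn.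
rewrite mulSn Eop_cat.
have bP' : bjm (Eop k g sg (J * L) (m + L)%N Phi) by exact: (Eop_bjm D).
have dP' : dalembert t (Eop k g sg (J * L) (m + L)%N Phi).
  exact: (dalembert_Eop D).
have IH' := IH (m + L)%N Jt' _ bP dP P1.
apply: (le_trans (H sg m t (J%:R * kap * t ^+ 2) _ Ssg tt Jt' _ bP' dP' (IH' _) z x)).
- by move=> i /andP[i0 iL]; apply: near_s0; rewrite i0 mulSn; exact: (leq_trans iL (leq_addr _ _)).
- move=> i /andP[i0 iL]; rewrite -addnA; apply: near_s0.
  by rewrite addn_gt0 i0 orbT mulSn leq_add2l.
- by rewrite lerD2r -natr1 le_eqVlt; apply/orP; left; apply/eqP; ring.
Qed.

End block_contraction.

(** * Estimates along the annealing sequence *)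

Section annealed.
Context {R : realType}.
Local Notation RR := (measurableTypeR R).
Context (phi0 : R) (phi01 : 0 < phi0 < 1).

Definition Sphi : set R := [set s | phi0 < s <= 1].

(* The index is clipped so that every parameter, also at index 0 and beyond
   [p], lies in ]phi0, 1]. *)
Definition anneal_clip (p n : nat) : R :=
  phi0 + (minn (maxn n 1) p)%:R * (1 - phi0) / p%:R.

Let d0 : 0 < 1 - phi0. Proof. by rewrite subr_gt0; case/andP: phi01. Qed.

Lemma anneal_clipE p n : (0 < n <= p)%N -> anneal_clip p n = annealing phi0 p n.
Proof.
by move=> /andP[n0 np]; rewrite /anneal_clip (maxn_idPl n0) (minn_idPl np).
Qed.

Lemma anneal_clip_in p n : (0 < p)%N -> Sphi (anneal_clip p n).
Proof.
move=> p0; rewrite /Sphi /anneal_clip /=; set i := minn _ _.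
have i0 : (0 < i)%N by rewrite leq_min p0 leq_max orbT.
have ip : (i <= p)%N by exact: geq_minr.
have pR : 0 < p%:R :> R by rewrite ltr0n.
apply/andP; split; first by rewrite ltrDl divr_gt0// mulr_gt0// ltr0n.
rewrite -lerBrDl ler_pdivrMr// mulrC ler_wpM2l ?(ltW d0)//.
by rewrite ler_nat.
Qed.

Lemma anneal_clip_step p n : (0 < p)%N ->
  `|anneal_clip p n.+1 - anneal_clip p n| <= p%:R^-1.
Proof.
move=> p0; have pR : 0 < p%:R :> R by rewrite ltr0n.
rewrite /anneal_clip; set i := minn (maxn n 1) p; set j := minn (maxn n.+1 1) p.
have [ij ji] : (i <= j)%N /\ (j <= i.+1)%N.
  by rewrite /i /j; lia.
have -> : phi0 + j%:R * (1 - phi0) / p%:R - (phi0 + i%:R * (1 - phi0) / p%:R) =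
    (j - i)%:R * (1 - phi0) / p%:R.
  by rewrite natrB//; ring.
rewrite ger0_norm; last by rewrite divr_ge0// mulr_ge0// ltW.
rewrite -[leRHS]mul1r ler_wpM2r ?invr_ge0 ?(ltW pR)// -[leRHS]mulr1.
have ji1 : (j - i)%:R <= 1 :> R by rewrite -[leRHS]/(1%:R) ler_nat; lia.
by apply: ler_pM => //; [exact: ltW|rewrite gerBl; case/andP: phi01 => /ltW].
Qed.

Context (k : R -> R.-pker RR ~> RR) (V : R -> R)
  (C : set RR) (nu : probability RR R) (theta lam b M : R)
  (D : drift_minor Sphi k V C nu theta lam b M).
Context (g : R -> R) (mg : measurable_fun [set: RR] (g : RR -> RR)).
Local Notation K := (kop k).
Local Notation dom := (Vdom V).
Local Notation N f := (\int[nu]_y f y).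

Let mV := dm_mV D.
Let V1 := dm_V1 D.
Let V0 x : 0 <= V x. Proof. exact: le_trans (V1 x). Qed.
Let dV : dom V. Proof. exact: VdomV. Qed.

Lemma annealed_quadratic (G : R) : (forall x, `|g x| <= G * sqrtV V x) ->
  exists2 B : R, 0 <= B & exists p0, forall p, (p0 <= p)%N ->
  exists a : R, forall F x, bjm F -> (forall z x, F z x <= (z - a) ^+ 2) ->
    Eop k g (anneal_clip p) p 0 F 0 x <= B * (V x + p%:R + 1).
Proof.
move=> gG; set kap := mixing_cst V nu theta lam b M.
have kap0 : 0 <= kap by exact: (mixing_cst_ge0 D).
(* Consecutive parameters differ by at most [1 / p], so windows of length [p / c] with
   [c >= 2 * kap] are short enough; [2 * c] of them cover the path despite rounding. *)
pose c := (Num.truncn (2 * kap)).+1.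
have ck : 2 * kap <= c%:R by rewrite ltW// truncnS_gt.
have cR : 0 < c%:R :> R by rewrite ltr0n.
exists (long_cst V nu theta lam b G (2 * c)); first exact: (long_cst_ge0 D gG).
exists c => p cp.
have p0 : (0 < p)%N by exact: leq_trans cp.
have pR : 0 < p%:R :> R by rewrite ltr0n.
pose w := (p %/ c)%N.
have ew : p%:R^-1 * w%:R * kap <= 1 / 2.
  have wc : w%:R <= p%:R / c%:R :> R.
    by rewrite ler_pdivlMr// -natrM ler_nat leq_divM.
  apply: (@le_trans _ _ (p%:R^-1 * (p%:R / c%:R) * kap)).
    by rewrite ler_wpM2r// ler_wpM2l// invr_ge0 ltW.
  rewrite mulKf ?gt_eqF// [leLHS]mulrC ler_pdivrMr// mulrAC ler_pdivlMr//.
  by rewrite mul1r mulrC.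
have Tq : (p <= 2 * c * w)%N.
  rewrite {1}(divn_eq p c) -/w -mulnA mul2n -addnn [(c * w)%N]mulnC leq_add2l.
  rewrite (leq_trans (ltnW (ltn_pmod p _)))//.
  by rewrite leq_pmull// /w divn_gt0.
have Ssg n : Sphi (anneal_clip p n) by exact: anneal_clip_in.
have e0 : 0 <= p%:R^-1 :> R by rewrite invr_ge0 ltW.
have [a Ha] := long_quadratic D mg gG 0 Ssg e0 (fun n => anneal_clip_step n p0) ew Tq.
exists a => F x bF Fa; apply: (le_trans (Ha a F 0 x bF Fa)).
by rewrite subrr subr0 expr0n /= mulr0 add0r.
Qed.

Lemma annealed_contraction s0 : Sphi s0 -> separated_blocks k C nu g s0 ->
  exists (c rho : R), [/\ 0 < c, 0 <= rho & forall a : R, 0 < a ->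
  exists p0, forall p, (p0 <= p)%N -> forall z x,
    Eop k g (anneal_clip p) p 0 (fun z _ => cos (a / p%:R * z)) z x <=
      1 - c * a ^+ 2 / p%:R + rho * (a / p%:R) ^+ 2 * (V x + b / (1 - lam))].
Proof.
move=> Ss0 sep.
have [L [kap [rho [t0 [tau0 [[L0 kap0 rho0 t00 tau00] H]]]]]] :=
  iterated_contraction D mg Ss0 sep.
have /andP[s01 s02] := Ss0.
(* The annealing reaches [s0] after the fraction [x0] of its steps. The stretch used for contraction
   ends there, as [s0] may be 1, and begins at the fraction [x0 - tau], positive since
   [tau <= x0 / 2]. *)
pose x0 := (s0 - phi0) / (1 - phi0).
have x00 : 0 < x0 by rewrite divr_gt0// subr_gt0.
have x01 : x0 <= 1 by rewrite ler_pdivrMr// mul1r lerD2r.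
pose tau := Num.min tau0 (x0 / 2).
have tau_gt0 : 0 < tau by rewrite lt_min tau00 divr_gt0.
have tau1 : tau <= tau0 by rewrite ge_min lexx.
have tau2 : tau <= x0 / 2 by rewrite ge_min lexx orbT.
have LR : 0 < L%:R :> R by rewrite ltr0n.
exists (kap * tau / (2 * L%:R)), rho; split=> //.
  by rewrite divr_gt0 ?mulr_gt0.
move=> a a0.
(* [q1] makes room for two groups of [L] steps, so that rounding at most halves their number; [q2]
   ensures [t <= t0], and [q3] keeps the total deficit below 1/2. *)
pose q1 := 2 * L%:R / tau; pose q2 := a / t0; pose q3 := 2 * kap * a ^+ 2.
exists (Num.truncn q1 + Num.truncn q2 + Num.truncn q3).+1 => p pp z x.
have p0 : (0 < p)%N by exact: leq_ltn_trans pp.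
have pR : 0 < p%:R :> R by rewrite ltr0n.
have pq (q : R) n : (Num.truncn q <= n)%N -> (n < p)%N -> q < p%:R.
  move=> qn np; apply: (lt_le_trans (truncnS_gt q)); rewrite ler_nat.
  exact: leq_ltn_trans np.
have pq1 : q1 < p%:R by apply: (pq _ _ _ pp); rewrite -addnA leq_addr.
have pq2 : q2 < p%:R.
  by apply: (pq _ _ _ pp); rewrite addnAC leq_addl.
have pq3 : q3 < p%:R by apply: (pq _ _ _ pp); rewrite leq_addl.
pose t := a / p%:R.
have t_ge0 : 0 <= t by rewrite divr_ge0// ltW.
have tt0 : 0 <= t <= t0.
  by rewrite t_ge0 /t ler_pdivrMr// mulrC -ler_pdivrMr// ltW.
pose m0 := Num.truncn (p%:R * (x0 - tau)).
pose J := Num.truncn (p%:R * tau / L%:R).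
have xt : 0 <= x0 - tau by 
  rewrite subr_ge0 (le_trans tau2)// ler_pdivrMr// ler_peMr ?(ltW x00)// ler1n.
have m01 : m0%:R <= p%:R * (x0 - tau).
  by rewrite truncn_le// mulr_ge0// ltW.
have m02 : p%:R * (x0 - tau) < m0.+1%:R by exact: truncnS_gt.
have pt0 : 0 <= p%:R * tau / L%:R by rewrite divr_ge0 ?mulr_ge0 ?ltW.
have J1 : J%:R <= p%:R * tau / L%:R by rewrite truncn_le.
have J2 : p%:R * tau / L%:R < J.+1%:R by exact: truncnS_gt.
have JL : J%:R * L%:R <= p%:R * tau by rewrite -ler_pdivlMr.
have Jlow : p%:R * tau / (2 * L%:R) <= J%:R.
  have h1 : 1 <= p%:R * tau / (2 * L%:R).
    rewrite ler_pdivlMr ?mulr_gt0// mul1r -ler_pdivrMr//.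
    exact: ltW.
  have h2 : p%:R * tau / L%:R = p%:R * tau / (2 * L%:R) + p%:R * tau / (2 * L%:R).
    by field; rewrite gt_eqF.
  have aux (u j : R) : u + u < j + 1 -> 1 <= u -> u <= j by lra.
  by apply: aux => //; rewrite -h2 natr1.
have mJ : m0%:R + J%:R * L%:R <= p%:R * x0.
  apply: (le_trans (lerD m01 JL)); rewrite -mulrDr subrK lexx//.
have mJp : (m0 + J * L <= p)%N.
  rewrite -(ler_nat R) natrD natrM (le_trans mJ)// ler_piMr// ltW//.
have near_s0 i : (0 < i <= J * L)%N -> `|anneal_clip p (m0 + i)%N - s0| <= tau0.
  move=> /andP[i0 iJ].
  have ii : (0 < m0 + i <= p)%N.
    by rewrite addn_gt0 i0 orbT (leq_trans _ mJp)// leq_add2l.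
  rewrite anneal_clipE// /annealing.
  have -> : phi0 + (m0 + i)%:R * (1 - phi0) / p%:R - s0 =
      (1 - phi0) * ((m0 + i)%:R / p%:R - x0).
    by rewrite /x0; field; rewrite !gt_eqF.
  rewrite normrM (ger0_norm (ltW d0)).
  apply: (@le_trans _ _ `|(m0 + i)%:R / p%:R - x0|).
    by rewrite ler_piMl// gerBl; case/andP: phi01 => /ltW.
  apply: le_trans tau1; rewrite ler_distl; apply/andP; split.
    rewrite ler_pdivlMr// mulrC (le_trans (ltW m02))// ler_nat.
    by rewrite -[in X in (X <= _)%N]addn1 leq_add2l.
  rewrite ler_pdivrMr// (@le_trans _ _ (p%:R * x0))//.
    by rewrite (le_trans _ mJ)// -natrM -natrD ler_nat leq_add2l.
  by rewrite mulrC ler_wpM2r ?(ltW pR)// lerDl ltW.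
have bcos : bjm (fun z' (_ : R) => cos (t * z')).
  apply: (@bjm_fst _ (fun z' => cos (t * z')) 1).
    apply: (measurableT_comp (f := cos : RR -> RR)).
      by apply: continuous_measurable_fun; exact: continuous_cos.
    exact: measurable_funM.
  by move=> z'; exact: cos_max.
have dcos : dalembert t (fun z' (_ : R) => cos (t * z')).
  by move=> z' w _; rewrite mulrDr mulrBr cosD cosB; ring.
have Ssg n : Sphi (anneal_clip p n) by exact: anneal_clip_in.
pose rest := (p - (m0 + J * L))%N.
have pE : p = (m0 + (J * L + rest))%N by rewrite /rest addnA subnKC.
have EE F : Eop k g (anneal_clip p) p 0 F z x =
    Eop k g (anneal_clip p) (m0 + (J * L + rest)) 0 F z x by rewrite -pE.
rewrite EE Eop_cat.
(* The steps after the stretch only preserve [Phi <= 1] and d'Alembert's equation; those before it,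
   treated last, turn [V] into at most [V + b / (1 - lam)]. *)
set Phi := Eop k g (anneal_clip p) rest (m0 + J * L)%N (fun z' (_ : R) => cos (t * z')).
have bPhi : bjm Phi by exact: (Eop_bjm D).
have dPhi : dalembert t Phi by exact: (dalembert_Eop D).
have Phi1 z' x' : Phi z' x' <= 1.
  rewrite -[leRHS](Eop_cst D g Ssg 1 rest (m0 + J * L)%N z' x').
  apply: (Eop_le D) => //; exact: bjm_cst.
have Jt : J%:R * kap * t ^+ 2 <= 1 / 2.
  have Jp : J%:R <= p%:R :> R.
    rewrite ler_nat (leq_trans _ mJp)// (leq_trans _ (leq_addl _ _))//.
    by rewrite leq_pmulr.
  apply: (@le_trans _ _ (p%:R * kap * t ^+ 2)).
    by rewrite -!mulrA ler_wpM2r// mulr_ge0 ?sqr_ge0// ltW.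
  rewrite /t exprMn (_ : _ * _ * _ = kap * a ^+ 2 / p%:R); last first.
    by field; rewrite gt_eqF.
  rewrite ler_pdivrMr// mulrAC ler_pdivlMr// mul1r mulrC mulrA.
  exact: ltW.
have blk := H (anneal_clip p) m0 J t Phi Ssg tt0 Jt near_s0 bPhi dPhi Phi1.
have cst c : dom (fun=> c) by exact: Vdom_cst.
have rt0 : 0 <= rho * t ^+ 2 by rewrite mulr_ge0// sqr_ge0.
have st : Eop k g (anneal_clip p) m0 0 (Eop k g (anneal_clip p) (J * L) m0 Phi) z x <=
    Pop k (anneal_clip p) m0 0
      (fun x => 1 - J%:R * kap * t ^+ 2 + rho * t ^+ 2 * V x) x.
  apply: (Eop_le_Pop D) => //; first exact: (Eop_bjm D).
  by apply: VdomD => //; exact: VdomZ.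
have -> : Eop k g (anneal_clip p) m0 0
    (Eop k g (anneal_clip p) (J * L + rest) (0 + m0)
      (fun z' (_ : R) => cos (a / p%:R * z'))) z x =
    Eop k g (anneal_clip p) m0 0 (Eop k g (anneal_clip p) (J * L) m0 Phi) z x.
  congr (Eop _ _ _ _ _ _ z x); apply/funext => z'; apply/funext => x'.
  by rewrite add0n Eop_cat.
apply: (le_trans st).
rewrite (PopD D)//; last exact: VdomZ.
rewrite (Pop_cst D)// (PopZ D)//; apply: lerD; last first.
  by rewrite ler_wpM2l//; exact: (PopV_le D).
rewrite lerD2l lerN2.
have -> : kap * tau / (2 * L%:R) * a ^+ 2 / p%:R =
    p%:R * tau / (2 * L%:R) * kap * t ^+ 2.
  by rewrite /t; field; rewrite !gt_eqF.
rewrite -[leLHS]mulrA -[leRHS]mulrA; apply: ler_wpM2r => //.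
by apply: mulr_ge0; [exact: ltW|exact: sqr_ge0].
Qed.

(** By invariance [T * mu(g)] is the [mu]-mean of [Hsum], so the difference is the [mu]-mean of
    [usum], which is bounded uniformly in [T]. *)
Lemma mean_identification s (mu : {measure set RR -> \bar R}) (G : R) :
  (forall x, `|g x| <= G * sqrtV V x) -> Sphi s -> Vprob V mu ->
  (forall f, dom f -> \int[mu]_x K s f x = \int[mu]_x f x) ->
  exists c : R, forall T,
    `|T%:R * \int[mu]_x g x - N (Hsum k g (fun=> s) T 0)| <= c.
Proof.
move=> gG Ss pmu inv.
have Ssg (n : nat) : Sphi ((fun=> s) n) by exact: Ss.
have dg : dom g.
  split=> //; exists G => x; rewrite (le_trans (gG x))// ler_wpM2l//.
    have := le_trans (normr_ge0 _) (gG 0); rewrite pmulr_lge0// sqrtr_gt0.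
    exact: lt_le_trans (V1 0).
  have s1 : 1 <= sqrtV V x.
    by rewrite /sqrtV -[leLHS]sqrtr1 ler_sqrt// (lt_le_trans _ (V1 x)).
  by rewrite -[leRHS](sqr_sqrtr (V0 x)) expr2 ler_peMr// (le_trans _ s1).
have dH T m : dom (Hsum k g (fun=> s) T m) by exact: (Hsum_dom D mg gG).
have muH T : forall m, \int[mu]_x (Hsum k g (fun=> s) T m x) = T%:R * \int[mu]_x g x.
  elim: T => [|T IH] m /=; first by rewrite mul0r; exact: Vint_cst pmu 0.
  rewrite (VintD mV V1 pmu)//; last exact: (kop_dom D).
  by rewrite inv// IH -natr1 mulrDl mul1r addrC.
pose U := usum_cst V nu theta lam b G.
exists (U * \int[mu]_x V x) => T.
have ew : 0 * T%:R * mixing_cst V nu theta lam b M <= 1 / 2.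
  by rewrite !mul0r divr_ge0.
have se n : `|(fun=> s) n.+1 - (fun=> s) n : R| <= 0 by rewrite subrr normr0.
have uU x := usum_short D mg gG Ssg (lexx 0) se ew 0 x (leqnn T).
have du : dom (usum k nu g (fun=> s) T 0) by exact: (usum_dom D mg gG).
have -> : T%:R * \int[mu]_x g x - N (Hsum k g (fun=> s) T 0) =
    \int[mu]_x (usum k nu g (fun=> s) T 0 x).
  rewrite /usum (VintB mV V1 pmu)//; last exact: Vdom_cst.
  by rewrite (Vint_cst pmu) muH.
apply: (le_trans (Vint_norm mV V1 pmu du)).
have U0 : 0 <= U by exact: (usum_cst_ge0 D gG).
rewrite -(VintZ mV V1 pmu)//; apply: (Vint_le mV V1 pmu).
- exact: Vdom_norm.
- exact: VdomZ.
move=> x; apply: (le_trans (uU x)); rewrite ler_wpM2l//.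
have s1 : 1 <= sqrtV V x.
  by rewrite /sqrtV -[leLHS]sqrtr1 ler_sqrt// (lt_le_trans _ (V1 x)).
by rewrite -[leRHS](sqr_sqrtr (V0 x)) expr2 ler_peMr// (le_trans _ s1).
Qed.

End annealed.

(** * From kernels to processes *)

Section constant_kernel.
Context d d' (X : measurableType d) (Y : measurableType d') (R : realType).
Variable mu : probability Y R.

Definition kconst (x : X) : {measure set Y -> \bar R} := mu.

Let measurable_kconst (U : set Y) : measurable U ->
  measurable_fun [set: X] (kconst ^~ U).
Proof. by move=> _; exact: measurable_cst. Qed.

HB.instance Definition _ :=
  isKernel.Build _ _ X Y R kconst measurable_kconst.

Let kconstT x : kconst x setT = 1%E. Proof. exact: probability_setT. Qed.

HB.instance Definition _ := Kernel_isProbability.Build _ _ X Y R kconst kconstT.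

End constant_kernel.

Section graph_kernel.
Context d0 d1 d2 (T0 : measurableType d0) (T1 : measurableType d1)
  (T2 : measurableType d2) (R : realType).
Variable K : R.-pker T1 ~> T2.

Definition graph_law x : set (T1 * T2) -> \bar R := pushforward (K x) (pair x).

Let graph_law0 x : graph_law x set0 = 0%E.
Proof. by rewrite /graph_law /pushforward preimage_set0 measure0. Qed.

Let graph_law_ge0 x U : (0 <= graph_law x U)%E.
Proof. exact: measure_ge0. Qed.

Let graph_law_sigma_additive x : semi_sigma_additive (graph_law x).
Proof.
move=> F mF tF mUF; rewrite /graph_law /pushforward preimage_bigcup.
have mpF n : measurable (pair x @^-1` F n).
  by rewrite -xsectionE; exact: measurable_xsection.
apply: measure_semi_sigma_additive => //; last exact: bigcup_measurable.
apply/trivIsetP => i j _ _ ij; rewrite -preimage_setI.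
by move/trivIsetP : tF => /(_ _ _ _ _ ij) ->//; rewrite preimage_set0.
Qed.

HB.instance Definition _ x := isMeasure.Build _ _ R
  (graph_law x) (graph_law0 x) (@graph_law_ge0 x) (@graph_law_sigma_additive x).

(** The law of [(x, y)] with [y] drawn from [K x]. Its argument is a pair because kernel composition
    passes on both the source and the intermediate point. *)
Definition kgraph (p : T0 * T1) : {measure set (T1 * T2) -> \bar R} :=
  graph_law p.2.

Lemma kgraphE p (U : set (T1 * T2)) : measurable U ->
  kgraph p U = K p.2 (xsection U p.2).
Proof. by rewrite xsectionE. Qed.

Let measurable_kgraph (U : set (T1 * T2)) : measurable U ->
  measurable_fun [set: T0 * T1] (kgraph ^~ U).
Proof.
move=> mU; rewrite (_ : (fun _ => _) = (fun x => K x (xsection U x)) \o snd).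
  apply: measurableT_comp => //.
  by apply: measurable_fun_xsection_finite_kernel; rewrite inE.
by apply/funext => p /=; rewrite kgraphE.
Qed.

HB.instance Definition _ :=
  isKernel.Build _ _ (T0 * T1)%type (T1 * T2)%type R kgraph measurable_kgraph.

Let kgraphT p : kgraph p setT = 1%E.
Proof. exact: (@prob_kernel _ _ _ _ _ K p.2). Qed.

HB.instance Definition _ :=
  Kernel_isProbability.Build _ _ (T0 * T1)%type (T1 * T2)%type R kgraph kgraphT.

End graph_kernel.

Section measures_on_products.
Local Open Scope ereal_scope.

Lemma rectangle_measure_unique d1 d2 (T1 : measurableType d1)
    (T2 : measurableType d2) (R : realType)
    (m1 m2 : {measure set (T1 * T2) -> \bar R}) :
  m1 setT < +oo ->
  (forall A B, measurable A -> measurable B ->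
     m1 (A `*` B) = m2 (A `*` B)) ->
  forall U, measurable U -> m1 U = m2 U.
Proof.
move=> fin mE U mU.
pose D : set (set (T1 * T2)) :=
  [set A `*` B | A in measurable & B in measurable].
have DI : setI_closed D.
  move=> /= _ _ [X1 mX1 [X2 mX2 <-]] [Y1 mY1 [Y2 mY2 <-]].
  rewrite -setXI; exists (X1 `&` Y1); first exact: measurableI.
  by exists (X2 `&` Y2) => //; exact: measurableI.
apply: (measure_unique D (fun=> setT)) => //.
- by rewrite measurable_prod_measurableType.
- by move=> n; exists setT => //; exists setT => //; rewrite setXTT.
- by rewrite bigcup_const.
- by move=> _ [A mA [B mB <-]]; exact: mE.
Qed.

(** The law of [(Z, Y)] and the composition of the law of [Z] with the graph kernel agree on
    rectangles, hence everywhere; the integral then unfolds along the composition. *)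
Lemma integral_disintegration d d1 d2 (Omega : measurableType d)
    (T1 : measurableType d1) (T2 : measurableType d2) (R : realType)
    (P : probability Omega R) (K : R.-pker T1 ~> T2)
    (Z : Omega -> T1) (Y : Omega -> T2) :
  measurable_fun [set: Omega] Z -> measurable_fun [set: Omega] Y ->
  (forall A B, measurable A -> measurable B ->
     P (Z @^-1` A `&` Y @^-1` B) = \int[P]_(w in Z @^-1` A) K (Z w) B) ->
  forall f : T1 * T2 -> \bar R, measurable_fun [set: T1 * T2] f ->
    (forall z, 0 <= f z) ->
    \int[P]_w f (Z w, Y w) = \int[P]_w \int[K (Z w)]_y f (Z w, y).
Proof.
move=> mZ mY ZYE f mf f0.
pose Z' : {mfun Omega >-> T1} := mfun_Sub (mem_set mZ : Z \in mfun).
have mZY : measurable_fun [set: Omega] (fun w => (Z w, Y w)).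
  exact: measurable_fun_pair.
pose ZY : {mfun Omega >-> (T1 * T2)%type} :=
  mfun_Sub (mem_set mZY : (fun w => (Z w, Y w)) \in mfun).
pose l := @kconst _ _ unit _ R (distribution P Z').
pose kg := @kgraph _ _ _ unit _ _ R K.
have kcE U : measurable U -> kcomp l kg tt U = distribution P ZY U.
  move=> mU; apply: (@rectangle_measure_unique _ _ _ _ _
      ((l \; kg) tt) (distribution P ZY)) => //.
    rewrite /= /kcomp; under eq_integral do rewrite prob_kernel.
    by rewrite integral_cst// mul1e prob_kernel ltry.
  move=> A B mA mB; rewrite /= /kcomp.
  have mAB : measurable (A `*` B) by exact: measurableX.
  transitivity (P (Z @^-1` A `&` Y @^-1` B)); last by [].
  rewrite ZYE//.
  transitivity (\int[P]_w ((fun x => kg (tt, x) (A `*` B)) \o Z') w).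
    apply: ge0_integral_distribution => //.
    exact: (measurableT_comp (measurable_kernel kg _ mAB)
      (pair1_measurable tt)).
  rewrite [RHS]integral_mkcond; apply: eq_integral => w _.
  transitivity (K (Z w) (xsection (A `*` B) (Z w))); first by rewrite xsectionE.
  rewrite patchE; case: ifPn => /= [/set_mem ZA|/negP ZA].
    by rewrite in_xsectionX ?inE.
  by rewrite notin_xsectionX ?measure0//; apply/negP => h; apply: ZA;
     rewrite inE; exact: set_mem h.
transitivity (\int[distribution P ZY]_z f z).
  by rewrite ge0_integral_distribution.
transitivity (\int[(l \; kg)%E tt]_z f z).
  by apply: eq_measure_integral => U mU _; exact: (esym (kcE U mU)).
rewrite integral_kcomp//.
transitivity (\int[P]_w ((fun x => \int[kg (tt, x)]_z f z) \o Z') w).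
  apply: ge0_integral_distribution; last by move=> x; exact: integral_ge0.
  apply: (measurable_fun_integral_kernel (l := fun x => kg (tt, x))) => //.
  move=> U mU.
  exact: (measurableT_comp (measurable_kernel kg _ mU) (pair1_measurable tt)).
apply: eq_integral => w _.
by rewrite -[RHS](ge0_integral_pushforward (pair1_measurable (Z w)) (K (Z w))
  measurableT mf).
Qed.

End measures_on_products.

(** * Expectations of bounded functions *)

Section bounded_expectation.
Context d (Omega : measurableType d) (R : realType)
  (P : {measure set Omega -> \bar R}) (P1 : P setT = 1%E).
Implicit Types (f h : Omega -> R).

Definition bmf f : Prop :=
  measurable_fun [set: Omega] f /\ exists c : R, forall w, `|f w| <= c.

Lemma bmf_cst a : bmf (fun=> a).
Proof. by split => //; exists `|a|. Qed.

Lemma bmfD f h : bmf f -> bmf h -> bmf (fun w => f w + h w).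
Proof.
move=> [mf [c fc]] [mh [e he]]; split; first exact: measurable_funD.
by exists (c + e) => w; rewrite (le_trans (ler_normD _ _))// lerD.
Qed.

Lemma bmfM f h : bmf f -> bmf h -> bmf (fun w => f w * h w).
Proof.
move=> [mf [c fc]] [mh [e he]]; split; first exact: measurable_funM.
by exists (c * e) => w; rewrite normrM ler_pM.
Qed.

Lemma bmfZ a f : bmf f -> bmf (fun w => a * f w).
Proof. by move=> bf; apply: bmfM => //; exact: bmf_cst. Qed.

Lemma bmfN f : bmf f -> bmf (fun w => - f w).
Proof.
by move=> [mf [c fc]]; split; [exact: measurableT_comp|exists c => w; rewrite normrN].
Qed.

Lemma bmf_sum (I : Type) (s : seq I) (f : I -> Omega -> R) :
  (forall i, bmf (f i)) -> bmf (fun w => \sum_(i <- s) f i w).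
Proof.
move=> bf; elim: s => [|i s IH].
  by under [X in bmf X]eq_fun do rewrite big_nil; exact: bmf_cst.
by under [X in bmf X]eq_fun do rewrite big_cons; exact: bmfD.
Qed.

Lemma bmf_cos f : measurable_fun [set: Omega] f -> bmf (fun w => cos (f w)).
Proof.
move=> mf; split; last by exists 1 => w; rewrite ler_norml cos_geN1 cos_le1.
apply: measurableT_comp mf; apply: continuous_measurable_fun.
exact: continuous_cos.
Qed.

Lemma bmf_sin f : measurable_fun [set: Omega] f -> bmf (fun w => sin (f w)).
Proof.
move=> mf; split; last by exists 1 => w; rewrite ler_norml sin_geN1 sin_le1.
apply: measurableT_comp mf; apply: continuous_measurable_fun.
exact: continuous_sin.
Qed.

Lemma bmf_integrable f : bmf f -> P.-integrable setT (EFin \o f).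
Proof.
move=> [mf [c fc]]; apply: (@le_integrable _ _ _ P setT _ _ (EFin \o cst c)) => //.
- exact/measurable_EFinP.
- by move=> w _ /=; rewrite lee_fin (le_trans (fc w))// ler_norm.
apply/integrableP; split; first exact/measurable_EFinP.
by rewrite /= integral_cst// P1 mule1 ltry.
Qed.

Lemma bexp_EFin f : bmf f ->
  (\int[P]_w (f w)%:E)%E = (\int[P]_w f w)%R%:E.
Proof.
move=> bf; rewrite /Rintegral fineK//.
exact: integrable_fin_num (bmf_integrable bf).
Qed.

Lemma bexpD f h : bmf f -> bmf h ->
  \int[P]_w (f w + h w) = \int[P]_w f w + \int[P]_w h w.
Proof.
by move=> bf bh; rewrite RintegralD//; exact: bmf_integrable.
Qed.

Lemma bexp_cst a : \int[P]_w a = a.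
Proof.
by rewrite /Rintegral integral_cst// P1 mule1.
Qed.

Lemma bexpZ a f : bmf f -> \int[P]_w (a * f w) = a * \int[P]_w f w.
Proof. by move=> bf; rewrite RintegralZl//; exact: bmf_integrable. Qed.

Lemma bexp_lin a b f h : bmf f -> bmf h ->
  \int[P]_w (a * f w + b * h w) = a * \int[P]_w f w + b * \int[P]_w h w.
Proof. by move=> bf bh; rewrite bexpD ?bexpZ//; exact: bmfZ. Qed.

Lemma bexpN f : bmf f -> \int[P]_w (- f w) = - \int[P]_w f w.
Proof.
move=> bf; rewrite -mulN1r -bexpZ//; congr Rintegral.
by apply/funext => w; rewrite mulN1r.
Qed.

Lemma bexp_le f h : bmf f -> bmf h -> (forall w, f w <= h w) ->
  \int[P]_w f w <= \int[P]_w h w.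
Proof.
move=> bf bh fh; apply: le_Rintegral => //; exact: bmf_integrable.
Qed.

Lemma bexp_sum (I : Type) (s : seq I) (f : I -> Omega -> R) :
  (forall i, bmf (f i)) ->
  \int[P]_w (\sum_(i <- s) f i w) = \sum_(i <- s) \int[P]_w f i w.
Proof.
move=> bf; elim: s => [|i s IH].
  by under eq_Rintegral do rewrite big_nil; rewrite bexp_cst big_nil.
under eq_Rintegral do rewrite big_cons.
by rewrite bexpD// ?big_cons ?IH//; exact: bmf_sum.
Qed.

End bounded_expectation.

Section bounded_disintegration.
Context d d1 d2 (Omega : measurableType d) (T1 : measurableType d1)
  (T2 : measurableType d2) (R : realType) (P : probability Omega R)
  (K : R.-pker T1 ~> T2) (Z : Omega -> T1) (Y : Omega -> T2).
Hypothesis mZ : measurable_fun [set: Omega] Z.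
Hypothesis mY : measurable_fun [set: Omega] Y.
Hypothesis ZYE : forall A B, measurable A -> measurable B ->
  P (Z @^-1` A `&` Y @^-1` B) = (\int[P]_(w in Z @^-1` A) K (Z w) B)%E.

Lemma bounded_disintegration (f : T1 * T2 -> R) : bmf f ->
  \int[P]_w f (Z w, Y w) = \int[P]_w \int[K (Z w)]_y f (Z w, y).
Proof.
move=> [mf [c fc]].
have mfp x : measurable_fun [set: T2] (fun y => f (x, y)).
  by apply: measurableT_comp mf _; exact: pair1_measurable.
have bf x : bmf (fun y => f (x, y)) by split => //; exists c => y; exact: fc.
have bfZY : bmf (fun w => f (Z w, Y w)).
  split; last by exists c.
  by apply: measurableT_comp mf _; exact: measurable_fun_pair.
have fc0 z : 0 <= f z + c 
  by have /ler_normlP[h _] := fc z; rewrite -lerBlDr sub0r lerNl.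
have K1 x : K x setT = 1%E by exact: prob_kernel.
have Kint x : (\int[K x]_y (f (x, y) + c)%:E)%E =
    (\int[K x]_y f (x, y) + c)%:E.
  rewrite (bexp_EFin (K1 x)) ?(bexpD (K1 x)) ?(bexp_cst (K1 x))//;
    by [exact: bmf_cst|apply: bmfD => //; exact: bmf_cst].
have mfc : measurable_fun [set: T1 * T2] (fun z => (f z + c)%:E).
  by apply/measurable_EFinP; exact: measurable_funD.
have mKf : measurable_fun [set: T1] (fun x => \int[K x]_y f (x, y)).
  rewrite (_ : (fun _ => _) =
    (fun x => fine (\int[K x]_y (f (x, y) + c)%:E)%E - c)); last first.
    by apply/funext => x; rewrite Kint /= addrK.
  apply: measurable_funB => //; apply: measurableT_comp => //.
  apply: (measurable_fun_integral_finite_kernel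
     (fun z : T1 * T2 => (f z + c)%:E) K) => //.
have bKf : bmf (fun w => \int[K (Z w)]_y f (Z w, y)).
  split; first exact: (measurableT_comp mKf mZ).
  exists c => w; apply/ler_normlP; split.
    rewrite -(bexpN (K1 _))// -[leRHS](bexp_cst (K1 (Z w)) c).
    apply: (bexp_le (K1 _)) => //; [exact: bmfN|exact: bmf_cst|].
    by move=> y; have /ler_normlP[] := fc (Z w, y).
  rewrite -[leRHS](bexp_cst (K1 (Z w)) c).
  apply: (bexp_le (K1 _)) => //; first exact: bmf_cst.
  by move=> y; have /ler_normlP[] := fc (Z w, y).
have P1 : P setT = 1%E by exact: probability_setT.
have shift h : bmf h ->
    (\int[P]_w (h w + c)%:E)%E = (\int[P]_w h w + c)%:E.
  move=> bh; rewrite (bexp_EFin P1) ?(bexpD P1) ?(bexp_cst P1)//;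
    by [exact: bmf_cst|apply: bmfD => //; exact: bmf_cst].
have := integral_disintegration mZ mY ZYE mfc fc0.
under [X in _ = X -> _]eq_integral do rewrite Kint.
by rewrite (shift _ bfZY) (shift _ bKf) => -[] h;
   move: (congr1 (fun x : R => x - c) h); rewrite !addrK.
Qed.

End bounded_disintegration.

(** * Path sums of a Markov chain and the path operators *)

Section markov_path.
Context {R : realType}.
Local Notation RR := (measurableTypeR R).
Context (d : measure_display) (Omega : measurableType d).
Variable P : probability Omega R.
Context (g : R -> R) (mg : measurable_fun [set: RR] (g : RR -> RR)).
Context (Y : nat -> Omega -> RR).
Hypothesis mY : forall n, measurable_fun [set: Omega] (Y n).

Definition path_sum (n : nat) (w : Omega) : R := \sum_(i < n) g (Y i w).

Let gens n : set (set Omega) :=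
  [set F | exists m (A : set RR),
     [/\ (m <= n)%N, measurable A & F = Y m @^-1` A]].

Lemma history_measurable i n : (i <= n)%N ->
  measurable_fun [set: g_sigma_algebraType (gens n)] (Y i : _ -> RR).
Proof.
move=> ilen _ B mB; rewrite setTI; apply: sub_sigma_algebra.
by exists i, B.
Qed.

(** [path_sum m] reads the positions of index below [m], hence the bound [n.+1]. *)
Lemma history_path_sum m n (A : set (RR * RR)) : (m <= n.+1)%N ->
  measurable A -> history (fun m => Y m : Omega -> R) n
    ((fun w => (path_sum m w : RR, Y n w)) @^-1` A).
Proof.
move=> mn mA.
have mS : measurable_fun [set: g_sigma_algebraType (gens n)]
    (path_sum m : _ -> RR).
  rewrite /path_sum; apply: measurable_sum => i.
  apply: measurableT_comp => //; apply: history_measurable.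
  by rewrite -ltnS (leq_trans _ mn).
have := measurable_fun_pair mS (history_measurable (leqnn n)) measurableT mA.
by rewrite setTI.
Qed.

Context (S : set R) (k : R -> R.-pker RR ~> RR) (V : R -> R)
  (C : set RR) (nu : probability RR R) (theta lam b M : R)
  (D : drift_minor S k V C nu theta lam b M).
Context (sg : nat -> R) (Ssg : forall n, S (sg n)).
Context (mu : {measure set RR -> \bar R}) (K : nat -> R.-pker RR ~> RR).
Context (p : nat) (YMC : markov_chain P mu K p (fun m => Y m : Omega -> R)).
Hypothesis Ksg : forall n, (0 < n <= p)%N -> K n = k (sg n).

Lemma path_sum_measurable n : measurable_fun [set: Omega] (path_sum n : _ -> RR).
Proof.
rewrite /path_sum; apply: measurable_sum => i.
by apply: measurableT_comp => //; exact: mY.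
Qed.

Lemma path_expectation_step m T F : (T + m = p)%N -> bjm F ->
  \int[P]_w F (path_sum p w) (Y p w) =
  \int[P]_w Eop k g sg T m F (path_sum m w) (Y m w).
Proof.
move=> + bF; elim: T m => [|T IH] m; first by rewrite add0n => ->.
rewrite addSnnS => Tm; rewrite (IH _ Tm) /=.
have bE := @Eop_bjm _ _ _ _ _ _ _ _ _ _ D g mg _ Ssg T m.+1 F bF.
(* The sum including position [m] is known at time [m], so conditioning on the history integrates
   out [Y m.+1] alone, with [Z] as the parameter. *)
pose Z w : RR * RR := (path_sum m.+1 w : RR, Y m w).
have mZ : measurable_fun [set: Omega] Z.
  by apply: measurable_fun_pair => //; exact: path_sum_measurable.
pose f (z : (RR * RR) * RR) : R := Eop k g sg T m.+1 F z.1.1 z.2.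
have mp : (m < p)%N by rewrite -Tm leq_addl.
have := @bounded_disintegration _ _ _ _ _ _ _ P
  (@ksnd _ _ _ RR RR RR R (k (sg m.+1))) Z (Y m.+1) mZ (mY m.+1) _ f _.
rewrite /f /Z /= => ->; last 2 first.
- move=> A B mA mB; rewrite /ksnd /= -Ksg//.
  by apply: YMC.2 => //; exact: history_path_sum.
- split; last by have [_ [c Fc]] := bE; exists c => z; exact: Fc.
  have [mE _] := bE.
  have mq : measurable_fun [set: (RR * RR) * RR]
      (fun z : (RR * RR) * RR => (z.1.1, z.2)).
    by apply: measurable_fun_pair => //; exact: measurableT_comp.
  exact: (measurableT_comp mE mq).
apply: eq_Rintegral => w _; rewrite /kop /path_sum big_ord_recr.
by [].
Qed.

Lemma path_expectation F : Vprob V mu -> bjm F ->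
  \int[P]_w F (path_sum p w) (Y p w) = \int[mu]_x Eop k g sg p 0 F 0 x.
Proof.
move=> pmu bF; rewrite (@path_expectation_step 0 p)// ?addn0//.
have bE := @Eop_bjm _ _ _ _ _ _ _ _ _ _ D g mg _ Ssg p 0 F bF.
pose h x := Eop k g sg p 0 F 0 x.
have mh : measurable_fun [set: RR] (h : RR -> RR) by exact: (bjm_section 0 bE).
pose Y0 : {mfun Omega >-> RR} := mfun_Sub (mem_set (mY 0) : Y 0%N \in mfun).
have h_int : mu.-integrable setT (EFin \o h).
  by have [_ [c hc]] := bE; apply: (@bmf_integrable _ _ _ mu pmu.1); split => //;
    exists c => x; exact: hc.
have disE U : measurable U -> distribution P Y0 U = mu U.
  by move=> mU; exact: YMC.1.
rewrite /Rintegral; congr fine; transitivity (\int[distribution P Y0]_x (h x)%:E)%E.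
  rewrite integral_distribution//; last first.
    have P1 : P setT = 1%E by exact: probability_setT.
    apply: (bmf_integrable P1); split; first exact: measurableT_comp.
    by have [_ [c hc]] := bE; exists c => w; exact: hc.
    exact/measurable_EFinP.
  by apply: eq_integral => w _ /=; rewrite /path_sum big_ord0.
by apply: eq_measure_integral => U mU _; rewrite -disE.
Qed.

End markov_path.

(** * Independence *)

Section independent_pairs.
Context {R : realType}.
Local Notation RR := (measurableTypeR R).
Context (d : measure_display) (Omega : measurableType d).
Variable P : probability Omega R.
Implicit Types (X Y : Omega -> RR).

Definition indep_pair X Y : Prop := forall A B : set RR,
  measurable A -> measurable B ->
  P (X @^-1` A `&` Y @^-1` B) = (P (X @^-1` A) * P (Y @^-1` B))%E.

Lemma indep_pair_disintegrates X Y (mX : measurable_fun [set: Omega] X)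
    (mY : measurable_fun [set: Omega] Y) : indep_pair X Y ->
  forall A B : set RR, measurable A -> measurable B ->
  P (X @^-1` A `&` Y @^-1` B) = (\int[P]_(w in X @^-1` A)
    kconst (distribution P (mfun_Sub (mem_set mY : Y \in mfun))) (X w) B)%E.
Proof.
move=> ind A B mA mB; rewrite ind// /kconst.
rewrite integral_cst; last by rewrite -[X in measurable X]setTI; exact: mX.
by rewrite muleC.
Qed.

Lemma indep_pair_bexp X Y (mX : measurable_fun [set: Omega] X)
    (mY : measurable_fun [set: Omega] Y) : indep_pair X Y ->
  forall f : R -> R -> R, bjm f ->
  \int[P]_w f (X w) (Y w) = \int[P]_w \int[P]_v f (X w) (Y v).
Proof.
move=> ind f [mf [c fc]].
have := bounded_disintegration mX mY (indep_pair_disintegrates mX mY ind)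
  (f := fun z => f z.1 z.2).
move=> ->; last by split => //; exists c => z; exact: fc.
apply: eq_Rintegral => w _; rewrite /Rintegral; congr fine.
have mfw : measurable_fun [set: RR] (f (X w) : RR -> RR).
  by apply: (@bjm_section R); split => //; exists c.
rewrite integral_distribution//=; first exact/measurable_EFinP.
apply: (bmf_integrable (probability_setT P)); split; last by exists c.
exact: measurableT_comp mfw mY.
Qed.

(* The squared modulus of the characteristic function of [X] at 1. *)
Definition char_sqr X : R :=
  (\int[P]_w cos (X w)) ^+ 2 + (\int[P]_w sin (X w)) ^+ 2.

Lemma char_sqr_ge0 X : 0 <= char_sqr X.
Proof. by rewrite addr_ge0// sqr_ge0. Qed.

Lemma char_sqrN X : measurable_fun [set: Omega] X ->
  char_sqr (fun w => - X w) = char_sqr X.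
Proof.
move=> mX; rewrite /char_sqr; under eq_Rintegral do rewrite cosN.
congr (_ + _).
under eq_Rintegral do rewrite sinN.
by rewrite (bexpN (probability_setT P)) ?sqrrN//; exact: bmf_sin.
Qed.

(** Multiplicativity of characteristic functions in real form: the addition formulas, then the
    two-square identity. *)
Lemma char_sqrD X Y (mX : measurable_fun [set: Omega] X)
    (mY : measurable_fun [set: Omega] Y) : indep_pair X Y ->
  char_sqr (fun w => X w + Y w) = char_sqr X * char_sqr Y.
Proof.
move=> ind; have P1 : P setT = 1%E by exact: probability_setT.
have m1 : measurable_fun [set: RR * RR] (fun p : RR * RR => p.1 + p.2 : RR).
  exact: measurable_funD.
have bcos : bjm (fun x y : R => cos (x + y)).
  split; first exact: (bmf_cos m1).1.
  by exists 1 => x y; rewrite ler_norml cos_geN1 cos_le1.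
have bsin : bjm (fun x y : R => sin (x + y)).
  split; first exact: (bmf_sin m1).1.
  by exists 1 => x y; rewrite ler_norml sin_geN1 sin_le1.
have bcX := bmf_cos mX; have bsX := bmf_sin mX.
have bcY := bmf_cos mY; have bsY := bmf_sin mY.
rewrite /char_sqr (indep_pair_bexp mX mY ind bcos).
rewrite (indep_pair_bexp mX mY ind bsin).
set cY := \int[P]_w cos (Y w); set sY := \int[P]_w sin (Y w).
set cX := \int[P]_w cos (X w); set sX := \int[P]_w sin (X w).
have -> : \int[P]_w \int[P]_v cos (X w + Y v) = cX * cY - sX * sY.
  transitivity (\int[P]_w (cY * cos (X w) + - sY * sin (X w))); last first.
    by rewrite (bexp_lin P1)// mulNr mulrC (mulrC sY).
  apply: eq_Rintegral => w _.
  transitivity (\int[P]_v (cos (X w) * cos (Y v) + - sin (X w) * sin (Y v))).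
    by apply: eq_Rintegral => v _; rewrite cosD mulNr.
  by rewrite (bexp_lin P1)// mulNr mulNr mulrC (mulrC sY).
have -> : \int[P]_w \int[P]_v sin (X w + Y v) = sX * cY + cX * sY.
  transitivity (\int[P]_w (cY * sin (X w) + sY * cos (X w))); last first.
    by rewrite (bexp_lin P1)// mulrC (mulrC sY).
  apply: eq_Rintegral => w _.
  transitivity (\int[P]_v (sin (X w) * cos (Y v) + cos (X w) * sin (Y v))).
    by apply: eq_Rintegral => v _; rewrite sinD.
  by rewrite (bexp_lin P1)// mulrC (mulrC sY).
have aux (a b e f : R) : (a * b - e * f) ^+ 2 + (e * b + a * f) ^+ 2 =
  (a ^+ 2 + e ^+ 2) * (b ^+ 2 + f ^+ 2) by ring.
exact: aux.
Qed.

Lemma integral_sqr_shift Y (x : R) : P.-integrable setT (EFin \o Y) ->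
  P.-integrable setT (fun w => (Y w ^+ 2)%:E) -> (\int[P]_w (Y w)%:E = 0)%E ->
  (\int[P]_w ((x + Y w) ^+ 2)%:E = (x ^+ 2)%:E + \int[P]_w (Y w ^+ 2)%:E)%E.
Proof.
move=> iY iY2 Y0; have P1 : P setT = 1%E by exact: probability_setT.
rewrite (_ : (fun w => _) =
  (fun w => (x ^+ 2)%:E + (2 * x)%:E * (Y w)%:E + (Y w ^+ 2)%:E))%E; last first.
  by apply/funext => w /=; rewrite -EFinM -!EFinD; congr EFin; ring.
have i1 : P.-integrable setT (fun w => ((2 * x)%:E * (Y w)%:E)%E).
  exact: integrableZl.
have i0 : P.-integrable setT (cst (x ^+ 2)%:E).
  by apply: (bmf_integrable P1 (f := cst (x ^+ 2))); exact: bmf_cst.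
rewrite integralD//=; last exact: integrableD.
rewrite integralD//= integralZl//= Y0 mule0 adde0.
by rewrite integral_cst// [X in (_ * X)%E]P1 mule1.
Qed.

(** The integral over [Y] is taken first, at fixed [X], where centring removes the cross term;
    nothing but measurability is asked of [X]. *)
Lemma indep_pair_sqr X Y (mX : measurable_fun [set: Omega] X)
    (mY : measurable_fun [set: Omega] Y) : indep_pair X Y ->
  P.-integrable setT (EFin \o Y) -> P.-integrable setT (fun w => (Y w ^+ 2)%:E) ->
  (\int[P]_w (Y w)%:E = 0)%E ->
  (\int[P]_w ((X w + Y w) ^+ 2)%:E =
   \int[P]_w (X w ^+ 2)%:E + \int[P]_w (Y w ^+ 2)%:E)%E.
Proof.
move=> ind iY iY2 Y0; have P1 : P setT = 1%E by exact: probability_setT.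
have m1 : measurable_fun [set: RR * RR] (fun p : RR * RR => (p.1 + p.2) ^+ 2 : RR).
  by apply: measurable_funX; exact: measurable_funD.
pose f (z : RR * RR) : \bar R := ((z.1 + z.2) ^+ 2)%:E.
have mf : measurable_fun [set: RR * RR] f by exact/measurable_EFinP.
have f0 z : (0 <= f z)%E by rewrite lee_fin sqr_ge0.
have := integral_disintegration mX mY (indep_pair_disintegrates mX mY ind) mf f0.
rewrite /f /= => ->.
have inner x : (\int[distribution P (mfun_Sub (mem_set mY : Y \in mfun))]_y
    ((x + y) ^+ 2)%:E = (x ^+ 2)%:E + \int[P]_w (Y w ^+ 2)%:E)%E.
  rewrite ge0_integral_distribution//=; last 2 first.
  - apply/measurable_EFinP; apply: measurable_funX.
    by apply: measurable_funD.
  - by move=> y; rewrite lee_fin sqr_ge0.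
  exact: integral_sqr_shift.
under eq_integral do rewrite /kconst inner.
rewrite ge0_integralD//=.
- by rewrite integral_cst// [X in (_ * X)%E]P1 mule1.
- by move=> w _; rewrite lee_fin sqr_ge0.
- by apply/measurable_EFinP; apply: measurable_funX.
- by move=> w _; apply: integral_ge0 => v _; rewrite lee_fin sqr_ge0.
Qed.

End independent_pairs.

Section independent_families.
Context {R : realType}.
Local Notation RR := (measurableTypeR R).
Context (d : measure_display) (Omega : measurableType d).
Variable P : probability Omega R.
Context (I : finType) (p : nat) (Y : I -> nat -> Omega -> RR).
Hypothesis mY : forall i n, measurable_fun [set: Omega] (Y i n).
Hypothesis indY : independent_chains P p (fun i => Y i : nat -> Omega -> R).
Implicit Types (Z : I -> Omega -> RR) (s : seq I).

Local Notation hist i := (history (fun n => Y i n : Omega -> R) p).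

Lemma history_is_measurable i F : hist i F -> measurable F.
Proof.
apply: (smallest_sub (@sigma_algebra_measurable _ Omega)) => _ [m [A [_ mA ->]]].
by rewrite -[X in measurable X]setTI; exact: mY.
Qed.

Lemma historyT i : hist i setT.
Proof. exact: (@measurableT _ (g_sigma_algebraType _)). Qed.

Lemma historyI i A B : hist i A -> hist i B -> hist i (A `&` B).
Proof. exact: (@measurableI _ (g_sigma_algebraType _)). Qed.

(** Stable under intersection and generating the joint history of the chains with index in [s]. *)
Definition group_events s : set (set Omega) :=
  [set A | exists F : I -> set Omega, [/\ forall i, hist i (F i),
     forall i, i \notin s -> F i = setT & A = \bigcap_(i in [set: I]) F i]].

Lemma group_events_measurable s : group_events s `<=` measurable.
Proof.
move=> _ [F [hF _ ->]]; apply: fin_bigcap_measurable => // i _.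
exact: history_is_measurable (hF i).
Qed.

(** At fixed [B] both sides are finite measures in [A]. They agree on [group_events s] by
    independence of the chains, hence on the generated sigma-algebra. *)
Lemma group_events_indep s j A B : j \notin s ->
  <<s group_events s >> A -> hist j B -> P (A `&` B) = (P A * P B)%E.
Proof.
move=> js sA hB; have mB := history_is_measurable hB.
have PB : P B \is a fin_num by rewrite fin_num_measure.
pose r : {nonneg R} := NngNum (fine_ge0 (measure_ge0 P B)).
have mscaleE F : mscale r P F = (P F * P B)%E.
  by rewrite /mscale /r /= fineK// muleC.
have -> : P (A `&` B) = mrestr P mB A by [].
rewrite -mscaleE; apply: (@g_sigma_algebra_measure_unique _ R Omega
  (group_events s) (@group_events_measurable s) (fun=> setT)) sA => //.
- move=> _; exists (fun=> setT); split => // [i|]; first exact: historyT.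
  by rewrite bigcapT.
- by rewrite bigcup_const.
- move=> _ _ [F1 [h1 T1 ->]] [F2 [h2 T2 ->]].
  exists (fun i => F1 i `&` F2 i); split => [i|i si|].
  + exact: historyI.
  + by rewrite T1// T2// setIT.
  + by rewrite bigcapI.
- move=> _ [F [hF FT ->]].
  pose F' i := if i == j then B else F i.
  have hF' i : hist i (F' i) by rewrite /F'; case: eqP => [->|].
  have capE : \bigcap_(i in [set: I]) F i `&` B = \bigcap_(i in [set: I]) F' i.
    apply/seteqP; split => w /=.
      by move=> [Fw Bw] i _; rewrite /F'; case: ifP => // _; exact: Fw.
    move=> F'w; split; last by have := F'w j Logic.I; rewrite /F' eqxx.
    move=> i _; have := F'w i Logic.I; rewrite /F'; case: eqP => // -> _.
    by rewrite FT.
  transitivity (P (\bigcap_(i in [set: I]) F i) * P B)%E; last first.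
    by move: (esym (mscaleE (\bigcap_(i in [set: I]) F i))).
  transitivity (P (\bigcap_(i in [set: I]) F i `&` B)); first by [].
  rewrite capE (indY hF') (indY hF) (bigD1 j)//= [in RHS](bigD1 j)//=.
  rewrite (FT _ js) probability_setT mul1e /F' eqxx muleC; congr (_ * _)%E.
  by apply: eq_bigr => i /negbTE ->.
- move=> _; have h : (mrestr P mB setT < +oo)%E; last exact: h.
  by rewrite /mrestr setTI (le_lt_trans (probability_le1 P mB))// ltry.
Qed.

Definition adapted Z : Prop :=
  forall i (A : set RR), measurable A -> hist i (Z i @^-1` A).

Lemma adapted_measurable Z i : adapted Z -> measurable_fun [set: Omega] (Z i).
Proof.
by move=> aZ _ A mA; rewrite setTI; exact: history_is_measurable (aZ i A mA).
Qed.

Lemma adapted_sum_indep Z s j : adapted Z -> j \notin s ->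
  indep_pair P (fun w => \sum_(i <- s) Z i w) (Z j).
Proof.
move=> aZ js A B mA mB; apply: (group_events_indep js); last exact: aZ.
have mZ i : i \in s ->
    measurable_fun [set: g_sigma_algebraType (group_events s)] (Z i : _ -> RR).
  move=> si _ U mU; rewrite setTI; apply: sub_sigma_algebra.
  exists (fun i' => if i' == i then Z i @^-1` U else setT); split => [i'|i'|].
  - by case: eqP => [->|_]; [exact: aZ|exact: historyT].
  - by case: eqP => // ->; rewrite si.
  - apply/seteqP; split => w /=; first by move=> Zw i' _; case: ifP.
    by move=> /(_ i Logic.I); rewrite eqxx.
have mS s' : {subset s' <= s} -> measurable_fun
    [set: g_sigma_algebraType (group_events s)]
    ((fun w => \sum_(i <- s') Z i w) : _ -> RR).
  elim: s' => [|i s' IH] ss'.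
    by under eq_fun do rewrite big_nil; exact: measurable_cst.
  under eq_fun do rewrite big_cons; apply: measurable_funD.
    by apply: mZ; apply: ss'; rewrite mem_head.
  by apply: IH => i' i's; apply: ss'; rewrite inE i's orbT.
by have := mS s (fun _ => id) measurableT A mA; rewrite setTI.
Qed.

Lemma adapted_sum_measurable Z s : adapted Z ->
  measurable_fun [set: Omega] ((fun w => \sum_(i <- s) Z i w) : _ -> RR).
Proof.
move=> aZ; elim: s => [|i s IH].
  by under eq_fun do rewrite big_nil; exact: measurable_cst.
under eq_fun do rewrite big_cons; apply: measurable_funD => //.
exact: adapted_measurable.
Qed.

Lemma char_sqr_sum Z s : adapted Z -> uniq s ->
  char_sqr P (fun w => \sum_(i <- s) Z i w) = \prod_(i <- s) char_sqr P (Z i).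
Proof.
move=> aZ; have P1 : P setT = 1%E by exact: probability_setT.
elim: s => [|i s IH] /=.
  rewrite /char_sqr !big_nil => _.
  under eq_Rintegral do rewrite big_nil cos0.
  under [X in _ + X ^+ 2]eq_Rintegral do rewrite big_nil sin0.
  by rewrite !(bexp_cst P1) expr1n expr0n addr0.
move=> /andP[si us]; rewrite big_cons -(IH us) mulrC.
rewrite -(char_sqrD (adapted_sum_measurable s aZ) (adapted_measurable i aZ)).
  congr char_sqr; apply/funext => w; by rewrite big_cons addrC.
exact: adapted_sum_indep.
Qed.

Lemma sqr_sum Z s : adapted Z -> uniq s ->
  (forall i, P.-integrable setT (EFin \o Z i)) ->
  (forall i, P.-integrable setT (fun w => (Z i w ^+ 2)%:E)) ->
  (forall i, \int[P]_w (Z i w)%:E = 0)%E ->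
  (\int[P]_w ((\sum_(i <- s) Z i w) ^+ 2)%:E =
   \sum_(i <- s) \int[P]_w (Z i w ^+ 2)%:E)%E.
Proof.
move=> aZ us iZ iZ2 Z0; elim: s us => [_|i s IH /= /andP[si us]].
  rewrite big_nil; under eq_integral do rewrite big_nil expr0n.
  by rewrite integral0.
rewrite big_cons -(IH us) addeC.
rewrite -(indep_pair_sqr (adapted_sum_measurable s aZ) (adapted_measurable i aZ))//.
  by apply: eq_integral => w _; rewrite big_cons addrC.
exact: adapted_sum_indep.
Qed.

End independent_families.

(** The maximum of the left side over [al] is the Euclidean norm of [(x, y)]: a bound on the real
    part at every phase bounds the modulus. *)
Lemma sqr_le_of_phases (R : realType) (x y q : R) :
  (forall al, x * cos al - y * sin al <= q) -> 0 <= q /\ x ^+ 2 + y ^+ 2 <= q ^+ 2.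
Proof.
move=> h; pose r := Num.sqrt (x ^+ 2 + y ^+ 2).
have s0 : 0 <= x ^+ 2 + y ^+ 2 by rewrite addr_ge0// sqr_ge0.
have r2 : r ^+ 2 = x ^+ 2 + y ^+ 2 by rewrite sqr_sqrtr.
have [r0|rneq] := eqVneq r 0.
  move: r2; rewrite r0 expr0n /= => /esym/eqP.
  rewrite paddr_eq0 ?sqr_ge0// !sqrf_eq0 => /andP[/eqP x0 /eqP y0].
  have q0 : 0 <= q by have := h 0; rewrite x0 y0 !mul0r subr0.
  by split => //; rewrite x0 y0 expr0n/= addr0 sqr_ge0.
have rgt0 : 0 < r by rewrite lt_neqAle eq_sym rneq sqrtr_ge0.
have xr2 : (x / r) ^+ 2 + (y / r) ^+ 2 = 1.
  by rewrite !expr_div_n -mulrDl -r2 divff// sqrf_eq0.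
have xr1 : -1 <= x / r <= 1.
  rewrite -ler_norml -(@ler_pXn2r _ 2)// ?nnegrE// expr1n real_normK ?num_real//.
  by rewrite -xr2 lerDl sqr_ge0.
have sac : sin (acos (x / r)) = `|y / r|.
  by rewrite sin_acos// -xr2 addrAC subrr add0r sqrtr_sqr.
have xyr : x * (x / r) + y * (y / r) = r.
  rewrite !mulrA -mulrDl -!expr2 -r2 expr2 mulfK//.
suff rq : r <= q.
  have q0 : 0 <= q by exact: le_trans (ltW rgt0) rq.
  by split => //; rewrite -r2 ler_pXn2r// nnegrE// ltW.
(* The sine of an [acos] is nonnegative, so the sign of [y] decides between this angle and its
   opposite. *)
have [y0|y0] := leP y 0.
  have := h (acos (x / r)); rewrite acosK// sac.
  have yr0 : y / r <= 0 by rewrite ler_pdivrMr// mul0r.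
  by rewrite ler0_norm// mulrN opprK xyr.
have := h (- acos (x / r)); rewrite cosN sinN acosK// sac.
rewrite gtr0_norm; last by rewrite divr_gt0.
by rewrite mulrN opprK xyr.
Qed.

(** Monotone convergence, carrying bounds proved for bounded test functions over to second
    moments. *)
Lemma integral_le_truncations d (T : measurableType d) (R : realType)
    (m : {measure set T -> \bar R}) (h : T -> R) (c : \bar R) :
  measurable_fun [set: T] h -> (forall x, 0 <= h x) ->
  (forall n, \int[m]_x (Num.min (h x) n%:R)%:E <= c)%E ->
  (\int[m]_x (h x)%:E <= c)%E.
Proof.
move=> mh h0 hc; pose f n x : \bar R := (Num.min (h x) n%:R)%:E.
have -> : (\int[m]_x (h x)%:E = \int[m]_x limn (f ^~ x))%E.
  apply: eq_integral => x _; apply/esym/lim_near_cst => //.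
  exists (Num.truncn (h x)).+1 => // n /= hn; congr EFin; apply/min_idPl.
  by rewrite ltW// (lt_le_trans (truncnS_gt _))// ler_nat.
have cv : (\int[m]_x f n x @[n --> \oo] --> \int[m]_x limn (f ^~ x))%E.
  apply: cvg_monotone_convergence => //.
  - by move=> i; apply/measurable_EFinP; exact: measurable_minr.
  - by move=> i y _; rewrite lee_fin le_min h0 ler0n.
  - move=> y _ i j ij; rewrite lee_fin le_min ge_min lexx /=.
    by rewrite ge_min ler_nat ij orbT.
rewrite -(cvg_lim (@ereal_hausdorff R) cv); apply: lime_le; first exact: cvgP cv.
by apply: nearW => n; exact: hc.
Qed.

(** * Second moment and characteristic function of one annealed chain *)

Section annealed_chains.
Context {R : realType}.
Local Notation RR := (measurableTypeR R).
Context (phi0 : R) (phi01 : 0 < phi0 < 1).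
Context (k : R -> R.-pker RR ~> RR) (V : R -> R)
  (C : set RR) (nu : probability RR R) (theta lam b M : R)
  (D : drift_minor (Sphi phi0) k V C nu theta lam b M).
Context (g : R -> R) (mg : measurable_fun [set: RR] (g : RR -> RR)).
Context (mu : {measure set RR -> \bar R}) (pmu : Vprob V mu).

Let mV := dm_mV D.
Let V1 := dm_V1 D.

Definition annealed_chain (d : measure_display) (Omega : measurableType d)
    (P : probability Omega R) (p : nat) (Y : nat -> Omega -> RR) : Prop :=
  (forall n, measurable_fun [set: Omega] (Y n)) /\
  markov_chain P mu (fun n => k (annealing phi0 p n)) p
    (Y : nat -> Omega -> R).

Lemma annealed_chain_expectation (d : measure_display)
    (Omega : measurableType d) (P : probability Omega R) p Y F (h : R -> R) :
  (0 < p)%N -> annealed_chain P p Y -> bjm F -> Vdom V h ->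
  (forall x, Eop k g (anneal_clip phi0 p) p 0 F 0 x <= h x) ->
  \int[P]_w F (path_sum g Y p w) (Y p w) <= \int[mu]_x h x.
Proof.
move=> p0 [mY YMC] bF dh Fh.
have Ssg n : Sphi phi0 (anneal_clip phi0 p n) by exact: anneal_clip_in.
rewrite (path_expectation mg mY D Ssg YMC _ pmu bF); last first.
  by move=> n np; rewrite anneal_clipE.
by apply: (Vint_le mV V1 pmu) => //; exact: (Eop_dom D mg Ssg).
Qed.

(** The centre [a] is chosen before the chain, so it serves all particles and coordinates. *)
Lemma chain_second_moment (G : R) : (forall x, `|g x| <= G * sqrtV V x) ->
  exists2 B : R, 0 <= B & exists p0, forall p, (p0 <= p)%N ->
  exists a : R, forall (d : measure_display) (Omega : measurableType d)
    (P : probability Omega R) (Y : nat -> Omega -> RR), annealed_chain P p Y ->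
  (\int[P]_w ((path_sum g Y p w - a) ^+ 2)%:E <= (B * p%:R)%:E)%E.
Proof.
move=> gG; have [B B0 [p0 H]] := annealed_quadratic phi01 D mg gG.
set m := \int[mu]_x V x.
have m0 : 0 <= m by apply: Rintegral_ge0 => x _; exact: le_trans (V1 x).
exists (B * (m + 2)); first by rewrite mulr_ge0// addr_ge0.
exists (maxn 1 p0) => p; rewrite geq_max => /andP[p1 pp0].
have [a Ha] := H p pp0; exists a => d Omega P Y YC.
have [mY _] := YC.
have mS := @path_sum_measurable R d Omega g mg Y mY p.
pose f n (z : R) : R := Num.min ((z - a) ^+ 2) n%:R.
have msq : measurable_fun [set: RR] (fun z : RR => (z - a) ^+ 2 : RR).
  by apply: measurable_funX; exact: measurable_funB.
have mf n : measurable_fun [set: RR] (f n : RR -> RR) by exact: measurable_minr.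
have f0 n z : 0 <= f n z by rewrite le_min sqr_ge0 ler0n.
have bf n : bjm (z_only (f n)).
  by apply: (@bjm_fst _ _ n%:R) => // z; rewrite ger0_norm// ge_min lexx orbT.
apply: integral_le_truncations.
- exact: measurableT_comp msq mS.
- by move=> w; exact: sqr_ge0.
move=> n; rewrite -[X in (X <= _)%E]/(\int[P]_w (f n (path_sum g Y p w))%:E)%E.
have P1 : P setT = 1%E by exact: probability_setT.
rewrite (bexp_EFin P1); last first.
  split; first exact: measurableT_comp (mf n) mS.
  by exists n%:R => w; rewrite ger0_norm// ge_min lexx orbT.
rewrite lee_fin.
have dh : Vdom V (fun x => B * (V x + p%:R + 1)).
  apply: VdomZ; apply: VdomD; last exact: Vdom_cst.
  by apply: VdomD; [exact: VdomV|exact: Vdom_cst].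
apply: (le_trans (annealed_chain_expectation p1 YC (bf n) dh _)).
  by move=> x; apply: Ha => // z y; rewrite ge_min lexx.
have dVp : Vdom V (fun x => V x + p%:R).
  by apply: VdomD; [exact: VdomV|exact: Vdom_cst].
rewrite (VintZ mV V1 pmu); last by apply: VdomD => //; exact: Vdom_cst.
rewrite (VintD mV V1 pmu)//; last exact: Vdom_cst.
rewrite (VintD mV V1 pmu); [|exact: VdomV|exact: Vdom_cst].
rewrite !(Vint_cst pmu) -mulrA ler_wpM2l// -/m.
have p1' : 1 <= p%:R :> R by rewrite ler1n.
have aux (u v : R) : 0 <= u -> 1 <= v -> u + v + 1 <= (u + 2) * v by nra.
exact: aux.
Qed.

(** A phase [al] is a translation of the sum by [al / t] with [t = a / p], and the operator bound is
    uniform in translations. The remainder [rho * t ^ 2 * m] is of order [1 / p ^ 2] and takes at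
    most half of the gain. *)
Lemma chain_char_sqr s0 : Sphi phi0 s0 -> separated_blocks k C nu g s0 ->
  exists2 c : R, 0 < c & forall a : R, 0 < a ->
  exists p0, forall p, (p0 <= p)%N ->
  forall (d : measure_display) (Omega : measurableType d)
    (P : probability Omega R) (Y : nat -> Omega -> RR), annealed_chain P p Y ->
  0 <= 1 - c * a ^+ 2 / p%:R /\
  char_sqr P (fun w => a / p%:R * path_sum g Y p w) <=
    (1 - c * a ^+ 2 / p%:R) ^+ 2.
Proof.
move=> Ss0 sep.
have [c [rho [c0 rho0 H]]] := annealed_contraction phi01 D mg Ss0 sep.
exists (c / 2); first exact: divr_gt0.
move=> a a0; have [p0 Hp] := H a a0.
set m := \int[mu]_x (V x + b / (1 - lam)).
pose p1 := (Num.truncn (2 * rho * m / c)).+1.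
exists (maxn p1 p0) => p; rewrite geq_max => /andP[pp1 pp0] d Omega P Y YC.
have p_gt0 : (0 < p)%N by exact: leq_trans pp1.
have pR : 0 < p%:R :> R by rewrite ltr0n.
have [mY _] := YC.
have mS := @path_sum_measurable R d Omega g mg Y mY p.
have P1 : P setT = 1%E by exact: probability_setT.
set q := 1 - _.
have mtS : measurable_fun [set: Omega] (fun w => a / p%:R * path_sum g Y p w).
  exact: measurable_funM.
apply: sqr_le_of_phases => al.
rewrite [leLHS](_ : _ =
   \int[P]_w cos (a / p%:R * (path_sum g Y p w + al / (a / p%:R)))); last first.
  rewrite mulrC (mulrC _ (sin al)) -mulNr -(bexp_lin P1); last 2 first.
  - exact: bmf_cos.
  - exact: bmf_sin.
  apply: eq_Rintegral => w _; rewrite mulrDr mulrCA divff ?mulr1; last first.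
    by rewrite gt_eqF// divr_gt0.
  by rewrite cosD mulrC (mulrC _ (sin al)) mulNr.
have mcos : measurable_fun [set: RR]
    (fun z : RR => cos (a / p%:R * (z + al / (a / p%:R))) : RR).
  have : measurable_fun [set: RR]
      (fun z : RR => a / p%:R * (z + al / (a / p%:R)) : RR).
    by apply: measurable_funM => //; exact: measurable_funD.
  by move=> /bmf_cos[].
have bF : bjm (z_only (fun z : R => cos (a / p%:R * (z + al / (a / p%:R))))).
  by apply: (@bjm_fst _ _ 1) => // z; rewrite ler_norml cos_geN1 cos_le1.
have dVb : Vdom V (fun x => V x + b / (1 - lam)).
  by apply: VdomD; [exact: VdomV|exact: Vdom_cst].
have dh : Vdom V (fun x => 1 - c * a ^+ 2 / p%:R +
    rho * (a / p%:R) ^+ 2 * (V x + b / (1 - lam))).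
  by apply: VdomD; [exact: Vdom_cst|exact: VdomZ].
apply: (le_trans (annealed_chain_expectation p_gt0 YC bF dh _)).
  move=> x; have := Hp p pp0 (0 + al / (a / p%:R)) x.
  by rewrite -Eop_translate.
rewrite (VintD mV V1 pmu); [|exact: Vdom_cst|exact: VdomZ].
rewrite (VintZ mV V1 pmu)// (Vint_cst pmu) -/m.
have pm : 2 * rho * m / c <= p%:R.
  by rewrite ltW// (lt_le_trans (truncnS_gt _))// ler_nat.
have rm : rho * m / p%:R <= c / 2.
  by move: pm; rewrite !ler_pdivrMr// [c / 2 * _]mulrAC ler_pdivlMr//; lra.
rewrite /q -addrA lerD2l.
have -> : rho * (a / p%:R) ^+ 2 * m = (rho * m / p%:R) * (a ^+ 2 / p%:R).
  by rewrite expr_div_n; field; rewrite gt_eqF.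
have a2 : 0 <= a ^+ 2 / p%:R by rewrite divr_ge0// ?sqr_ge0// ltW.
have aux (u v x : R) : u <= v / 2 -> 0 <= x -> - (v * x) + u * x <= - (v / 2 * x).
  by move=> uv x0; nra.
rewrite -(mulrA c) -(mulrA (c / 2)); exact: aux.
Qed.

End annealed_chains.

(** * The effective sample size *)

Section effective_sample_size.
Context {R : realType} (N : nat).
Implicit Types (w L : 'I_N -> R).

Definition ess w : R := (\sum_(i < N) w i) ^+ 2 / \sum_(i < N) w i ^+ 2.

Lemma ess_balanced w (A q : R) : (0 < N)%N -> 0 < A -> 1 <= q ->
  (forall i, A <= w i <= A * q) -> `|ess w - N%:R| <= N%:R * (q ^+ 2 - 1).
Proof.
move=> N0 A0 q1 wA; have q0 : 0 < q by exact: lt_le_trans q1.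
have N0' : 0 < N%:R :> R by rewrite ltr0n.
have w0 i : 0 < w i by case/andP: (wA i) => [h _]; exact: lt_le_trans h.
have sumcst (x : R) : \sum_(i < N) x = N%:R * x.
  by rewrite sumr_const card_ord mulr_natl.
have s1 : N%:R * A <= \sum_(i < N) w i.
  by rewrite -sumcst; apply: ler_sum => i _; case/andP: (wA i).
have s2 : \sum_(i < N) w i <= N%:R * (A * q).
  by rewrite -sumcst; apply: ler_sum => i _; case/andP: (wA i).
have t1 : N%:R * A ^+ 2 <= \sum_(i < N) w i ^+ 2.
  rewrite -sumcst; apply: ler_sum => i _; case/andP: (wA i) => h _.
  by rewrite ler_pXn2r// nnegrE ltW.
have t2 : \sum_(i < N) w i ^+ 2 <= N%:R * (A * q) ^+ 2.
  rewrite -sumcst; apply: ler_sum => i _; case/andP: (wA i) => _ h.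
  by rewrite ler_pXn2r// nnegrE ltW// mulr_gt0.
have NA : 0 < N%:R * A by exact: mulr_gt0.
have t0 : 0 < \sum_(i < N) w i ^+ 2.
  by apply: lt_le_trans t1; rewrite mulr_gt0// exprn_gt0.
have S0 : 0 <= \sum_(i < N) w i by exact: le_trans (ltW NA) s1.
have S1 : (N%:R * A) ^+ 2 <= (\sum_(i < N) w i) ^+ 2.
  by rewrite ler_pXn2r// nnegrE ltW.
have S2 : (\sum_(i < N) w i) ^+ 2 <= (N%:R * (A * q)) ^+ 2.
  by rewrite ler_pXn2r// nnegrE (le_trans S0).
have up : ess w <= N%:R * q ^+ 2.
  rewrite /ess ler_pdivrMr// (le_trans S2)//.
  rewrite [leLHS](_ : _ = N%:R * q ^+ 2 * (N%:R * A ^+ 2)); last by ring.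
  by rewrite ler_wpM2l// mulr_ge0// ?sqr_ge0// ltW.
have low : N%:R / q ^+ 2 <= ess w.
  rewrite /ess ler_pdivlMr// mulrAC ler_pdivrMr ?exprn_gt0//.
  apply: (le_trans (y := N%:R * (N%:R * (A * q) ^+ 2))).
    by rewrite ler_wpM2l// ltW.
  rewrite [leLHS](_ : _ = (N%:R * A) ^+ 2 * q ^+ 2); last by ring.
  by rewrite ler_wpM2r// sqr_ge0.
have Q1 : 1 <= q ^+ 2 by rewrite exprn_ege1.
have Qinv : 2 - q ^+ 2 <= (q ^+ 2)^-1.
  have aux (x : R) : 1 <= x -> 2 - x <= x^-1.
    move=> x1; have x0 : 0 < x by exact: lt_le_trans x1.
    by rewrite -(ler_pM2r x0) mulVf ?gt_eqF//; nra.
  exact: aux.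
have low' : N%:R * (2 - q ^+ 2) <= ess w.
  by apply: le_trans low; rewrite ler_wpM2l// ltW.
rewrite ler_norml; apply/andP; split.
  by rewrite lerBrDr (le_trans _ low')// le_eqVlt; apply/orP; left; apply/eqP; ring.
by rewrite lerBlDr (le_trans up)// le_eqVlt; apply/orP; left; apply/eqP; ring.
Qed.

(** All weights but the largest are at most [q] times it, so the sum is at most [1 + N q] times the
    largest, while the sum of squares is at least its square. *)
Lemma ess_dominated w (q : R) : (0 < N)%N -> 0 <= q -> (forall i, 0 < w i) ->
  (forall i j, i != j -> w i <= q * w j \/ w j <= q * w i) -> q <= 1 ->
  `|ess w - 1| <= (1 + N%:R * q) ^+ 2 - 1.
Proof.
move=> N0 q0 w0 wq q1.
pose i0 := [arg max_(i > Ordinal N0) w i]%O.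
have wi0 i : w i <= w i0.
  by rewrite /i0; case: arg_maxP => //= j _ /(_ i isT).
have wiq i : i != i0 -> w i <= q * w i0.
  move=> ii0; have [//|h] := wq i i0 ii0.
  have wieq : w i0 <= w i.
    by rewrite (le_trans h)// ler_piMl// ltW.
  apply: (le_trans (wi0 i)); apply: (le_trans h).
  by rewrite ler_wpM2l.
have t0 : 0 < \sum_(i < N) w i ^+ 2.
  rewrite (bigD1 i0)//= ltr_pwDl ?exprn_gt0// sumr_ge0// => i _; exact: sqr_ge0.
have sw : \sum_(i < N) w i <= (1 + N%:R * q) * w i0.
  rewrite (bigD1 i0)//= mulrDl mul1r lerD2l.
  apply: (@le_trans _ _ (\sum_(i < N | i != i0) q * w i0)).
    by apply: ler_sum => i /wiq.
  rewrite -mulrA sumr_const -(mulr_natl (q * w i0)).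
  apply: ler_wpM2r; first by rewrite mulr_ge0// ltW.
  by rewrite ler_nat (leq_trans (max_card _))// card_ord.
have sw0 : 0 <= \sum_(i < N) w i by apply: sumr_ge0 => i _; exact: ltW.
have up : ess w <= (1 + N%:R * q) ^+ 2.
  rewrite /ess ler_pdivrMr//.
  apply: (@le_trans _ _ (((1 + N%:R * q) * w i0) ^+ 2)).
    by rewrite ler_pXn2r// nnegrE (le_trans sw0).
  rewrite exprMn ler_wpM2l ?sqr_ge0// (bigD1 i0)//= lerDl sumr_ge0// => i _.
  exact: sqr_ge0.
have low : 1 <= ess w.
  rewrite /ess ler_pdivlMr// mul1r expr2 mulr_suml ler_sum// => i _.
  rewrite expr2 ler_wpM2l//; first exact: ltW.
  by rewrite (bigD1 i)//= lerDl sumr_ge0// => j _; exact: ltW.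
by rewrite ger0_norm ?subr_ge0// lerD2r.
Qed.

End effective_sample_size.

Lemma markov_ge0 d (T : measurableType d) (R : realType)
    (P : probability T R) (h : T -> R) (t c : R) :
  measurable_fun [set: T] h -> (forall x, 0 <= h x) -> 0 < t ->
  (\int[P]_x (h x)%:E <= c%:E)%E -> (P [set x | (t <= h x)%R] <= (c / t)%:E)%E.
Proof.
move=> mh h0 t0 hc; set A := [set x | _].
have mA : measurable A.
  have := mh measurableT `[t, +oo[%classic (measurable_itv _).
  rewrite setTI (_ : _ @^-1` _ = A)//; apply/seteqP; split => x /=;
    by rewrite in_itv/= andbT.
have mE : measurable_fun [set: T] (fun x => (h x)%:E) by exact/measurable_EFinP.
rewrite EFinM lee_pdivlMr// muleC.
apply: le_trans hc; rewrite -integral_cst//.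
apply: (@le_trans _ _ (\int[P]_(x in A) (h x)%:E)%E); last first.
  by apply: ge0_subset_integral => // x _; rewrite lee_fin.
apply: ge0_le_integral => //.
- by move=> x _; rewrite lee_fin ltW.
- exact: measurable_funTS.
Qed.

(** * The Fejer kernel *)

Section fejer.
Context {R : realType}.

(* Squared modulus of the geometric sum of [expR (i x)]: a Fejer kernel up to
   normalisation, hence a trigonometric polynomial that detects [x] near 0. *)
Definition fejer (n : nat) (x : R) : R :=
  (\sum_(i < n) cos (i%:R * x)) ^+ 2 + (\sum_(i < n) sin (i%:R * x)) ^+ 2.

Lemma fejerE n x :
  fejer n x = \sum_(i < n) \sum_(j < n) cos (`|i%:R - j%:R| * x).
Proof.
rewrite /fejer !expr2 !mulr_suml -big_split /=; apply: eq_bigr => i _.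
rewrite !mulr_sumr -big_split /=; apply: eq_bigr => j _.
have -> : cos (`|i%:R - j%:R| * x) = cos ((i%:R - j%:R) * x).
  by case: ler0P => _ //; rewrite mulNr cosN.
by rewrite mulrBl cosB.
Qed.

Lemma fejer_ge0 n x : 0 <= fejer n x.
Proof. by rewrite addr_ge0// sqr_ge0. Qed.

(** All [n] cosines of the geometric sum are at least 1/2, their frequencies being below [n]. *)
Lemma fejer_near0 v0 n x : (forall v : R, `|v| <= v0 -> 1 / 2 <= cos v) ->
  `|n%:R * x| <= v0 -> (n%:R / 2) ^+ 2 <= fejer n x.
Proof.
move=> cosv nx; rewrite /fejer -[leLHS]addr0 lerD ?sqr_ge0//.
have h : n%:R / 2 <= \sum_(i < n) cos (i%:R * x).
  rewrite [leLHS](_ : _ = \sum_(i < n) (1 / 2 : R)); last first.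
    by rewrite sumr_const card_ord -[RHS]mulr_natl mul1r.
  apply: ler_sum => i _; apply: cosv; apply: le_trans nx.
  by rewrite !normrM ler_wpM2r// !normr_nat ler_nat ltnW.
by rewrite ler_pXn2r// nnegrE ?(le_trans _ h)// divr_ge0.
Qed.

Lemma fejer_measurable d (T : measurableType d) n (X : T -> R) :
  measurable_fun [set: T] X -> measurable_fun [set: T] (fun w => fejer n (X w)).
Proof.
move=> mX; apply: measurable_funD; apply: measurable_funX;
  apply: measurable_sum => i.
- by apply: (bmf_cos _).1; exact: measurable_funM.
- by apply: (bmf_sin _).1; exact: measurable_funM.
Qed.

(** The [n] diagonal terms of the double sum contribute at most 1 each; all others have a positive
    frequency below [n]. *)
Lemma fejer_expectation d (T : measurableType d) (P : probability T R) n
    (X : T -> R) (eta : R) : measurable_fun [set: T] X -> 0 <= eta ->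
  (forall j, (0 < j < n)%N -> \int[P]_w cos (j%:R * X w) <= eta) ->
  (\int[P]_w (fejer n (X w))%:E <= (n%:R + n%:R ^+ 2 * eta)%:E)%E.
Proof.
move=> mX eta0 H; have P1 : P setT = 1%E by exact: probability_setT.
have bc (i j : nat) : bmf (fun w => cos (`|i%:R - j%:R| * X w) : R).
  by apply: bmf_cos; exact: measurable_funM.
have bs (i : nat) : bmf (fun w => \sum_(j < n) cos (`|i%:R - j%:R| * X w) : R).
  by apply: (@bmf_sum _ _ _ _ _ (fun j w => _)) => j; exact: bc.
under eq_integral do rewrite fejerE.
rewrite (bexp_EFin P1); last first.
  by apply: (@bmf_sum _ _ _ _ _ (fun i w => _)) => i; exact: bs.
rewrite lee_fin (bexp_sum P1 _ (f := fun i w => _))//.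
rewrite [leRHS](_ : _ = \sum_(i < n) (1 + n%:R * eta)); last first.
  rewrite sumr_const card_ord -[RHS]mulr_natl; ring.
apply: ler_sum => i _; rewrite (bexp_sum P1 _ (f := fun i w => _))//.
rewrite (bigD1 i)//=; apply: lerD.
  rewrite -[leRHS](bexp_cst P1 1); apply: (bexp_le P1) => [||w].
  - exact: bc.
  - exact: bmf_cst.
  - exact: cos_le1.
apply: (@le_trans _ _ (\sum_(j < n | j != i) eta)).
  apply: ler_sum => j ji; rewrite -val_eqE /= in ji.
  have [ij|ij] := leqP i j.
    rewrite -normrN opprB -natrB// normr_nat; apply: H.
    by rewrite subn_gt0 ltn_neqAle eq_sym ji ij (leq_ltn_trans (leq_subr _ _)).
  rewrite -natrB ?(ltnW ij)// normr_nat; apply: H.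
  by rewrite subn_gt0 ij (leq_ltn_trans (leq_subr _ _)).
rewrite sumr_const -(mulr_natl eta) ler_wpM2r// ler_nat.
by rewrite (leq_trans (max_card _))// card_ord.
Qed.

End fejer.

Section second_moments.
Context {R : realType} d (Omega : measurableType d) (P : probability Omega R).

Lemma le_integrable_ge0 (f h : Omega -> R) : measurable_fun [set: Omega] f ->
  (forall w, `|f w| <= h w) -> P.-integrable setT (EFin \o h) ->
  P.-integrable setT (EFin \o f).
Proof.
move=> mf fh ih; apply: (@le_integrable _ _ _ P setT _ _ (EFin \o h)) => //.
- exact/measurable_EFinP.
- by move=> w _ /=; rewrite lee_fin (le_trans (fh w))// ler_norm.
Qed.

(** The mean minimizes the mean square deviation, so a bound around any [a] bounds the variance. *)
Lemma centered_second_moment (S : Omega -> R) (a c : R) :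
  measurable_fun [set: Omega] S ->
  (\int[P]_w ((S w - a) ^+ 2)%:E <= c%:E)%E ->
  let m := \int[P]_w S w in
  [/\ P.-integrable setT (EFin \o (fun w => S w - m)),
      P.-integrable setT (fun w => ((S w - m) ^+ 2)%:E),
      (\int[P]_w (S w - m)%:E = 0)%E &
      (\int[P]_w ((S w - m) ^+ 2)%:E <= c%:E)%E].
Proof.
move=> mS Sc m; have P1 : P setT = 1%E by exact: probability_setT.
have mSa x : measurable_fun [set: Omega] (fun w => S w - x).
  exact: measurable_funB.
have mSa2 x : measurable_fun [set: Omega] (fun w => (S w - x) ^+ 2).
  by apply: measurable_funX; exact: mSa.
have icst x : P.-integrable setT (EFin \o (fun _ : Omega => x)).
  by apply: (bmf_integrable P1); exact: bmf_cst.
have ia2 : P.-integrable setT (EFin \o (fun w => (S w - a) ^+ 2)).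
  apply/integrableP; split; first exact/measurable_EFinP.
  rewrite (le_lt_trans _ (ltry c))// (le_trans _ Sc)//.
  rewrite le_eqVlt; apply/orP; left; apply/eqP.
  by apply: eq_integral => w _ /=; rewrite ger0_norm// sqr_ge0.
have iSm x : P.-integrable setT (EFin \o (fun w => S w - x)).
  apply: (@le_integrable_ge0 _ (fun w => (S w - a) ^+ 2 + (1 + `|a - x|))) => //.
    move=> w; have -> : S w - x = (S w - a) + (a - x) by ring.
    rewrite (le_trans (ler_normD _ _))// addrA lerD2r.
    rewrite -(real_normK (num_real (S w - a))).
    have aux (u : R) : 0 <= u -> u <= u ^+ 2 + 1 by nra.
    exact: aux.
  exact: (integrableD measurableT ia2 (icst _)).
have iS : P.-integrable setT (EFin \o S).
  by have := iSm 0; under eq_fun do rewrite subr0.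
have i2 x : P.-integrable setT (EFin \o (fun w => (S w - x) ^+ 2)).
  apply: (@le_integrable_ge0 _ (fun w => 2 * (S w - a) ^+ 2 + 2 * (a - x) ^+ 2)) => //.
    move=> w; rewrite ger0_norm ?sqr_ge0//.
    have aux (u v z : R) : (u - z) ^+ 2 <= 2 * (u - v) ^+ 2 + 2 * (v - z) ^+ 2.
      have := sqr_ge0 (u - v - (v - z)); nra.
    exact: aux.
  exact: (integrableD measurableT (integrableZl measurableT 2 ia2) (icst _)).
have m0 : (\int[P]_w (S w - m)%:E = 0)%E.
  under eq_integral do rewrite EFinB.
  rewrite (integralB_EFin measurableT iS (icst m)).
  rewrite integral_cst// [X in (_ * X)%E]P1 mule1 /m /Rintegral fineK ?subee//;
    exact: integrable_fin_num.
split => //; first exact: i2.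
apply: le_trans Sc.
have := @integral_sqr_shift R d Omega P (fun w => S w - m) (m - a)
  (iSm m) (i2 m) m0.
rewrite (_ : (fun w => _) = (fun w => ((S w - a) ^+ 2)%:E)); last first.
  by apply/funext => w; congr (_ ^+ 2)%:E; ring.
by move=> ->; rewrite leeDr// lee_fin sqr_ge0.
Qed.

End second_moments.

Section annealed_means.
Context {R : realType}.
Local Notation RR := (measurableTypeR R).
Context (phi0 : R) (phi01 : 0 < phi0 < 1).
Context (k : R -> R.-pker RR ~> RR) (V : R -> R)
  (C : set RR) (nu : probability RR R) (theta lam b M : R)
  (D : drift_minor (Sphi phi0) k V C nu theta lam b M).
Context (g : R -> R) (mg : measurable_fun [set: RR] (g : RR -> RR)).
Context (mu : {measure set RR -> \bar R}) (pmu : Vprob V mu).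

(** The law of the path sum is given by [Eop] on indicators, hence shared by all chains. This
    provides one centre for all log-weights. *)
Lemma annealed_chain_mean (d : measure_display) (Omega : measurableType d)
    (P : probability Omega R) p (Y Y' : nat -> Omega -> RR) : (0 < p)%N ->
  annealed_chain phi0 k mu P p Y -> annealed_chain phi0 k mu P p Y' ->
  P.-integrable setT (EFin \o path_sum g Y p) ->
  P.-integrable setT (EFin \o path_sum g Y' p) ->
  \int[P]_w path_sum g Y p w = \int[P]_w path_sum g Y' p w.
Proof.
move=> p0 YC YC' iY iY'; have P1 : P setT = 1%E by exact: probability_setT.
have mS Z : annealed_chain phi0 k mu P p Z ->
    measurable_fun [set: Omega] (path_sum g Z p : _ -> RR).
  by move=> [mZ _]; exact: path_sum_measurable.
have law Z (A : set RR) : annealed_chain phi0 k mu P p Z -> measurable A ->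
    P (path_sum g Z p @^-1` A) = (\int[mu]_x
      Eop k g (anneal_clip phi0 p) p 0 (z_only \1_A) 0 x)%:E.
  move=> ZC mA; have [mZ ZMC] := ZC.
  have Ssg n : Sphi phi0 (anneal_clip phi0 p n) by exact: anneal_clip_in.
  have bA : bjm (z_only (\1_A : R -> R)).
    apply: (@bjm_fst _ _ 1); first exact: measurable_indic.
    by move=> z; rewrite indicE; case: (z \in A); rewrite ?normr1 ?normr0.
  rewrite -(path_expectation mg mZ D Ssg ZMC _ pmu bA); last first.
    by move=> n np; rewrite anneal_clipE.
  have mAS : measurable (path_sum g Z p @^-1` A).
    by have := mS Z ZC measurableT A mA; rewrite setTI.
  rewrite /z_only -(bexp_EFin P1); last first.
    split; first exact: (measurableT_comp (measurable_indic mA) (mS Z ZC)).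
    by exists 1 => w; rewrite indicE; case: (_ \in A); rewrite ?normr1 ?normr0.
  rewrite (_ : (fun w => _) = (fun w => (\1_(path_sum g Z p @^-1` A) w)%:E)).
    by rewrite integral_indic// setIT.
  by apply/funext => w; rewrite !indicE; congr (_%:R)%:E;
    apply/idP/idP; rewrite !inE.
pose X Z (ZC : annealed_chain phi0 k mu P p Z) : {mfun Omega >-> RR} :=
  mfun_Sub (mem_set (mS Z ZC) : (path_sum g Z p : Omega -> RR) \in mfun).
have mE Z (ZC : annealed_chain phi0 k mu P p Z) :
    P.-integrable setT (EFin \o path_sum g Z p) ->
    (\int[P]_w (path_sum g Z p w)%:E = \int[distribution P (X Z ZC)]_x x%:E)%E.
  move=> iZ; rewrite integral_distribution//; exact: measurable_EFin.
rewrite /Rintegral (mE _ YC iY) (mE _ YC' iY'); congr fine.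
apply: eq_measure_integral => A mA _.
exact: etrans (law Y A YC mA) (esym (law Y' A YC' mA)).
Qed.

End annealed_means.

Lemma expectation_sum_le d (T : measurableType d) (R : realType)
    (P : {measure set T -> \bar R}) (n : nat) (f : 'I_n -> T -> R) (c : R) :
  (forall i, measurable_fun [set: T] (f i)) -> (forall i w, 0 <= f i w) ->
  (forall i, \int[P]_w (f i w)%:E <= c%:E)%E ->
  (\int[P]_w (\sum_(i < n) f i w)%:E <= (n%:R * c)%:E)%E.
Proof.
move=> mf f0 fc; under eq_integral do rewrite -sumEFin.
rewrite ge0_integral_sum//; last 2 first.
- by move=> i; apply/measurable_EFinP.
- by move=> i w _; rewrite lee_fin.
apply: (@le_trans _ _ (\sum_(i < n) c%:E)%E); first exact: lee_sum.
by rewrite sumEFin sumr_const card_ord -(mulr_natl c).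
Qed.

(** * Deviations of the effective sample size at fixed dimension *)

Section particle_system.
Context {R : realType}.
Local Notation RR := (measurableTypeR R).
Context (phi0 : R) (phi01 : 0 < phi0 < 1).
Context (k : R -> R.-pker RR ~> RR) (V : R -> R)
  (C : set RR) (nu : probability RR R) (theta lam b M : R)
  (D : drift_minor (Sphi phi0) k V C nu theta lam b M).
Context (g : R -> R) (mg : measurable_fun [set: RR] (g : RR -> RR)).
Context (mu : {measure set RR -> \bar R}) (pmu : Vprob V mu).
Context (N : nat) (N0 : (0 < N)%N).

Definition particle_system (d : measure_display) (Omega : measurableType d)
    (P : probability Omega R) (dim p : nat)
    (Y : 'I_N * 'I_dim -> nat -> Omega -> RR) : Prop :=
  (forall ij, annealed_chain phi0 k mu P p (Y ij)) /\
  independent_chains P p (fun ij => Y ij : nat -> Omega -> R).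

Section fixed_system.
Context (d : measure_display) (Omega : measurableType d)
  (P : probability Omega R) (dim p : nat)
  (Y : 'I_N * 'I_dim -> nat -> Omega -> RR).
Hypothesis p0 : (0 < p)%N.
Hypothesis YPS : particle_system P p Y.

Let mY ij n : measurable_fun [set: Omega] (Y ij n).
Proof. by have [/(_ ij)[]] := YPS. Qed.

Let mS ij : measurable_fun [set: Omega] (path_sum g (Y ij) p : _ -> RR).
Proof. exact: path_sum_measurable. Qed.

Lemma path_sum_adapted (h : 'I_N * 'I_dim -> R -> R) :
  (forall ij, measurable_fun [set: RR] (h ij : RR -> RR)) ->
  adapted p Y (fun ij w => h ij (path_sum g (Y ij) p w)).
Proof.
move=> mh ij A mA.
have mA' : measurable ((fun z : RR * RR => h ij z.1) @^-1` A).
  have mh' : measurable_fun [set: RR * RR] (fun z : RR * RR => h ij z.1 : RR).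
    exact: measurableT_comp (mh ij) (@measurable_fst _ _ _ _).
  by have := mh' measurableT A mA; rewrite setTI.
exact: (history_path_sum mg (leqnSn p) mA').
Qed.

Definition coords (i : 'I_N) : seq ('I_N * 'I_dim) :=
  [seq (i, j) | j <- index_enum 'I_dim].

Lemma coords_uniq i : uniq (coords i).
Proof. by rewrite map_inj_uniq ?index_enum_uniq// => j j' []. Qed.

Lemma big_coords (T : Type) (idx : T) (op : Monoid.law idx) i
    (F : 'I_N * 'I_dim -> T) :
  \big[op/idx]_(ij <- coords i) F ij = \big[op/idx]_(j < dim) F (i, j).
Proof. by rewrite big_map. Qed.

Definition log_weight (i : 'I_N) (w : Omega) : R :=
  (1 - phi0) / p%:R * \sum_(j < dim) path_sum g (Y (i, j)) p w.

Definition weights (w : Omega) (i : 'I_N) : R := expR (log_weight i w).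

Lemma log_weight_measurable i : measurable_fun [set: Omega] (log_weight i).
Proof.
apply: measurable_funM => //; apply: measurable_sum => j.
exact: mS.
Qed.

Lemma ess_weights_measurable :
  measurable_fun [set: Omega] (fun w => ess (weights w)).
Proof.
have mw i : measurable_fun [set: Omega] (fun w => weights w i).
  exact: measurableT_comp (@measurable_expR R) (log_weight_measurable i).
have m2 : measurable_fun [set: Omega] (fun w => \sum_(i < N) weights w i ^+ 2).
  by apply: measurable_sum => i; exact: measurable_funX.
rewrite (_ : (fun w => _) = (fun w => (\sum_(i < N) weights w i) ^+ 2 *
    expR (- ln (\sum_(i < N) weights w i ^+ 2)))).
  apply: measurable_funM; first by apply: measurable_funX; apply: measurable_sum.
  apply: measurableT_comp (@measurable_expR R) _.
  by apply: measurableT_comp => //; exact: measurableT_comp (@measurable_ln R) m2.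
apply/funext => w; rewrite /ess expRN lnK// posrE.
rewrite (bigD1 (Ordinal N0))//= ltr_pwDl ?exprn_gt0 ?expR_gt0//.
by apply: sumr_ge0 => i _; exact: sqr_ge0.
Qed.

Lemma ess_deviation_measurable (l e : R) :
  measurable [set w | (e <= `|ess (weights w) - l|)%R].
Proof.
have : measurable_fun [set: Omega] (fun w => `|ess (weights w) - l|).
  apply: measurableT_comp => //; apply: measurable_funB => //.
  exact: ess_weights_measurable.
move=> /(_ measurableT `[e, +oo[%classic (measurable_itv _)).
rewrite setTI (_ : _ @^-1` _ = [set w | (e <= `|ess (weights w) - l|)%R])//.
by apply/seteqP; split => x /=; rewrite in_itv/= andbT.
Qed.

(** Centring at the mean makes the terms of a log-weight orthogonal, so their second moments add up
    to [dim * B] only. Markov's inequality for the sum over the particles controls all log-weights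
    at once. *)
Lemma balanced_deviation (a B eps eta : R) : 0 < eta -> 0 <= B ->
  (forall ij, \int[P]_w ((path_sum g (Y ij) p w - a) ^+ 2)%:E <= B%:E)%E ->
  N%:R * (expR (2 * eta) ^+ 2 - 1) < eps ->
  (P [set w | (eps <= `|ess (weights w) - N%:R|)%R] <=
   (N%:R * (dim%:R * B) / (p%:R * eta) ^+ 2)%:E)%E.
Proof.
move=> eta0 B0 SB epsN; have P1 : P setT = 1%E by exact: probability_setT.
have pR : 0 < p%:R :> R by rewrite ltr0n.
have cent ij := centered_second_moment (mS ij) (SB ij).
(* The common mean, read off from any one chain; the default 0 is for [dim = 0]. *)
pose m : R := if [pick j : 'I_dim] is Some j
  then \int[P]_w path_sum g (Y (Ordinal N0, j)) p w else 0.
have integS ij : P.-integrable setT (EFin \o path_sum g (Y ij) p).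
  have [i1 _ _ _] := cent ij.
  set x := \int[P]_w path_sum g (Y ij) p w in i1.
  have ic : P.-integrable setT (EFin \o (fun _ : Omega => x)).
    by apply: (bmf_integrable P1); exact: bmf_cst.
  have := integrableD measurableT i1 ic.
  by congr integrable; apply/funext => w /=; rewrite -EFinD subrK.
have mE ij : \int[P]_w path_sum g (Y ij) p w = m.
  rewrite /m; case: pickP => [j _|/(_ ij.2)//].
  by apply: (annealed_chain_mean phi01 D mg pmu p0) => //; case: YPS.
pose Z ij w := path_sum g (Y ij) p w - m.
have aZ : adapted p Y Z.
  by apply: (@path_sum_adapted (fun _ x => x - m)) => ij; exact: measurable_funB.
have cZ ij : [/\ P.-integrable setT (EFin \o Z ij),
    P.-integrable setT (fun w => (Z ij w ^+ 2)%:E),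
    (\int[P]_w (Z ij w)%:E = 0)%E & (\int[P]_w (Z ij w ^+ 2)%:E <= B%:E)%E].
  by have := cent ij; rewrite /= mE.
have ind : independent_chains P p (fun ij => Y ij : nat -> Omega -> R) by case: YPS.
pose T i w := \sum_(j < dim) Z (i, j) w.
have mZ ij : measurable_fun [set: Omega] (Z ij).
  by apply: measurable_funB => //; exact: mS.
have mT i : measurable_fun [set: Omega] (T i) by apply: measurable_sum => j.
have ET i : (\int[P]_w (T i w ^+ 2)%:E <= (dim%:R * B)%:E)%E.
  have := sqr_sum mY ind aZ (coords_uniq i) (fun ij => let: And4 h _ _ _ := cZ ij in h)
    (fun ij => let: And4 _ h _ _ := cZ ij in h)
    (fun ij => let: And4 _ _ h _ := cZ ij in h).
  under eq_integral do rewrite big_coords.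
  rewrite big_coords => ->.
  apply: (@le_trans _ _ (\sum_(j < dim) B%:E)%E).
    by apply: lee_sum => j _; have [_ _ _] := cZ (i, j).
  by rewrite sumEFin sumr_const card_ord mulr_natl.
pose Q w := \sum_(i < N) T i w ^+ 2.
have Q0 w : 0 <= Q w by apply: sumr_ge0 => i _; exact: sqr_ge0.
have mQ : measurable_fun [set: Omega] Q.
  by apply: measurable_sum => i; exact: measurable_funX.
have EQ : (\int[P]_w (Q w)%:E <= (N%:R * (dim%:R * B))%:E)%E.
  apply: expectation_sum_le => [i|i w|//]; first exact: measurable_funX.
  exact: sqr_ge0.
have t0 : 0 < (p%:R * eta) ^+ 2 by rewrite exprn_gt0// mulr_gt0.
apply: le_trans (markov_ge0 mQ Q0 t0 EQ).
apply: le_measure; rewrite ?inE.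
- exact: ess_deviation_measurable.
- have := mQ measurableT `[(p%:R * eta) ^+ 2, +oo[%classic (measurable_itv _).
  rewrite setTI (_ : _ @^-1` _ = [set x | ((p%:R * eta) ^+ 2 <= Q x)%R])//.
  by apply/seteqP; split => x /=; rewrite in_itv/= andbT.
move=> w /=; apply: contraTT; rewrite -!ltNge => Qw.
have Tw i : `|T i w| <= p%:R * eta.
  rewrite -(@ler_pXn2r _ 2)// ?nnegrE// ?mulr_ge0// ?ltW//.
  rewrite real_normK ?num_real//; apply: le_lt_trans Qw.
  by rewrite /Q (bigD1 i)//= lerDl; apply: sumr_ge0 => i' _; exact: sqr_ge0.
pose c := (1 - phi0) * (dim%:R * m) / p%:R.
have lwE i : log_weight i w = c + (1 - phi0) / p%:R * T i w.
  rewrite /log_weight /T /Z sumrB sumr_const card_ord -[m *+ dim]mulr_natl /c.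
  by ring.
have lwc i : `|log_weight i w - c| <= eta.
  rewrite lwE addrAC subrr add0r normrM.
  have /andP[f0 f1] := phi01.
  have h0 : 0 <= 1 - phi0 by rewrite subr_ge0 ltW.
  rewrite ger0_norm; last by rewrite divr_ge0// ltW.
  rewrite mulrAC ler_pdivrMr// [leRHS]mulrC.
  apply: le_trans (Tw i); rewrite ler_piMl//.
  by rewrite lerBlDr lerDl ltW.
apply: le_lt_trans epsN.
apply: (@ess_balanced _ _ _ (expR (c - eta))) => //.
- exact: expR_gt0.
- by rewrite -expR0 ler_expR mulr_ge0// ltW.
- move=> i; have /ler_normlP[h1 h2] := lwc i.
  rewrite /weights -expRD !ler_expR; apply/andP; split; first by lra.
  by lra.
Qed.

(** The difference is a signed sum over the [2 * dim] independent chains of two particles, and a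
    sign leaves the modulus unchanged. *)
Lemma char_sqr_log_weight_diff (t rho : R) i i' : i != i' -> 0 <= rho ->
  (forall ij, char_sqr P (fun w => t * (1 - phi0) / p%:R * path_sum g (Y ij) p w)
    <= rho) ->
  char_sqr P (fun w => t * (log_weight i w - log_weight i' w)) <= rho ^+ (dim * 2).
Proof.
move=> ii' rho0 H.
pose u : R := t * (1 - phi0) / p%:R.
pose sgn (ij : 'I_N * 'I_dim) : R := if ij.1 == i then u else - u.
pose Z ij w := sgn ij * path_sum g (Y ij) p w.
have aZ : adapted p Y Z.
  by apply: (@path_sum_adapted (fun ij x => sgn ij * x)) => ij; exact: measurable_funM.
have ind : independent_chains P p (fun ij => Y ij : nat -> Omega -> R) by case: YPS.
have us : uniq (coords i ++ coords i').
  rewrite cat_uniq !coords_uniq andbT /=; apply/hasPn => _ /mapP[j' _ ->].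
  by apply/mapP => -[j _ [/eqP]]; rewrite eq_sym (negbTE ii').
have -> : (fun w => t * (log_weight i w - log_weight i' w)) =
    (fun w => \sum_(ij <- coords i ++ coords i') Z ij w).
  apply/funext => w; rewrite big_cat /= !big_coords /Z /sgn /= eqxx eq_sym.
  rewrite (negbTE ii') -!mulr_sumr /log_weight /u.
  by ring.
rewrite (char_sqr_sum mY ind aZ us) big_cat /= !big_coords.
have cZ ij : char_sqr P (Z ij) <= rho.
  have mu' : measurable_fun [set: Omega] (fun w => u * path_sum g (Y ij) p w).
    by apply: measurable_funM => //; exact: mS.
  rewrite /Z /sgn; case: ifP => _; first exact: H.
  under [X in char_sqr P X]eq_fun do rewrite mulNr.
  by rewrite char_sqrN//; exact: H.
have prod_le i1 : \prod_(j < dim) char_sqr P (Z (i1, j)) <= rho ^+ dim.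
  rewrite -[dim in leRHS]card_ord -prodr_const; apply: ler_prod => j _.
  by rewrite char_sqr_ge0 cZ.
rewrite exprM expr2.
by apply: ler_pM => //; apply: prodr_ge0 => j _; exact: char_sqr_ge0.
Qed.

(** Two log-weights at distance at most [K] push a Fejer kernel above [(n / 2) ^ 2], which Markov's
    inequality for the sum over all pairs makes unlikely. Otherwise, of any two weights one is at
    most [exp (- K)] times the other. *)
Lemma dominated_deviation (v0 K eps rho eta : R) (n : nat) :
  (forall v : R, `|v| <= v0 -> 1 / 2 <= cos v) -> 0 < v0 -> 0 < K -> (0 < n)%N ->
  0 <= rho -> 0 <= eta -> rho ^+ (dim * 2) <= eta ^+ 2 ->
  (forall j ij, (0 < j < n)%N ->
    char_sqr P (fun w => j%:R * (v0 / (n%:R * K)) * (1 - phi0) / p%:R *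
      path_sum g (Y ij) p w) <= rho) ->
  (1 + N%:R * expR (- K)) ^+ 2 - 1 < eps ->
  (P [set w | (eps <= `|ess (weights w) - 1|)%R] <=
   (N%:R * (N%:R * (n%:R + n%:R ^+ 2 * eta)) / (n%:R / 2) ^+ 2)%:E)%E.
Proof.
move=> cosv v00 K0 n0 rho0 eta0 rhoeta H epsK.
have P1 : P setT = 1%E by exact: probability_setT.
have nR : 0 < n%:R :> R by rewrite ltr0n.
(* Scaled so that a difference of at most [K], times [n * tau], stays within [v0]. *)
pose tau := v0 / (n%:R * K).
have tau0 : 0 < tau by rewrite divr_gt0// mulr_gt0.
pose X (i i' : 'I_N) w := tau * (log_weight i w - log_weight i' w).
have mX i i' : measurable_fun [set: Omega] (X i i').
  by apply: measurable_funM => //; apply: measurable_funB; exact: log_weight_measurable.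
have EX i i' : i' != i ->
    (\int[P]_w (fejer n (X i i' w))%:E <= (n%:R + n%:R ^+ 2 * eta)%:E)%E.
  move=> ii'; apply: fejer_expectation => // j jn.
  have h : char_sqr P (fun w => j%:R * X i i' w) <= eta ^+ 2.
    apply: le_trans rhoeta.
    rewrite (_ : (fun w => _) =
      (fun w => j%:R * tau * (log_weight i w - log_weight i' w))); last first.
      by apply/funext => w; rewrite /X mulrA.
    by apply: char_sqr_log_weight_diff; rewrite 1?eq_sym// => ij; exact: H.
  apply: le_trans (ler_norm _) _; rewrite -(@ler_pXn2r _ 2)// ?nnegrE//.
  rewrite real_normK ?num_real//; apply: le_trans h.
  by rewrite /char_sqr lerDl sqr_ge0.
have c0 : 0 <= n%:R + n%:R ^+ 2 * eta :> R.
  by rewrite addr_ge0// mulr_ge0// sqr_ge0.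
pose F (i i' : 'I_N) w := if i' != i then fejer n (X i i' w) else 0.
have F0 i i' w : 0 <= F i i' w by rewrite /F; case: ifP => // _; exact: fejer_ge0.
have mF i i' : measurable_fun [set: Omega] (F i i').
  by rewrite /F; case: (i' != i) => //; exact: fejer_measurable.
have EF i i' : (\int[P]_w (F i i' w)%:E <= (n%:R + n%:R ^+ 2 * eta)%:E)%E.
  rewrite /F; case: (boolP (i' != i)) => [/EX //|_].
  by rewrite integral0 lee_fin.
pose Q w := \sum_(i < N) \sum_(i' < N) F i i' w.
have Q0 w : 0 <= Q w by apply: sumr_ge0 => i _; exact: sumr_ge0.
have mQi i : measurable_fun [set: Omega] (fun w => \sum_(i' < N) F i i' w).
  exact: measurable_sum.
have mQ : measurable_fun [set: Omega] Q by exact: measurable_sum.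
have EQ : (\int[P]_w (Q w)%:E <= (N%:R * (N%:R * (n%:R + n%:R ^+ 2 * eta)))%:E)%E.
  apply: expectation_sum_le => // [i w|i]; first exact: sumr_ge0.
  exact: expectation_sum_le.
have t0 : 0 < (n%:R / 2) ^+ 2 :> R by rewrite exprn_gt0// divr_gt0.
apply: le_trans (markov_ge0 mQ Q0 t0 EQ).
apply: le_measure; rewrite ?inE.
- exact: ess_deviation_measurable.
- have := mQ measurableT `[(n%:R / 2) ^+ 2, +oo[%classic (measurable_itv _).
  rewrite setTI (_ : _ @^-1` _ = [set x | ((n%:R / 2) ^+ 2 <= Q x)%R])//.
  by apply/seteqP; split => x /=; rewrite in_itv/= andbT.
move=> w /=; apply: contraTT; rewrite -!ltNge => Qw.
apply: le_lt_trans epsK.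
apply: (@ess_dominated _ _ (weights w) (expR (- K)) N0 (expR_ge0 _)).
- by move=> i; exact: expR_gt0.
- move=> i i' ii'; rewrite /weights -!expRD !ler_expR.
  have : K < `|log_weight i w - log_weight i' w|.
    rewrite ltNge; apply/negP => hK.
    have : (n%:R / 2) ^+ 2 <= Q w.
      rewrite /Q (bigD1 i)//= (bigD1 i')//= -addrA.
      apply: ler_wpDr.
        by rewrite addr_ge0// sumr_ge0// => i1 _; exact: sumr_ge0.
      rewrite /F eq_sym ii'.
      apply: (fejer_near0 cosv).
      rewrite /X mulrA.
      have -> : n%:R * tau = v0 / K by rewrite /tau; field; rewrite !gt_eqF.
      by rewrite normrM (gtr0_norm (divr_gt0 v00 K0)) mulrAC ler_pdivrMr// ler_wpM2l// ltW.
    by rewrite leNgt Qw.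
  by rewrite lter_normr => /orP[h|h]; [right|left]; lra.
- by rewrite -expR0 ler_expR oppr_le0 ltW.
Qed.

End fixed_system.
End particle_system.

(** * Tempered densities *)

Section density.
Context d (T : measurableType d) (R : realType).
Variables (m nu : {measure set T -> \bar R}) (h : T -> R).
Hypothesis mh : measurable_fun [set: T] h.
Hypothesis h0 : forall x, 0 <= h x.
Hypothesis nuE : forall A, measurable A -> (nu A = \int[m]_(x in A) (h x)%:E)%E.
Import HBNNSimple.
Local Open Scope ereal_scope.

Let mEh : measurable_fun [set: T] (fun x => (h x)%:E).
Proof. exact/measurable_EFinP. Qed.

Let integral_density_nnsfun (f : {nnsfun T >-> R}) :
  \int[nu]_x (f x)%:E = \int[m]_x ((f x)%:E * (h x)%:E).
Proof.
under eq_integral do rewrite fimfunE -fsumEFin//.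
rewrite ge0_integral_fsum//; last 2 first.
- by move=> r; exact/measurable_EFinP/measurableT_comp.
- by move=> n x _; rewrite EFinM nnfun_muleindic_ge0.
under [RHS]eq_integral.
  move=> x _; rewrite muleC fimfunE -fsumEFin// ge0_mule_fsumr; last first.
    by move=> r; rewrite EFinM nnfun_muleindic_ge0.
  over.
rewrite [RHS]ge0_integral_fsum//; last 2 first.
- move=> r; apply: emeasurable_funM => //.
  by apply/measurable_EFinP; exact: measurableT_comp.
- by move=> r x _; apply: mule_ge0; rewrite ?lee_fin// -lee_fin EFinM nnfun_muleindic_ge0.
apply: eq_fsbigr => r _.
rewrite integralZl_indic_nnsfun// integral_indic// setIT.
have mfr : measurable (f @^-1` [set r]) by [].
under [RHS]eq_integral do rewrite EFinM muleCA.
have [r0|r0] := leP 0%R r; last first.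
  rewrite preimage_nnfun0// measure0 mule0.
  by under eq_integral do rewrite indic0 mule0 mule0; rewrite integral0.
rewrite ge0_integralZl_EFin//; last 2 first.
- by move=> x _; rewrite mule_ge0 ?lee_fin.
- by apply: emeasurable_funM => //; exact/measurable_EFinP.
congr (_ * _); rewrite nuE// integral_mkcond; apply: eq_integral => x _.
by rewrite patchE indicE; case: ifP; rewrite ?mule1 ?mule0.
Qed.

Lemma integral_density (f : T -> \bar R) : measurable_fun [set: T] f ->
  (forall x, 0 <= f x) -> \int[nu]_x f x = \int[m]_x (f x * (h x)%:E).
Proof.
move=> mf f0; pose f_ := nnsfun_approx measurableT mf.
have fE x : f x = limn (fun n => (f_ n x)%:E).
  by apply/esym/cvg_lim => //; exact: cvg_nnsfun_approx.
transitivity (limn (fun n => \int[nu]_x (f_ n x)%:E)).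
  rewrite -monotone_convergence//=.
  - by apply: eq_integral => x _; exact: fE.
  - by move=> n; exact/measurable_EFinP.
  - by move=> n x _; rewrite lee_fin.
  - by move=> x _ a b ab; rewrite lee_fin; exact/lefP/nd_nnsfun_approx.
transitivity (limn (fun n => \int[m]_x ((f_ n x)%:E * (h x)%:E))); last first.
  rewrite -monotone_convergence//=.
  - apply: eq_integral => x _; apply/cvg_lim => //; apply: cvgeZr => //.
    exact: cvg_nnsfun_approx.
  - by move=> n; apply: emeasurable_funM => //; exact/measurable_EFinP.
  - by move=> n x _; rewrite mule_ge0 ?lee_fin.
  - by move=> x _ a b ab; rewrite lee_wpmul2r ?lee_fin//; exact/lefP/nd_nnsfun_approx.
by congr (limn _); apply/funext => n; exact: integral_density_nnsfun.
Qed.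

End density.

Lemma integral_density_real d (T : measurableType d) (R : realType)
    (m nu : {measure set T -> \bar R}) (h f : T -> R) :
  measurable_fun [set: T] h -> (forall x, 0 <= h x) ->
  (forall A, measurable A -> nu A = \int[m]_(x in A) (h x)%:E)%E ->
  nu.-integrable setT (EFin \o f) ->
  m.-integrable setT (EFin \o (fun x => f x * h x)) /\
  \int[nu]_x f x = \int[m]_x (f x * h x).
Proof.
move=> mh h0 nuE /integrableP[mEf fi].
have mf : measurable_fun [set: T] f by exact/measurable_EFinP.
split.
  apply/integrableP; split; first by apply/measurable_EFinP; exact: measurable_funM.
  rewrite (le_lt_trans _ fi)// (integral_density mh h0 nuE)//; last first.
    exact: measurableT_comp.
  rewrite le_eqVlt; apply/orP; left; apply/eqP; apply: eq_integral => x _ /=.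
  by rewrite -EFinM normrM (ger0_norm (h0 x)).
rewrite /Rintegral; congr fine; rewrite integralE [RHS]integralE.
rewrite !(integral_density mh h0 nuE)//; last 2 first.
- exact: measurable_funeneg.
- exact: measurable_funepos.
congr (_ - _)%E; apply: eq_integral => x _.
- by rewrite !funeposE -!EFin_max -EFinM maxr_pMl// mul0r.
- by rewrite !funenegE -!EFinN -!EFin_max -EFinM maxr_pMl// mul0r mulNr.
Qed.

(** With [u = g - m], the function [u (exp (tau u) - 1)] is nonnegative and vanishes only where [u]
    does, while equality of the means gives it integral 0 under [P]. *)
Lemma tilted_mean_constant d (T : measurableType d) (R : realType)
    (P Q : {measure set T -> \bar R}) (g : T -> R) (kap tau m : R) :
  P setT = 1%E -> Q setT = 1%E -> measurable_fun [set: T] g ->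
  0 < kap -> 0 < tau ->
  (forall A, measurable A ->
     Q A = \int[P]_(x in A) (kap * expR (tau * g x))%:E)%E ->
  P.-integrable setT (EFin \o g) -> Q.-integrable setT (EFin \o g) ->
  \int[P]_x g x = m -> \int[Q]_x g x = m ->
  exists A, [/\ measurable A, P A = 0%E & forall x, g x != m -> A x].
Proof.
move=> P1 Q1 mg kap0 tau0 QE iP iQ mP mQ.
pose h x := kap * expR (tau * g x).
have h0 x : 0 <= h x by exact: (mulr_ge0 (ltW kap0) (expR_ge0 _)).
have mh : measurable_fun [set: T] h.
  apply: measurable_funM => //; apply: measurableT_comp => //.
  exact: measurable_funM.
pose u x := g x - m.
have cP := bmf_integrable P1 (bmf_cst T m).
have cQ := bmf_integrable Q1 (bmf_cst T m).
have iuP : P.-integrable setT (EFin \o u) by exact: (integrableB measurableT iP cP).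
have iuQ : Q.-integrable setT (EFin \o u) by exact: (integrableB measurableT iQ cQ).
have uP : \int[P]_x u x = 0.
  rewrite /u RintegralB//.
  by rewrite (bexp_cst P1) mP subrr.
have uQ : \int[Q]_x u x = 0.
  rewrite /u RintegralB//.
  by rewrite (bexp_cst Q1) mQ subrr.
have [iuh] := integral_density_real mh h0 QE iuQ; rewrite uQ => uhE.
pose hm := kap * expR (tau * m).
have hm0 : 0 < hm by exact: (mulr_gt0 kap0 (expR_gt0 _)).
have ihu : P.-integrable setT (EFin \o (fun x => hm * u x)).
  exact: (integrableZl measurableT hm iuP).
pose psi x := u x * h x - hm * u x.
have ipsi : P.-integrable setT (EFin \o psi) by exact: (integrableB measurableT iuh ihu).
have psiE x : psi x = hm * (u x * (expR (tau * u x) - 1)).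
  rewrite /psi /h /hm.
  have -> : expR (tau * g x) = expR (tau * m) * expR (tau * u x).
    by rewrite -expRD /u; congr expR; ring.
  by ring.
have psi0 x : 0 <= psi x.
  rewrite psiE; apply: (mulr_ge0 (ltW hm0)); have [ux|ux] := leP 0 (u x).
    by rewrite mulr_ge0// subr_ge0 -expR0 ler_expR mulr_ge0// ltW.
  rewrite mulr_le0 ?ltW// subr_lt0 -expR0 ltr_expR.
  by rewrite pmulr_rlt0.
have psi_neq0 x : u x != 0 -> psi x != 0.
  move=> ux; rewrite psiE; apply: mulf_neq0; first by rewrite gt_eqF.
  apply: (mulf_neq0 ux); rewrite subr_eq0 -expR0 (inj_eq (@expR_inj R)).
  by apply: (mulf_neq0 _ ux); rewrite gt_eqF.
have psi_int : (\int[P]_x `|(psi x)%:E| = 0)%E.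
  have : \int[P]_x psi x = 0.
    by rewrite /psi RintegralB// RintegralZl// -uhE uP mulr0 subr0.
  rewrite /Rintegral => h'; under eq_integral do rewrite gee0_abs ?lee_fin//.
  by rewrite -[LHS]fineK ?h'//; exact: integrable_fin_num.
have mpsi : measurable_fun [set: T] (EFin \o psi) by case/integrableP: ipsi.
have [A [mA A0 uA]] := (ae_eq_integral_abs P measurableT mpsi).1 psi_int.
exists A; split => // x gm; apply: uA => /= /(_ Logic.I)[] /eqP; apply/negP.
by apply: psi_neq0; rewrite subr_eq0.
Qed.

Section tempered_family.
Context {R : realType}.
Local Notation RR := (measurableTypeR R).
Local Notation leb := (@lebesgue_measure R).
Context (g : {mfun RR >-> RR}).
Implicit Types s t : R.

Let mg : measurable_fun [set: RR] (g : RR -> RR).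
Proof. exact: measurable_funPT. Qed.

Let Z s : R := Rintegral leb setT (fun y => expR (s * g y)).

Lemma tempered_normalizer_gt0 s : normalizable g s -> 0 < Z s.
Proof.
move=> ns; rewrite lt_neqAle; apply/andP; split; last first.
  by apply: Rintegral_ge0 => x _; exact: expR_ge0.
apply/eqP => Z0; have := tempered_setT ns.
rewrite /tempered; under eq_integral do rewrite /tempered_pdf -/(Z s) -Z0 invr0 mulr0.
by rewrite integral0 => -[] /eqP; rewrite eq_sym oner_eq0.
Qed.

Lemma tempered_density s t (A : set RR) : normalizable g s -> normalizable g t ->
  measurable A ->
  tempered g t A = (\int[tempered g s]_(x in A)
     (Z s / Z t * expR ((t - s) * g x))%:E)%E.
Proof.
move=> ns nt mA; have Zs := tempered_normalizer_gt0 ns.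
have Zt := tempered_normalizer_gt0 nt.
pose h x := Z s / Z t * expR ((t - s) * g x).
have h0 x : 0 <= h x by exact: (mulr_ge0 (divr_ge0 (ltW Zs) (ltW Zt)) (expR_ge0 _)).
have mh : measurable_fun [set: RR] (h : RR -> RR).
  by apply: measurable_funM => //; exact: measurable_expR_scale.
have mhA : measurable_fun [set: RR] (((fun x => (h x)%:E) \_ A) : RR -> _).
  apply/(measurable_restrictT _ mA).
  by apply: measurable_funTS; exact/measurable_EFinP.
rewrite [RHS]integral_mkcond.
have hA0 x : (0 <= ((fun x => (h x)%:E) \_ A) x)%E.
  by rewrite patchE; case: ifP => // _; rewrite lee_fin.
rewrite (integral_density (measurable_tempered_pdf g s) (tempered_pdf_ge0 g s)
  (m := leb) (nu := tempered g s) (fun A _ => erefl (tempered g s A)) mhA hA0).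
transitivity (\int[leb]_x ((fun x => (tempered_pdf g t x)%:E) \_ A) x)%E.
  exact: integral_mkcond.
apply: eq_integral => x _; rewrite !patchE; case: ifP => _; last by rewrite mul0e.
rewrite -EFinM; congr EFin; rewrite /tempered_pdf -/(Z s) -/(Z t) /h.
have -> : expR (t * g x) = expR ((t - s) * g x) * expR (s * g x).
  by rewrite -expRD; congr expR; ring.
have aux (a b e f : R) : 0 < a -> 0 < b -> e * f / b = f / a * (a / b * e).
  by move=> a0 b0; field; rewrite !gt_eqF.
rewrite [RHS]mulrC; exact: aux.
Qed.

(** As [g] is bounded above, the tempered law at [s >= phi0] has a bounded density with respect to
    the one at [phi0]. *)
Lemma tempered_weight_moment (phi0 c : R) (V : R -> R) s :
  measurable_fun [set: RR] (V : RR -> RR) -> (forall x, 1 <= V x) ->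
  (forall x, g x <= c) -> normalizable g phi0 -> normalizable g s -> phi0 <= s ->
  (\int[tempered g phi0]_x (V x)%:E < +oo)%E -> Vprob V (tempered g s).
Proof.
move=> mV V1 gc n0 ns s0 VI; split; first exact: tempered_setT.
have Zs := tempered_normalizer_gt0 ns.
have Z0 := tempered_normalizer_gt0 n0.
have V0 x : 0 <= V x by exact: le_trans (V1 x).
pose h x := Z phi0 / Z s * expR ((s - phi0) * g x).
have h0 x : 0 <= h x by exact: (mulr_ge0 (divr_ge0 (ltW Z0) (ltW Zs)) (expR_ge0 _)).
have mh : measurable_fun [set: RR] (h : RR -> RR).
  by apply: measurable_funM => //; exact: measurable_expR_scale.
rewrite (integral_density mh h0 (m := tempered g phi0)).
- pose B := Z phi0 / Z s * expR ((s - phi0) * c).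
  have B0 : 0 <= B by rewrite /B (mulr_ge0 (divr_ge0 (ltW Z0) (ltW Zs)) (expR_ge0 _)).
  have hB x : h x <= B.
    apply: (ler_wpM2l (divr_ge0 (ltW Z0) (ltW Zs))).
    by rewrite ler_expR ler_wpM2l// subr_ge0.
  apply: (@le_lt_trans _ _ (\int[tempered g phi0]_x (B%:E * (V x)%:E))%E).
    apply: ge0_le_integral => //.
    - by move=> x _; rewrite mule_ge0 ?lee_fin.
    - by apply: emeasurable_funM; exact/measurable_EFinP.
    - by apply: emeasurable_funM => //; exact/measurable_EFinP.
    - by move=> x _; rewrite muleC lee_wpmul2r ?lee_fin.
  rewrite ge0_integralZl_EFin//; first exact: lte_mul_pinfty.
  - by move=> x _; rewrite lee_fin.
  - exact/measurable_EFinP.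
- by move=> A mA; exact: tempered_density.
- exact/measurable_EFinP.
- by move=> x; rewrite lee_fin.
Qed.

Lemma tempered_negligible s (A : set RR) : normalizable g s -> measurable A ->
  tempered g s A = 0%E -> leb A = 0%E.
Proof.
move=> ns mA A0.
have pdf_neq0 x : tempered_pdf g s x != 0.
  apply: mulf_neq0; first by rewrite gt_eqF ?expR_gt0.
  by apply: invr_neq0; rewrite gt_eqF//; exact: tempered_normalizer_gt0.
have : (\int[leb]_(x in A) `|(tempered_pdf g s x)%:E| = 0)%E.
  rewrite -[RHS]A0; apply: eq_integral => x _.
  by rewrite gee0_abs ?lee_fin ?tempered_pdf_ge0.
have mpdf : measurable_fun A (fun x => (tempered_pdf g s x)%:E).
  by apply: measurable_funTS; apply/measurable_EFinP; exact: measurable_tempered_pdf.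
move=> /(ae_eq_integral_abs leb mA mpdf)[B [mB B0 AB]].
apply/eqP; rewrite -measure_le0 -B0; apply: le_measure; rewrite ?inE// => x Ax.
by apply: AB => /= /(_ Ax)[] /eqP; rewrite (negbTE (pdf_neq0 x)).
Qed.

Lemma tempered_mean_inj s t : s < t -> normalizable g s -> normalizable g t ->
  (tempered g s).-integrable setT (EFin \o (g : R -> R)) ->
  (tempered g t).-integrable setT (EFin \o (g : R -> R)) ->
  \int[tempered g t]_x g x != \int[tempered g s]_x g x.
Proof.
move=> st ns nt is_ it; apply/eqP => mE.
pose m := \int[tempered g s]_x g x.
have [A [mA A0 gA]] := @tilted_mean_constant _ RR R (tempered g s) (tempered g t)
  g (Z s / Z t) (t - s) m (tempered_setT ns) (tempered_setT nt) mg
  (divr_gt0 (tempered_normalizer_gt0 ns) (tempered_normalizer_gt0 nt))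
  (etrans (subr_gt0 s t) st) (fun A mA => tempered_density ns nt mA) is_ it
  erefl mE.
have lA := tempered_negligible ns mA A0.
clearbody m; clear mE is_ it A0 st nt.
have : (\int[leb]_x (expR (s * g x))%:E = \int[leb]_x (expR (s * m))%:E)%E.
  apply: ae_eq_integral => //.
    by apply/measurable_EFinP; exact: measurable_expR_scale.
  exists A; split => // x /= /not_implyP[_ ne]; apply: gA.
  by apply/eqP => gm; apply: ne; rewrite gm.
move=> e; move: ns; rewrite /normalizable e integral_cst//.
have lT : leb setT = +oo%E by rewrite -set_itvNyy lebesgue_measure_itv.
by rewrite [X in (_ * X)%E]lT gt0_muley ?ltxx// lte_fin expR_gt0.
Qed.

End tempered_family.

(** * Consequences of the hypotheses *)

Section invariance.
Context {R : realType}.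
Local Notation RR := (measurableTypeR R).

Lemma invariant_integral (mu : {measure set RR -> \bar R})
    (K : R.-pker RR ~> RR) : mu setT = 1%E -> invariant_kernel mu K ->
  forall f : RR -> \bar R, measurable_fun [set: RR] f -> (forall x, 0 <= f x)%E ->
  (\int[mu]_x \int[K x]_y f y = \int[mu]_x f x)%E.
Proof.
move=> mu1 inv f mf f0.
(* Repackages [mu], of mass 1, as a probability that can serve as a constant kernel; the Dirac mass
   is the default for measures that cannot be normalized. *)
pose Q := mnormalize mu (\d_ (0 : RR)).
have QE A : Q A = mu A.
  by rewrite /Q /mnormalize mu1 /= eqe oner_eq0 /= invr1 mule1.
have := @integral_kcomp _ _ _ unit RR RR R (@kconst _ _ unit RR R Q)
  (@ksnd _ _ _ unit RR RR R K) tt f f0 mf.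
rewrite /kconst /ksnd /=.
have QmuE h : (\int[Q]_x h x = \int[mu]_x h x)%E.
  by apply: eq_measure_integral => A mA _; exact: QE.
rewrite (QmuE (fun x => \int[K x]_y f y)%E) => <-; apply: eq_measure_integral => A mA _.
exact: (etrans (QmuE (fun x => K x A)) (inv A mA)).
Qed.

Lemma powR_growth (V : R -> R) (f : R -> R) (r : R) : (forall x, 1 <= V x) ->
  0 <= r < 1 / 2 -> LV (fun x => V x `^ r) f ->
  exists G : R, forall x, `|f x| <= G * sqrtV V x.
Proof.
move=> V1 /andP[r0 r2] ; rewrite /LV; set n := Vnorm _ f => fV.
have V0 x : 0 < V x by exact: lt_le_trans (V1 x).
have le_n x : ((`|f x| / V x `^ r)%:E <= n)%E.
  by apply: ereal_sup_ubound; exists x.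
have n0 : (0 <= n)%E.
  by apply: le_trans (le_n 0); rewrite lee_fin divr_ge0// powR_ge0.
have nfin : n \is a fin_num by rewrite ge0_fin_numE.
exists (fine n) => x.
have fn0 : 0 <= fine n by exact: fine_ge0.
apply: (@le_trans _ _ (fine n * V x `^ r)).
  by rewrite -ler_pdivrMr ?powR_gt0// -lee_fin fineK.
rewrite ler_wpM2l// /sqrtV -powR12_sqrt ?(ltW (V0 x))//.
apply: ler_powR => //.
by rewrite ltW// (lt_le_trans r2)// div1r.
Qed.

Lemma drift_minor_of_conditions (phi0 : R) (g : {mfun RR >-> RR})
    (k : R -> R.-pker RR ~> RR) (C : set RR) (V : R -> R) : 0 < phi0 < 1 ->
  uniform_minorization phi0 k C -> uniform_drift phi0 g k C V ->
  Lipschitz_perturbation phi0 k V ->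
  exists (nu : probability RR R) (theta lam b M : R),
    drift_minor (Sphi phi0) k V C nu theta lam b M.
Proof.
move=> /andP[f0 f1] [mC [theta [nu [th01 minor]]]].
move=> [mV V1 _ [lambda [b [lambda1 drift]]] _] [M lip].
have V0 x : 0 <= V x by exact: le_trans (V1 x).
(* Enlarging the constants preserves the drift inequality and makes both positive. *)
pose lam := Num.max lambda (1 / 2); pose b' := `|b| + 1.
have lam01 : 0 < lam < 1.
  have h0 : 0 < 1 / 2 :> R by lra.
  have h1 : 1 / 2 < 1 :> R by lra.
  by rewrite /lam lt_max gt_max lambda1 h0 h1 orbT.
have b0 : 0 < b' by rewrite ltr_wpDl.
have drift' s x : Sphi phi0 s ->
    (kact (k s) V x <= (lam * V x + b' * \1_C x)%:E)%E.
  move=> Ss; apply: le_trans (drift x s Ss) _; rewrite lee_fin lerD//.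
    by rewrite ler_wpM2r// le_max lexx.
  apply: ler_wpM2r; first by rewrite indicE; case: (x \in C).
  by rewrite (le_trans (ler_norm b))// lerDl.
have S1 : Sphi phi0 1 by rewrite /Sphi /= f1 lexx.
(* Were [C] empty, [k 1] would contract [V] by the factor [lam] everywhere, which fails where [V] is
   close to its infimum. *)
have [x Cx] : exists x, C x.
  apply: contrapT => /forallNP C0; have /andP[lam0 lam1] := lam01.
  pose v := inf (range V).
  have hv : has_inf (range V).
    by split; [exists (V 0), 0|exists 1 => _ [x _ <-]].
  have v1 : 1 <= v.
    by apply: lb_le_inf; [exists (V 0), 0|move=> _ [x _ <-]].
  have vV x : v <= V x by apply: ge_inf; [exact: hv.2|exists x].
  have e0 : 0 < (lam^-1 - 1) * v.
    rewrite mulr_gt0 ?subr_gt0 ?invf_gt1//; exact: lt_le_trans v1.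
  have [_ [x _ <-] Vx] := inf_adherent e0 hv.
  have : (v%:E <= kact (k 1%R) V x)%E.
    rewrite /kact -[leLHS]mule1 -(@prob_kernel _ _ _ _ _ (k 1) x) -integral_cst//.
    apply: ge0_le_integral => //.
    - by move=> y _; rewrite lee_fin (le_trans _ v1).
    - exact/measurable_EFinP.
    - by move=> y _; rewrite lee_fin.
  move=> /le_trans/(_ (drift' 1 x S1)); rewrite lee_fin indicE memNset//.
  rewrite mulr0 addr0 leNgt -/v => /negP; apply.
  move: Vx; rewrite -/v -[X in X + _]mul1r -mulrDl addrCA subrr addr0.
  by rewrite mulrC ltr_pdivlMr// mulrC.
exists nu, theta, lam, b', `|M|; split => //.
- move=> s t Ss St; apply: le_trans (lip s t Ss St) _.
  by rewrite lee_fin ler_wpM2r// ler_norm.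
(* At a point of [C] the measure [theta * nu] is dominated by [k 1 x], under which [V] is
   integrable. *)
- have /andP[th0 _] := th01.
  pose th : {nonneg R} := NngNum (ltW th0).
  have mEV : measurable_fun [set: RR] (fun y => (V y)%:E) by exact/measurable_EFinP.
  have EV0 (y : RR) : (0 <= (V y)%:E)%E by rewrite lee_fin.
  have dom (A : set RR) : measurable A -> (mscale th nu A <= k 1%R x A)%E.
    by move=> mA; exact: minor.
  have := ge0_le_measure_integral dom measurableT EV0 mEV.
  rewrite ge0_integral_mscale//= => /le_lt_trans-/(_ +oo%E).
  move=> /(_ (le_lt_trans (drift' 1 x S1) (ltry _))).
  by apply: contraTT; rewrite -!leNgt !leye_eq => /eqP ->; rewrite gt0_muley.
Qed.

Lemma invariant_kop (S : set R) (k : R -> R.-pker RR ~> RR) (V : R -> R)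
    (C : set RR) (nu : probability RR R) (theta lam b M : R)
    (D : drift_minor S k V C nu theta lam b M)
    (mu : {measure set RR -> \bar R}) s : S s -> Vprob V mu ->
  invariant_kernel mu (k s) ->
  forall f, Vdom V f -> \int[mu]_x kop k s f x = \int[mu]_x f x.
Proof.
move=> Ss pmu inv f df; have [mf [c fc]] := df.
have mV := dm_mV D; have V1 := dm_V1 D.
have c0 : 0 <= c.
  by have := le_trans (normr_ge0 _) (fc 0); rewrite pmulr_lge0// (lt_le_trans _ (V1 0)).
have pos h : Vdom V h -> (forall x, 0 <= h x) ->
    \int[mu]_x kop k s h x = \int[mu]_x h x.
  move=> dh h0; have dk := kop_dom D Ss dh.
  apply: EFin_inj; rewrite -(Vdom_integralE mV V1 pmu dk).
  rewrite -(Vdom_integralE mV V1 pmu dh).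
  have mEh : measurable_fun [set: RR] (fun x => (h x)%:E).
    by have [mh _] := dh; exact/measurable_EFinP.
  have Eh0 (x : RR) : (0 <= (h x)%:E)%E by rewrite lee_fin.
  rewrite -(invariant_integral pmu.1 inv mEh Eh0).
  by apply: eq_integral => x _; rewrite -(kopE D x Ss dh).
have dcV : Vdom V (fun x => c * V x) by apply: VdomZ; exact: VdomV.
have cV0 x : 0 <= c * V x by rewrite mulr_ge0// (le_trans _ (V1 x)).
have fcV0 x : 0 <= f x + c * V x.
  by have /ler_normlP[h _] := fc x; rewrite -lerBlDr sub0r lerNl.
have e1 := pos _ (VdomD df dcV) fcV0; have e2 := pos _ dcV cV0.
have kfc x : kop k s (fun y => f y + c * V y) x =
    kop k s f x + kop k s (fun y => c * V y) x by exact: (kopD D).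
have dkf := kop_dom D Ss df; have dkc := kop_dom D Ss dcV.
move: e1; under eq_Rintegral do rewrite kfc.
rewrite (VintD mV V1 pmu dkf dkc) (VintD mV V1 pmu df dcV) e2.
exact: addIr.
Qed.

End invariance.

Lemma separated_parameter_exists (R : realType) (phi0 : R)
    (g : {mfun measurableTypeR R >-> measurableTypeR R})
    (k : R -> R.-pker measurableTypeR R ~> measurableTypeR R) (V : R -> R)
    (C : set (measurableTypeR R)) (nu : probability (measurableTypeR R) R)
    (theta lam b M c G : R) : 0 < phi0 < 1 ->
  drift_minor (Sphi phi0) k V C nu theta lam b M ->
  (forall x, g x <= c) -> (forall x, `|g x| <= G * sqrtV V x) ->
  (forall s, phi0 <= s <= 1 -> normalizable g s) ->
  (forall s, phi0 < s <= 1 -> invariant_kernel (tempered g s) (k s)) ->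
  (\int[tempered g phi0]_x (V x)%:E < +oo)%E ->
  exists2 s0, Sphi phi0 s0 & separated_blocks k C nu g s0.
Proof.
move=> /andP[f0 f1] D gc gG norm inv VI.
have mV := dm_mV D; have V1 := dm_V1 D.
have n0 : normalizable g phi0 by apply: norm; rewrite lexx ltW.
have mg : measurable_fun [set: measurableTypeR R] (g : measurableTypeR R -> _).
  exact: measurable_funPT.
have ns s : Sphi phi0 s -> normalizable g s.
  by move=> /andP[s0 s1]; apply: norm; rewrite s1 ltW.
have pV s : Sphi phi0 s -> Vprob V (tempered g s).
  move=> Ss; apply: (tempered_weight_moment mV V1 gc n0 (ns s Ss) _ VI).
  by case/andP: Ss => /ltW.
have dg : Vdom V g.
  split=> //; exists G => x; rewrite (le_trans (gG x))// ler_wpM2l//.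
    have := le_trans (normr_ge0 _) (gG 0); rewrite pmulr_lge0// sqrtr_gt0.
    exact: lt_le_trans (V1 0).
  have V0 : 0 <= V x by exact: le_trans (V1 x).
  rewrite /sqrtV -[leRHS](sqr_sqrtr V0) expr2 ler_peMr// -[leLHS]sqrtr1.
  by rewrite ler_sqrt// (lt_le_trans _ (V1 x)).
have ident s (Ss : Sphi phi0 s) := mean_identification D mg gG Ss (pV s Ss)
  (invariant_kop D Ss (pV s Ss) (inv s Ss)).
have S1 : Sphi phi0 1 by rewrite /Sphi /= f1 lexx.
have [c1 H1] := ident 1 S1.
have [tau tau0 H] := separated_blocks_exists D mg gG S1 H1.
(* Strictly between [phi0] and 1 and within [tau] of 1, so that the means of [g] at [t] and at 1
   differ. *)
pose t := Num.max ((1 + phi0) / 2) (1 - tau).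
have t1 : t < 1 by rewrite gt_max; apply/andP; split; lra.
have St : Sphi phi0 t.
  by rewrite /Sphi /= (ltW t1) andbT lt_max; apply/orP; left; lra.
have [ct Ht] := ident t St.
have dist : `|1 - t| <= tau.
  rewrite gtr0_norm ?subr_gt0// lerBlDr -lerBlDl.
  by rewrite le_max lexx orbT.
have int_g s : Sphi phi0 s -> (tempered g s).-integrable setT (EFin \o (g : R -> R)).
  by move=> Ss; exact: (Vdom_integrable mV V1 (pV s Ss) dg).
have := H t _ ct St Ht dist.
have ne := tempered_mean_inj t1 (ns t St) (ns 1 S1) (int_g t St) (int_g 1 S1).
by rewrite eq_sym => /(_ ne) [h|h]; [exists 1|exists t].
Qed.

(** * Growth of the number of bridging steps against the dimension *)

Section limits.
Context {R : realType}.

Lemma ereal_cvg0 (f : nat -> \bar R) : (forall n, 0 <= f n)%E ->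
  (forall e : R, 0 < e -> exists n0, forall n, (n0 <= n)%N -> (f n <= e%:E)%E) ->
  f n @[n --> \oo] --> 0%E.
Proof.
move=> f0 H.
have fin n e : (f n <= e%:E)%E -> f n \is a fin_num.
  by move=> h; rewrite ge0_fin_numE// (le_lt_trans h)// ltry.
apply/fine_cvgP; split.
  have [n0 Hn] := H 1 ltr01; exists n0 => // n /= /Hn; exact: fin.
apply/cvgrPdist_le => e e0; have [n0 Hn] := H e e0.
exists n0 => // n /= /Hn h; rewrite sub0r normrN ger0_norm ?fine_ge0//.
by rewrite -lee_fin fineK//; exact: fin h.
Qed.

Lemma powR_diverges (al : R) : 0 < al -> forall A : R,
  exists d0, forall d, (d0 <= d)%N -> A <= d%:R `^ al.
Proof.
move=> al0 A; pose B := Num.max A 1.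
have B0 : 0 < B by rewrite lt_max ltr01 orbT.
exists (Num.truncn (B `^ (al^-1))).+1 => d dd.
have h : B `^ (al^-1) <= d%:R.
  by rewrite ltW// (lt_le_trans (truncnS_gt _))// ler_nat.
apply: (@le_trans _ _ B); first by rewrite le_max lexx.
have BE : (B `^ al^-1) `^ al = B.
  by rewrite -powRrM mulVf ?powRr1 ?(ltW B0)// gt_eqF.
rewrite -BE; apply: (ge0_ler_powR (ltW al0)) => //; rewrite nnegrE ?powR_ge0//.
Qed.

Section steps.
Context (delta : R) (delta_gt : -1 < delta).
Local Notation p d := (bridging_steps delta d).

Lemma bridging_steps_diverges (n : nat) :
  exists d0, forall d, (d0 <= d)%N -> (n <= p d)%N.
Proof.
have h : 0 < 1 + delta by rewrite -ltrBlDl sub0r.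
have [d0 H] := powR_diverges h n%:R.
by exists d0 => d /H nd; rewrite /bridging_steps truncn_ge_nat ?powR_ge0.
Qed.

Lemma powR1D (d : nat) : (0 < d)%N -> d%:R `^ (1 + delta) = d%:R * d%:R `^ delta.
Proof.
by move=> d0; rewrite powRD ?powRr1// pnatr_eq0 -lt0n d0 implybT.
Qed.

Lemma dim_over_steps (e : R) : 0 < delta -> 0 < e ->
  exists d0, forall d, (d0 <= d)%N -> d%:R <= e * (p d)%:R.
Proof.
move=> delta0 e0; have [d0 H] := powR_diverges delta0 (e^-1 + 1).
exists (maxn 1 d0) => d; rewrite geq_max => /andP[d1 /H h].
have dR : 1 <= d%:R :> R by rewrite ler1n.
have pd : d%:R * d%:R `^ delta < (p d)%:R + 1.
  by rewrite -powR1D// /bridging_steps natr1 truncnS_gt.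
have : d%:R * (e^-1 + 1) <= d%:R * d%:R `^ delta by rewrite ler_wpM2l// (le_trans _ dR).
have : d%:R * (e^-1 + 1) = d%:R / e + d%:R by rewrite mulrDr mulr1.
move=> -> h2; rewrite -ler_pdivrMl// mulrC; lra.
Qed.

Lemma steps_over_dim (rho : R) : delta < 0 -> 0 < rho ->
  exists d0, forall d, (d0 <= d)%N -> rho * (p d)%:R <= d%:R.
Proof.
move=> delta0 rho0; have nd0 : 0 < - delta by rewrite oppr_gt0.
have [d0 H] := powR_diverges nd0 rho.
exists (maxn 1 d0) => d; rewrite geq_max => /andP[d1 /H h].
have dR : 0 < d%:R :> R by rewrite ltr0n.
have pd : (p d)%:R <= d%:R * d%:R `^ delta.
  by rewrite -powR1D// /bridging_steps truncn_le powR_ge0.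
apply: le_trans (ler_wpM2l (ltW rho0) pd) _.
have x0 : 0 < d%:R `^ delta by exact: powR_gt0.
rewrite mulrCA; apply: (ler_piMr (ltW dR)).
apply: (le_trans (ler_wpM2r (ltW x0) h)).
by rewrite -powRD ?addNr ?powRr0// eqxx /= pnatr_eq0 -lt0n.
Qed.

End steps.
End limits.

(** * Asymptotics *)

Section asymptotics.
Context {R : realType}.
Local Notation RR := (measurableTypeR R).
Context (phi0 : R) (phi01 : 0 < phi0 < 1).
Context (k : R -> R.-pker RR ~> RR) (V : R -> R)
  (C : set RR) (nu : probability RR R) (theta lam b M : R)
  (D : drift_minor (Sphi phi0) k V C nu theta lam b M).
Context (g : R -> R) (mg : measurable_fun [set: RR] (g : RR -> RR)).
Context (mu : {measure set RR -> \bar R}) (pmu : Vprob V mu).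
Context (N : nat) (N0 : (0 < N)%N).

Lemma ess_balanced_asymptotics (G eps e : R) :
  (forall x, `|g x| <= G * sqrtV V x) -> 0 < eps -> 0 < e ->
  exists p0, exists2 r : R, 0 < r & forall p dim, (p0 <= p)%N ->
    dim%:R <= r * p%:R ->
  forall (d : measure_display) (Omega : measurableType d)
    (P : probability Omega R) (Y : 'I_N * 'I_dim -> nat -> Omega -> RR),
  particle_system phi0 k mu P p Y ->
  (P [set w | (eps <= `|ess (weights phi0 g p Y w) - N%:R|)%R] <= e%:E)%E.
Proof.
move=> gG eps0 e0.
have NR : 0 < N%:R :> R by rewrite ltr0n.
have [B B0 [p0 H]] := chain_second_moment phi01 D mg pmu gG.
pose x := eps / N%:R; have x0 : 0 < x by exact: divr_gt0.
have lnx : 0 < ln (1 + x) by rewrite ln_gt0// ltrDl.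
(* [exp (4 * eta) < 1 + eps / N] is required; here [4 * eta] is half of the logarithm. *)
pose eta := ln (1 + x) / 8; have eta0 : 0 < eta by exact: divr_gt0.
have etaE : N%:R * (expR (2 * eta) ^+ 2 - 1) < eps.
  rewrite mulrC -ltr_pdivlMr// ltrBlDl -/x expr2 -expRD.
  rewrite -[ltRHS]lnK ?posrE ?addr_gt0// ltr_expR /eta.
  by move: lnx; set y := ln _ => lnx; lra.
pose K := N%:R * B / eta ^+ 2 + 1.
have K0 : 0 < K.
  by rewrite ltr_wpDl// divr_ge0 ?sqr_ge0// mulr_ge0// ltW.
exists (maxn 1 p0), (e / K); first exact: divr_gt0.
move=> p dim; rewrite geq_max => /andP[p1 pp0] dimp d Omega P Y YPS.
have [a Ha] := H p pp0.
have pR : 0 < p%:R :> R by rewrite ltr0n.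
have Bp0 : 0 <= B * p%:R by rewrite mulr_ge0// ltW.
apply: (le_trans (balanced_deviation phi01 D mg pmu N0 p1 YPS eta0 Bp0
  (fun ij => Ha _ _ _ _ (YPS.1 ij)) etaE)).
rewrite lee_fin.
have -> : N%:R * (dim%:R * (B * p%:R)) / (p%:R * eta) ^+ 2 =
    N%:R * B / eta ^+ 2 * (dim%:R / p%:R).
  by field; rewrite !gt_eqF.
have dp : dim%:R / p%:R <= e / K by rewrite ler_pdivrMr.
apply: (@le_trans _ _ (K * (dim%:R / p%:R))).
  by rewrite ler_wpM2r ?divr_ge0// /K lerDl.
by rewrite mulrC -ler_pdivlMr.
Qed.

Lemma ess_dominated_asymptotics (s0 eps e : R) :
  Sphi phi0 s0 -> separated_blocks k C nu g s0 -> 0 < eps -> 0 < e ->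
  exists p0, exists2 r : R, 0 < r & forall p dim, (p0 <= p)%N ->
    r * p%:R <= dim%:R ->
  forall (d : measure_display) (Omega : measurableType d)
    (P : probability Omega R) (Y : 'I_N * 'I_dim -> nat -> Omega -> RR),
  particle_system phi0 k mu P p Y ->
  (P [set w | (eps <= `|ess (weights phi0 g p Y w) - 1|)%R] <= e%:E)%E.
Proof.
move=> Ss0 sep eps0 e0.
have NR : 0 < N%:R :> R by rewrite ltr0n.
have [c c0 H] := chain_char_sqr phi01 D mg pmu Ss0 sep.
have [v0 v00 cosv'] := @cos_near0 R.
have cosv v : `|v| <= v0 -> 1 / 2 <= cos v by move=> /cosv' /andP[].
(* With [u = N q <= 1 / 2], [(1 + u) ^ 2 - 1 <= 5 u / 2 <= 5 eps / 12]. [Kk] is the gap between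
   log-weights that corresponds to the ratio [q]. *)
pose q := Num.min (1 / (2 * N%:R)) (eps / (6 * N%:R)).
have q0 : 0 < q by rewrite lt_min !divr_gt0// mulr_gt0.
have q1 : N%:R * q <= 1 / 2.
  rewrite mulrC -ler_pdivlMr// ge_min; apply/orP; left.
  by rewrite le_eqVlt; apply/orP; left; apply/eqP; field; rewrite gt_eqF.
have q2 : N%:R * q <= eps / 6.
  rewrite mulrC -ler_pdivlMr// ge_min; apply/orP; right.
  by rewrite le_eqVlt; apply/orP; left; apply/eqP; field; rewrite gt_eqF.
have N1 : 1 <= N%:R :> R by rewrite ler1n.
have Nq0 : 0 < N%:R * q by exact: mulr_gt0.
have qlt1 : q < 1.
  have : q <= N%:R * q by rewrite ler_peMl// ltW.
  by move=> /le_trans/(_ q1)/le_lt_trans; apply; lra.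
pose Kk := - ln q; have K0 : 0 < Kk by rewrite oppr_gt0 ln_lt0// q0.
have epsK : (1 + N%:R * expR (- Kk)) ^+ 2 - 1 < eps.
  rewrite /Kk opprK lnK ?posrE//.
  have aux (u : R) : 0 < u -> u <= 1 / 2 -> u <= eps / 6 -> (1 + u) ^+ 2 - 1 < eps.
    by move=> *; nra.
  exact: aux.
(* With [1 / n <= eta], the bound [4 N ^ 2 (1 / n + eta)] from [dominated_deviation] is at most
   [e / 2]. *)
pose eta := e / (16 * N%:R ^+ 2).
have N2 : 0 < 16 * N%:R ^+ 2 :> R by rewrite mulr_gt0// exprn_gt0.
have eta0 : 0 < eta by exact: divr_gt0.
pose n := (Num.truncn eta^-1).+2.
have nR : 0 < n%:R :> R by rewrite ltr0n.
have neta : n%:R^-1 <= eta.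
  rewrite -[leRHS]invrK lef_pV2 ?posrE ?invr_gt0// ltW//.
  by rewrite (lt_trans (truncnS_gt _))// ltr_nat.
(* The frequencies of the Fejer kernel. The smallest positive one, [a 1], has the weakest decay and
   sets the requirement on [dim / p]. *)
pose a (j : nat) := j%:R * (v0 / (n%:R * Kk)) * (1 - phi0).
have f1 : 0 < 1 - phi0 by rewrite subr_gt0; case/andP: phi01.
have tau0 : 0 < v0 / (n%:R * Kk) by rewrite divr_gt0// mulr_gt0.
have a0 (j : nat) : (0 < j)%N -> 0 < a j.
  by move=> j0; apply: mulr_gt0 => //; apply: mulr_gt0 => //; rewrite ltr0n.
have a1 (j : nat) : (0 < j)%N -> a 1%N <= a j.
  move=> j0; apply: ler_wpM2r; first exact: ltW.
  by apply: ler_wpM2r; [exact: ltW|rewrite ler_nat].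
have Hj (j : nat) : exists p0 : nat, (0 < j)%N -> forall p, (p0 <= p)%N ->
    forall (d : measure_display) (Omega : measurableType d)
      (P : probability Omega R) (Y : nat -> Omega -> RR),
    annealed_chain phi0 k mu P p Y ->
    0 <= 1 - c * a j ^+ 2 / p%:R /\
    char_sqr P (fun w => a j / p%:R * path_sum g Y p w) <=
      (1 - c * a j ^+ 2 / p%:R) ^+ 2.
  case: (posnP j) => [->|j0]; first by exists 0%N.
  by have [p0 Hp0] := H (a j) (a0 j j0); exists p0.
have [p_ Hp] := choice Hj.
pose y := c * a 1%N ^+ 2.
have y0 : 0 < y by apply: mulr_gt0 => //; exact: exprn_gt0 (a0 _ _).
have r0 : 0 < 1 / (2 * y * eta).
  by apply: divr_gt0 => //; apply: mulr_gt0 => //; exact: mulr_gt0.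
exists (maxn 1 (\max_(j < n) p_ j)), (1 / (2 * y * eta)) => //.
move=> p dim; rewrite geq_max => /andP[p1 pp0] dimp d Omega P Y YPS.
have pR : 0 < p%:R :> R by rewrite ltr0n.
have chain_j (j : nat) ij : (0 < j < n)%N -> 0 <= 1 - c * a j ^+ 2 / p%:R /\
    char_sqr P (fun w => a j / p%:R * path_sum g (Y ij) p w) <=
      (1 - c * a j ^+ 2 / p%:R) ^+ 2.
  move=> /andP[j0 jn]; apply: Hp => //; last exact: YPS.1.
  by rewrite (leq_trans _ pp0)// (leq_bigmax (Ordinal jn)).
pose z := 1 - y / p%:R.
have dim0 : (0 < dim)%N.
  rewrite -(ltr_nat R); apply: lt_le_trans dimp.
  exact: mulr_gt0 r0 pR.
have z0 : 0 <= z by have [] := chain_j 1%N (Ordinal N0, Ordinal dim0) isT.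
have zj (j : nat) ij : (0 < j < n)%N ->
    char_sqr P (fun w => a j / p%:R * path_sum g (Y ij) p w) <= z ^+ 2.
  move=> jn; have [u0 h] := chain_j j ij jn; apply: (le_trans h).
  rewrite ler_pXn2r// ?nnegrE// /z lerD2l lerN2 ler_pM2r ?invr_gt0//.
  have /andP[j0 _] := jn.
  rewrite /y ler_pM2l// ler_pXn2r// ?nnegrE ?(ltW (a0 _ _))//.
  exact: a1.
(* [z ^ (2 dim) <= exp (- u)] with [u = 2 dim y / p >= 1 / eta], and [exp (- u) <= 1 / u]. *)
have zexp : z ^+ (dim * 2) <= eta.
  pose u := y / p%:R *+ (dim * 2).
  have u_ge : eta^-1 <= u.
    have aux (x t q' m : R) : 0 < x -> 0 < t -> 0 < q' ->
        1 / (2 * x * t) * q' <= m -> t^-1 <= x / q' * (m * 2).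
      move=> x0 t0 q0' h.
      have -> : t^-1 = (x / q' * 2) * (1 / (2 * x * t) * q') by field; rewrite !gt_eqF.
      have -> : x / q' * (m * 2) = (x / q' * 2) * m by ring.
      by apply: ler_wpM2l h; rewrite mulr_ge0// divr_ge0// ltW.
    by rewrite /u -mulr_natr natrM; exact: aux.
  have u0 : 0 < u by apply: lt_le_trans u_ge; rewrite invr_gt0.
  apply: (@le_trans _ _ (expR (- u))).
    rewrite /u -mulr_natl -mulrN expRM_natl.
    by rewrite lerXn2r ?nnegrE ?expR_ge0// expR_ge1Dx.
  rewrite expRN -[leRHS]invrK lef_pV2 ?posrE ?expR_gt0 ?invr_gt0//.
  by apply: (le_trans u_ge); apply: le_trans (expR_ge1Dx u); rewrite lerDr.
have z2 : (z ^+ 2) ^+ (dim * 2) <= eta ^+ 2.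
  by rewrite exprAC ler_pXn2r// ?nnegrE ?exprn_ge0// ltW.
have h := dominated_deviation mg N0 YPS cosv v00 K0 (isT : (0 < n)%N)
  (sqr_ge0 z) (ltW eta0) z2 zj epsK.
apply: (le_trans h).
rewrite lee_fin.
have -> : N%:R * (N%:R * (n%:R + n%:R ^+ 2 * eta)) / (n%:R / 2) ^+ 2 =
    4 * N%:R ^+ 2 * (n%:R^-1 + eta).
  by field; rewrite gt_eqF.
apply: (@le_trans _ _ (4 * N%:R ^+ 2 * (eta + eta))).
  rewrite ler_wpM2l ?lerD2r// mulr_ge0// sqr_ge0.
have -> : 4 * N%:R ^+ 2 * (eta + eta) = e / 2 by rewrite /eta; field; rewrite gt_eqF.
by rewrite ler_pdivrMr// ler_peMr ?ler1n// ltW.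
Qed.

End asymptotics.

Lemma smc_ess_weights (R : realType) (phi0 : R)
    (g : {mfun measurableTypeR R >-> measurableTypeR R}) (N dim p : nat)
    (d : measure_display) (Omega : measurableType d) (P : probability Omega R)
    (X : 'I_N -> 'I_dim -> nat -> {RV P >-> measurableTypeR R}) :
  ESS g phi0 p X =
  (fun w => ess (weights phi0 g p (fun ij => X ij.1 ij.2 : nat -> Omega -> _) w)).
Proof.
apply/funext => w; rewrite /ESS /ess.
have wE i : smc_weight g phi0 p X i w =
    weights phi0 g p (fun ij => X ij.1 ij.2 : nat -> Omega -> _) w i.
  rewrite /smc_weight /weights /log_weight; congr (expR (_ * _)).
  by apply: eq_bigr => j _; rewrite /path_sum big_add1 /= big_mkord.
by congr (_ ^+ 2 / _); apply: eq_bigr => i _; rewrite wE.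
Qed.

Theorem corollary6p1 (R : realType)
    (g : {mfun measurableTypeR R >-> measurableTypeR R}) (phi0 : R)
    (k : R -> R.-pker measurableTypeR R ~> measurableTypeR R)
    (C : set (measurableTypeR R)) (V : R -> R) (r delta : R) (N : nat)
    (disp : nat -> measure_display)
    (Omega : forall d, measurableType (disp d))
    (P : forall d, probability (Omega d) R)
    (X : forall d, 'I_N -> 'I_d -> nat -> {RV (P d) >-> measurableTypeR R})
    (g_bounded_above : exists c : R, forall x, g x <= c)
    (pi_density : (\int[@lebesgue_measure R]_x (expR (g x))%:E = 1)%E)
    (phi0_range : 0 < phi0 < 1)
    (pi_s_normalizable : forall s, phi0 <= s <= 1 -> normalizable g s)
    (k_invariant : forall s, phi0 < s <= 1 ->
       invariant_kernel (tempered g s) (k s))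
    (k_phi0 : forall x A, measurable A -> k phi0 x A = tempered g phi0 A)
    (minorization : uniform_minorization phi0 k C)
    (drift : uniform_drift phi0 g k C V)
    (perturbation : Lipschitz_perturbation phi0 k V)
    (r_range : 0 <= r < 1 / 2)
    (g_LVr : LV (fun x => V x `^ r) g)
    (delta_gt : -1 < delta)
    (N_gt1 : (1 < N)%N)
    (X_smc : forall d,
       smc_without_resampling g k phi0 (bridging_steps delta d) (X d)) :
  (0 < delta ->
     cvg_in_probability P
       (fun d => ESS g phi0 (bridging_steps delta d) (X d)) N%:R) /\
  (delta < 0 ->
     cvg_in_probability P
       (fun d => ESS g phi0 (bridging_steps delta d) (X d)) 1).
Proof.
have [c gc] := g_bounded_above; have [f0 f1] := andP phi0_range.
have [nu [theta [lam [b [M D]]]]] :=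
  drift_minor_of_conditions phi0_range minorization drift perturbation.
have V1 := dm_V1 D; have mV := dm_mV D.
have [G gG] := powR_growth V1 r_range g_LVr.
have VI : (\int[tempered g phi0]_x (V x)%:E < +oo)%E by case: drift.
have n0 : normalizable g phi0 by apply: pi_s_normalizable; rewrite lexx ltW.
have pmu : Vprob V (tempered g phi0) by split => //; exact: tempered_setT.
have mg : measurable_fun [set: measurableTypeR R] (g : measurableTypeR R -> _).
  exact: measurable_funPT.
have N0 : (0 < N)%N by exact: ltnW.
have sys d : particle_system phi0 k (tempered g phi0) (P d)
    (bridging_steps delta d) (fun ij => X d ij.1 ij.2 : nat -> Omega d -> _).
  have [chains ind] := X_smc d; split=> [ij|//]; split; last exact: chains.
  by move=> n; exact: measurable_funPT.
have cvg0 (l : R) : (forall eps e : R, 0 < eps -> 0 < e -> exists d0, forall d,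
      (d0 <= d)%N ->
      (P d [set w | (eps <= `|ess (weights phi0 g (bridging_steps delta d)
        (fun ij => X d ij.1 ij.2 : nat -> Omega d -> _) w) - l|)%R] <= e%:E)%E) ->
    cvg_in_probability P
      (fun d => ESS g phi0 (bridging_steps delta d) (X d)) l.
  move=> H eps eps0; apply: ereal_cvg0 => [d|e e0]; first exact: measure_ge0.
  have [d0 Hd] := H eps e eps0 e0; exists d0 => d /Hd.
  by rewrite smc_ess_weights.
split => delta0; apply: cvg0 => eps e eps0 e0.
- have [p0 [s s0 H]] :=
    ess_balanced_asymptotics phi0_range D mg pmu N0 gG eps0 e0.
  have [d1 H1] := bridging_steps_diverges delta_gt p0.
  have [d2 H2] := dim_over_steps delta0 s0.
  exists (maxn d1 d2) => d; rewrite geq_max => /andP[/H1 h1 /H2 h2].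
  exact: H (sys d).
- have [s1 Ss1 sep] := separated_parameter_exists phi0_range D gc gG
    pi_s_normalizable k_invariant VI.
  have [p0 [s s0 H]] :=
    ess_dominated_asymptotics phi0_range D mg pmu N0 Ss1 sep eps0 e0.
  have [d1 H1] := bridging_steps_diverges delta_gt p0.
  have [d2 H2] := steps_over_dim delta0 s0.
  exists (maxn d1 d2) => d; rewrite geq_max => /andP[/H1 h1 /H2 h2].
  exact: H (sys d).
Qed.
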